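(* Let $N>2s>1$ with $s\in(\tfrac12,1)$, let $\lambda>0$ and $R_0>0$. Let $p=\frac{N}{N-2s}$ and $q>\frac{N}{N+1-2s}$. Assume that $f\colon(0,\infty)\to(0,\infty)$ is a continuous nondecreasing function satisfying $$\liminf_{t\to0^+}\frac{f(t)}{t^p}>0 .$$ Then there are no positive classical supersolutions $u$ of $$(-\Delta)^s u+|\nabla u|^q=\lambda f(u)\quad\text{in }\mathbb{R}^N\setminus B_{R_0}$$ which do not blow up at infinity.
   Context: $N\ge1$ is an integer and $B_R$ denotes the ball in $\mathbb{R}^N$ of radius $R$ centred at $0$. The fractional Laplacian is $(-\Delta)^s u(x)=C_{N,s}\,\mathrm{P.V.}\int_{\mathbb{R}^N}\frac{u(x)-u(y)}{|x-y|^{N+2s}}\,dy$, with $C_{N,s}>0$ a normalization constant. $\mathcal{L}_{2s}$ is the set of functions $u\colon\mathbb{R}^N\to\mathbb{R}$ with $\int_{\mathbb{R}^N}\frac{|u(x)|}{1+|x|^{N+2s}}\,dx<\infty$. A classical supersolution of $(-\Delta)^s u+|\nabla u|^q=\lambda f(u)$ in $\mathbb{R}^N\setminus B_{R_0}$ is a function $u\in \mathcal{C}^2(\mathbb{R}^N\setminus B_{R_0})\cap\mathcal{L}_{2s}$ such that $(-\Delta)^s u(x)+|\nabla u(x)|^q\ge\lambda f(u(x))$ for all $x\in\mathbb{R}^N\setminus B_{R_0}$. ''Positive'' means $u>0$ in $\mathbb{R}^N$. ''$u$ does not blow up at infinity'' means that $u(x)$ does not tend to $+\infty$ as $|x|\to\infty$,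 i.e. $\liminf_{|x|\to\infty}u(x)<\infty$. *)

(* Defs.v *)
From HB Require Import structures.
From mathcomp Require Import all_boot all_order all_algebra.
From mathcomp Require Import all_classical all_reals all_analysis.
From mathcomp Require Import measurable_realfun.

Set Implicit Arguments.
Unset Strict Implicit.
Unset Printing Implicit Defensive.

Import Order.TTheory GRing.Theory Num.Theory.
Import numFieldNormedType.Exports.

Local Open Scope classical_set_scope.
Local Open Scope ring_scope.

Definition measure_rV_display : measure_display.
Proof. exact: default_measure_display. Qed.

(* R^n is 'rV[R]_n, equipped with the Borel sigma-algebra, generated by the
   coordinate functions. *)
Section measurable_rV.
Context {R : realType} (n : nat).

Definition coor_rV (i : 'I_n) (x : 'rV[R]_n) : measurableTypeR R := x ord0 i.

Let rV_set0 : g_sigma_preimage coor_rV set0.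
Proof. exact: sigma_algebra0. Qed.

Let rV_setC A : g_sigma_preimage coor_rV A -> g_sigma_preimage coor_rV (~` A).
Proof. exact: sigma_algebraC. Qed.

Let rV_bigcup (F : (set 'rV[R]_n)^nat) :
  (forall i, g_sigma_preimage coor_rV (F i)) ->
  g_sigma_preimage coor_rV (\bigcup_i (F i)).
Proof. exact: sigma_algebra_bigcup. Qed.

HB.instance Definition _ := @isMeasurable.Build measure_rV_display
  'rV[R]_n (g_sigma_preimage coor_rV) rV_set0 rV_setC rV_bigcup.

Lemma measurable_coor_rV (i : 'I_n) :
  measurable_fun [set: 'rV[R]_n] (coor_rV i).
Proof.
move=> _ Y mY; rewrite setTI; apply: sub_sigma_algebra => /=.
rewrite -bigcup_seq/=; exists i => /=; first by rewrite mem_index_enum.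
by exists Y => //; rewrite setTI.
Qed.

Lemma measurable_fun_coor_rVP d (T : measurableType d) (f : T -> 'rV[R]_n) :
  (forall i, measurable_fun [set: T] (coor_rV i \o f)) ->
  measurable_fun [set: T] f.
Proof.
move=> mf _ A mA; rewrite setTI; move: A mA.
pose G : set_system 'rV[R]_n := [set A | measurable (f @^-1` A)].
suff : g_sigma_preimage coor_rV `<=` G by apply.
apply: smallest_sub.
  split.
  - by rewrite /G/= preimage_set0.
  - by move=> A GA; rewrite /G/= setTD preimage_setC; exact: measurableC.
  - by move=> F GF; rewrite /G/= preimage_bigcup; exact: bigcupT_measurable.
rewrite -bigcup_seq => A [i _ [B mB <-]].
by rewrite /G/= setTI -comp_preimage -[X in measurable X]setTI; exact: mf.
Qed.

End measurable_rV.

(* n-dimensional Lebesgue measure, by recursion on n: the point mass when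
   n = 0, and for n.+1 the product of the Lebesgue measures on R and on R^n,
   transported along (t, x) |-> (t, x_0, ..., x_(n-1)). *)
Section lebesgue_rVS.
Context {R : realType} {n : nat}.

Definition cons_rV (z : measurableTypeR R * 'rV[R]_n) : 'rV[R]_n.+1 :=
  row_mx (const_mx z.1 : 'rV_1) z.2.

Lemma cons_rV0 z : cons_rV z ord0 ord0 = z.1.
Proof.
rewrite /cons_rV (_ : ord0 = lshift n (ord0 : 'I_1)); last exact: val_inj.
by rewrite (row_mxEl (const_mx z.1 : 'rV_1)) mxE.
Qed.

Lemma cons_rVS z i : cons_rV z ord0 (lift ord0 i) = z.2 ord0 i.
Proof.
rewrite /cons_rV (_ : lift ord0 i = rshift 1 i); last exact: val_inj.
by rewrite (row_mxEr (const_mx z.1 : 'rV_1)).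
Qed.

Lemma measurable_cons_rV : measurable_fun [set: _] cons_rV.
Proof.
apply: measurable_fun_coor_rVP => i; have [j ->|->] := unliftP ord0 i.
  rewrite (_ : _ \o _ = coor_rV j \o snd); last first.
    by apply/funext => z; rewrite /= /coor_rV cons_rVS.
  by apply: measurableT_comp => //; exact: measurable_coor_rV.
rewrite (_ : _ \o _ = fst)//.
by apply/funext => z; rewrite /= /coor_rV cons_rV0.
Qed.

Definition uncons_rV (x : 'rV[R]_n.+1) : measurableTypeR R * 'rV[R]_n :=
  (x ord0 ord0, \row_i x ord0 (lift ord0 i)).

Lemma cons_rVK : cancel cons_rV uncons_rV.
Proof.
move=> [t x]; rewrite /uncons_rV cons_rV0; congr pair.
by apply/rowP => i; rewrite mxE cons_rVS.
Qed.

Lemma uncons_rVK : cancel uncons_rV cons_rV.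
Proof.
move=> x; apply/rowP => i; have [j ->|->] := unliftP ord0 i.
  by rewrite cons_rVS mxE.
by rewrite cons_rV0.
Qed.

Lemma measurable_uncons_rV : measurable_fun [set: _] uncons_rV.
Proof.
apply/measurable_fun_pairP; split; first exact: (measurable_coor_rV ord0).
apply: measurable_fun_coor_rVP => i.
rewrite (_ : _ \o _ = coor_rV (lift ord0 i)); first exact: measurable_coor_rV.
by apply/funext => x; rewrite /= /coor_rV mxE.
Qed.

Context (m : {sigma_finite_measure set 'rV[R]_n -> \bar R}).

Definition lebesgue_rVS : set 'rV[R]_n.+1 -> \bar R :=
  pushforward (lebesgue_measure \x m)%E cons_rV.

Let lebesgue_rVS0 : lebesgue_rVS set0 = 0%E.
Proof. by rewrite /lebesgue_rVS /pushforward preimage_set0 measure0. Qed.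

Let lebesgue_rVS_ge0 A : (0 <= lebesgue_rVS A)%E.
Proof. by rewrite /lebesgue_rVS /pushforward measure_ge0. Qed.

Let lebesgue_rVS_semi_sigma_additive : semi_sigma_additive lebesgue_rVS.
Proof.
move=> F mF tF mUF; rewrite /lebesgue_rVS /pushforward preimage_bigcup.
apply: measure_semi_sigma_additive.
- by move=> k; rewrite -[X in measurable X]setTI; exact: measurable_cons_rV.
- apply/trivIsetP => /= i j _ _ ij; rewrite -preimage_setI.
  by move/trivIsetP : tF => /(_ _ _ _ _ ij) ->//; rewrite preimage_set0.
- rewrite -preimage_bigcup -[X in measurable X]setTI.
  exact: measurable_cons_rV.
Qed.

HB.instance Definition _ := isMeasure.Build _ _ _ lebesgue_rVS
  lebesgue_rVS0 lebesgue_rVS_ge0 lebesgue_rVS_semi_sigma_additive.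

Let lebesgue_rVS_sigma_finite : sigma_finite setT lebesgue_rVS.
Proof.
have /sigma_finiteP[F [TF ndF Foo]] :
  sigma_finite setT (@lebesgue_measure R) by exact: sigma_finiteT.
have /sigma_finiteP[G [TG ndG Goo]] := sigma_finiteT m.
exists (fun k => uncons_rV @^-1` (F k `*` G k)).
  rewrite -preimage_bigcup -[LHS](preimage_setT uncons_rV).
  congr (_ @^-1` _); apply/seteqP; split=> [z _|//].
  have [j _ Fj] : (\bigcup_i F i) z.1 by rewrite -TF.
  have [k _ Gk] : (\bigcup_i G i) z.2 by rewrite -TG.
  exists (maxn j k) => //; split.
  - by move: Fj; exact/subsetPset/ndF/leq_maxl.
  - by move: Gk; exact/subsetPset/ndG/leq_maxr.
move=> k; have [mF Fk] := Foo k; have [mG Gk] := Goo k.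
split.
  rewrite -[X in measurable X]setTI.
  by apply: measurable_uncons_rV => //; exact: measurableX.
rewrite /lebesgue_rVS /pushforward -comp_preimage.
rewrite (_ : uncons_rV \o cons_rV = id); last exact/funext/cons_rVK.
by rewrite preimage_id product_measure1E// lte_mul_pinfty// ge0_fin_numE.
Qed.

HB.instance Definition _ := Measure_isSigmaFinite.Build _ _ _ lebesgue_rVS
  lebesgue_rVS_sigma_finite.

End lebesgue_rVS.

Fixpoint lebesgue_rV {R : realType} (n : nat) :
    {sigma_finite_measure set 'rV[R]_n -> \bar R} :=
  match n with
  | 0 => dirac (0 : 'rV[R]_0)
  | n'.+1 => lebesgue_rVS (lebesgue_rV n')
  end.

Lemma lebesgue_rV_box {R : realType} (n : nat) (a b : 'rV[R]_n) :
  (forall i, a ord0 i <= b ord0 i) ->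
  lebesgue_rV n [set x | forall i, a ord0 i < x ord0 i <= b ord0 i] =
  (\prod_(i < n) (b ord0 i - a ord0 i))%:E.
Proof.
elim: n a b => [|n IH] a b ab.
  rewrite big_ord0 /= diracE mem_set//= => -[]//.
rewrite /= /lebesgue_rVS /pushforward.
pose a' : 'rV[R]_n := \row_i a ord0 (lift ord0 i).
pose b' : 'rV[R]_n := \row_i b ord0 (lift ord0 i).
set B := [set x : 'rV[R]_n | forall i, a' ord0 i < x ord0 i <= b' ord0 i].
have -> : cons_rV @^-1` [set x | forall i, a ord0 i < x ord0 i <= b ord0 i] =
    `]a ord0 ord0, b ord0 ord0]%classic `*` B.
  apply/seteqP; split=> [z /= h|z /= [h0 h]].
    split; first by rewrite in_itv/= -cons_rV0; exact: h.
    by move=> i; rewrite !mxE -cons_rVS; exact: h.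
  move=> i; have [j ->|->] := unliftP ord0 i.
    by rewrite cons_rVS; have := h j; rewrite !mxE.
  by rewrite cons_rV0; move: h0; rewrite in_itv.
have mB : measurable B.
  rewrite (_ : B = \bigcap_(i in [set: 'I_n])
      (coor_rV i @^-1` `]a' ord0 i, b' ord0 i]%classic)); last first.
    apply/seteqP; split=> [x h i _|x h i].
      by rewrite /= in_itv/=; exact: h.
    by have := h i I; rewrite /= in_itv.
  apply: fin_bigcap_measurable => [|i _]; first exact: finite_finset.
  by rewrite -[X in measurable X]setTI; exact: measurable_coor_rV.
rewrite product_measure1E//= [X in (_ * X)%E]IH; last by move=> i; rewrite !mxE.
rewrite lebesgue_measure_itv/= lte_fin big_ord_recl EFinM.
congr (_ * _)%E; last by congr EFin; apply: eq_bigr => i _; rewrite !mxE.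
have := ab ord0; rewrite le_eqVlt => /orP[/eqP ->|->//].
by rewrite ltxx subrr.
Qed.

Section euclidean.
Context {R : realType} {N : nat}.
Implicit Types (u : 'rV[R]_N -> R) (x : 'rV[R]_N) (s : R).

(* The library norm `|x| of 'rV[R]_N is the sup norm: it induces the same
   topology, but is not the Euclidean norm. *)
Definition enorm x : R := Num.sqrt (\sum_i x ord0 i ^+ 2).

Definition exterior (r : R) : set 'rV[R]_N := [set x | r < enorm x].

(* |x| -> +oo *)
Definition infty_rV : set_system 'rV[R]_N :=
  [set A | exists r, exterior r `<=` A].

#[global] Instance infty_rV_filter : Filter infty_rV.
Proof.
split; first by exists 0.
- move=> A B [r rA] [t tB]; exists (Num.max r t) => x.
  by rewrite /exterior/= gt_max => /andP[rx tx]; split; [exact: rA|exact: tB].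
- by move=> A B AB [r rA]; exists r; exact: subset_trans AB.
Qed.

Definition partial (i : 'I_N) u x : R := 'D_(delta_mx ord0 i) u x.

Definition grad u x : 'rV[R]_N := \row_i partial i u x.

(* For open D: u and its partial derivatives of order 1 and 2 exist and are
   continuous at each point of D. *)
Definition C2_on (D : set 'rV[R]_N) u := forall x, D x ->
  [/\ {for x, continuous u},
    forall i, derivable u x (delta_mx ord0 i) /\
      {for x, continuous (partial i u)} &
    forall i j, derivable (partial i u) x (delta_mx ord0 j) /\
      {for x, continuous (partial j (partial i u))}].

(* Measurability with respect to the completion of the Borel sigma-algebra *)
Definition lebesgue_measurable_fun u := forall B : set (measurableTypeR R),
  measurable B -> completed_algebra_gen (@lebesgue_rV R N) (u @^-1` B).

Definition weighted_L1 s u := lebesgue_measurable_fun u /\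
  (\int[lebesgue_rV N]_x (`|u x| / (1 + enorm x `^ (N%:R + 2 * s)))%:E < +oo)%E.

(* Principal value: the limit, as eps -> 0+, of the integral over
   |x - y| >= eps. C is the normalization constant C_(N,s). *)
Definition fracLaplacian (C s : R) u x : R :=
  C * lim ((\int[lebesgue_rV N]_(y in [set y | eps <= enorm (x - y)])
             ((u x - u y) / enorm (x - y) `^ (N%:R + 2 * s))) @[eps --> 0^'+]).

Definition classical_supersolution (C s q lambda R0 : R) (f : R -> R) u :=
  [/\ C2_on (exterior R0) u, weighted_L1 s u &
    forall x, exterior R0 x ->
      fracLaplacian C s u x + enorm (grad u x) `^ q >= lambda * f (u x)].

Definition blows_up_at_infinity u := u x @[x --> infty_rV] --> +oo.

End euclidean.

(* Main.v *)
(** Write [sigma = N - 2s]. Both [|h|^-(N+2s)] and the powers [|x|^-(sigma+2k)]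
    are mixtures of heat kernels, so the semigroup law reduces the fractional
    Laplacian of [|x|^-(sigma+2k)] to one-dimensional integrals: for [k = 0] it is
    [<= 0], for [k > 0] it is at most a negative multiple of [|x|^-(N+2k)], and it
    is never below [- D k |x|^-(N+2k)], with [D] independent of [k].

    Let [u] be a positive supersolution. Touching it from below by combinations of
    these powers gives [u >= A |x|^-sigma] near infinity, hence
    [f(u) >= c |x|^-N], and then [u >= M |x|^-sigma] for every [M].

    Suppose [u(x0) <= M0] with [x0] far away. A bump of radius [rho = |x0|/2]
    centred at [x0] and of height [T rho^-sigma <= M0] touches [u] from below at
    some [y]; if [a] measures the distance of [y] to the edge of the bump and
    [X = T a^2], so that [rho^sigma u(y) = X], the inequality at [y] becomes
    [c1 X^p + c0 T <= C1 T a + C3 (T a)^(N/(sigma+1))]. This bounds [T >= X]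
    independently of [x0], contradicting the bound [u >= M |x|^-sigma] for large
    [M]. Hence [u] tends to [+oo]. *)
Require Import Defs.
From HB Require Import structures.
From mathcomp Require Import all_boot all_order all_algebra.
From mathcomp Require Import all_classical all_reals all_analysis.
From mathcomp Require Import measurable_realfun ring lra.
Import Order.TTheory GRing.Theory Num.Theory.
Import numFieldNormedType.Exports.
Local Open Scope classical_set_scope.
Local Open Scope ring_scope.

Set Implicit Arguments.
Unset Strict Implicit.
Unset Printing Implicit Defensive.

(** The kernel is cut off in the heat time [t] rather than in space. The cut-off kernel
    [tkernel s e] is bounded and integrable, so its integral against the second difference of a
    power splits, and the large term of order [e^-s] cancels exactly against the mass of the kernel.
    Only the integral of the second difference of [u], which converges absolutely, is taken to the
    limit [e -> 0]; the barriers, singular at the origin, never meet the full kernel.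

    The exponent [p = N/sigma] is critical: the source [c |x|^-N] decays exactly like the fractional
    Laplacian of the barriers, so comparison is used to raise the constant in [M |x|^-sigma], not
    the power. This is why [D] must not depend on [k]: the cost [M k D |x|^-N] has to stay below a
    source whose constant is already fixed.

    The bump argument must therefore be scale invariant. Far out the gradient bound is at most 1, so
    [q] may be lowered to [N/(sigma+1)]; then every term of the contact inequality scales like
    [rho^-N], and [s < 1] makes the gradient term lose. *)

Section affine_change_of_variables.
Context {R : realType}.
Local Notation mu := (@lebesgue_measure R).
Local Open Scope ereal_scope.

(** * Affine changes of variables on the line and in R^n *)

Lemma lebesgue_measure_affine (c d : R) (A : set (measurableTypeR R)) :
  (c != 0)%R -> measurable A ->
  mu A = (`|c|%:E * mu ((fun t => c * t + d)%R @^-1` A))%E.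
Proof.
move=> c0 mA.
have mphi : measurable_fun [set: measurableTypeR R]
    ((fun t => c * t + d)%R : _ -> measurableTypeR R).
  by apply: measurable_funD => //; exact: measurable_funM.
pose cn : {nonneg R} := NngNum (normr_ge0 c).
have -> : (`|c|%:E * mu ((fun t => c * t + d)%R @^-1` A))%E =
  mscale cn (pushforward mu ((fun t => c * t + d)%R : _ -> measurableTypeR R)) A.
  by [].
(* It suffices to compare both measures on half-open intervals. For [c < 0] the preimage of []a, b]]
   is closed at the other end, which leaves its length unchanged. *)
apply: (@lebesgue_measure_unique _
  (measure_function_mscale__canonical__measure_function_Measure cn
    (measure_function_pushforward__canonical__measure_function_Measure mu mphi))) => //.
move=> X [[a b]] _ <-.
change (mu `]a, b]%classic = (`|c|%:E * mu ((fun t => c * t + d)%R @^-1` `]a, b]%classic))%E).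
have [cp|cn0] := ltrP 0%R c.
  rewrite [X in (_ * mu X)%E](_ : _ =
      `]((a - d) / c)%R, ((b - d) / c)%R]%classic); last first.
    apply/seteqP; split=> t /=; rewrite !in_itv/= ltr_pdivrMr// ler_pdivlMr//;
    by rewrite ltrBlDr lerBrDr (mulrC c).
  rewrite !lebesgue_measure_itv/= !lte_fin ltr_pM2r ?invr_gt0// ltrD2r.
  case: ifPn => _; last by rewrite mule0.
  by rewrite -!EFinB -EFinM gtr0_norm//; congr EFin; field; rewrite gt_eqF.
have {}cn0 : (c < 0)%R by rewrite lt_neqAle c0.
rewrite [X in (_ * mu X)%E](_ : _ =
      `[((b - d) / c)%R, ((a - d) / c)%R[%classic); last first.
    apply/seteqP; split=> t /=; rewrite !in_itv/= ltr_ndivlMr// ler_ndivrMr//;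
    by rewrite ltrBlDr lerBrDr (mulrC c) andbC.
rewrite !lebesgue_measure_itv/= !lte_fin ltr_nM2r ?invr_lt0// ltrD2r.
case: ifPn => _; last by rewrite mule0.
by rewrite -!EFinB -EFinM ltr0_norm//; congr EFin; field; rewrite lt_eqF.
Qed.

Lemma integral_affine (c d : R) (f : measurableTypeR R -> \bar R) : (c != 0)%R ->
  measurable_fun [set: measurableTypeR R] f -> (forall t, 0 <= f t) ->
  \int[mu]_t f (c * t + d)%R = `|c|^-1%:E * \int[mu]_t f t.
Proof.
move=> c0 mf f0.
have mphi : measurable_fun [set: measurableTypeR R]
    ((fun t => c * t + d)%R : _ -> measurableTypeR R).
  by apply: measurable_funD => //; exact: measurable_funM.
pose cn : {nonneg R} := NngNum (normr_ge0 c).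
pose m := measure_function_pushforward__canonical__measure_function_Measure mu mphi.
pose m' := measure_function_mscale__canonical__measure_function_Measure cn m.
have -> : \int[mu]_t f t = \int[m']_t f t.
  by apply: (@eq_measure_integral _ _ _ _ m' mu) => A mA _; exact: lebesgue_measure_affine.
rewrite (@ge0_integral_mscale _ _ _ m)// (ge0_integral_pushforward mphi)//= preimage_setT.
by rewrite muleA -EFinM mulVf ?normr_eq0// mul1e.
Qed.

Lemma measurable_affine_rV n (c : R) (d : 'rV[R]_n) :
  measurable_fun [set: 'rV[R]_n] (fun x : 'rV[R]_n => c *: x + d)%R.
Proof.
apply: measurable_fun_coor_rVP => i.
rewrite [X in measurable_fun _ X](_ : _ = fun x => c * coor_rV i x + d ord0 i)%R.
  apply: measurable_funD => //; apply: measurable_funM => //.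
  exact: measurable_coor_rV.
by apply/funext => x; rewrite /= /coor_rV !mxE.
Qed.

(** The recursive definition of [lebesgue_rV] as a pushforward along [cons_rV], followed by Tonelli;
    the inductions on the dimension rest on it. *)
Lemma integral_rVS n (f : 'rV[R]_n.+1 -> \bar R) :
  measurable_fun [set: 'rV[R]_n.+1] f -> (forall t, 0 <= f t) ->
  \int[lebesgue_rV n.+1]_x f x =
  \int[mu]_t \int[lebesgue_rV n]_x f (cons_rV (t, x)).
Proof.
move=> mf f0.
rewrite [LHS](@ge0_integral_pushforward _ _ _ _ _ _ measurable_cons_rV)//.
rewrite preimage_setT (fubini_tonelli1 (f \o cons_rV))//.
  exact: (measurableT_comp mf measurable_cons_rV).
by move=> x; exact: f0.
Qed.

Lemma integral_affine_rV n (c : R) (d : 'rV[R]_n) (f : 'rV[R]_n -> \bar R) :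
  (c != 0)%R -> measurable_fun [set: 'rV[R]_n] f -> (forall t, 0 <= f t) ->
  \int[lebesgue_rV n]_x f (c *: x + d)%R =
  (`|c| ^- n)%R%:E * \int[lebesgue_rV n]_x f x.
Proof.
move=> c0; elim: n d f => [|n IH] d f mf f0.
  rewrite expr0 invr1 mul1e; apply: eq_integral => x _; congr f.
  by apply/rowP => -[].
have mfa := measurableT_comp mf (measurable_affine_rV c d).
rewrite !integral_rVS//.
pose d' : 'rV[R]_n := (\row_i d ord0 (lift ord0 i))%R.
have E t x : (c *: cons_rV (t, x) + d = cons_rV (c * t + d ord0 ord0, c *: x + d'))%R.
  apply/rowP => i; have [j ->|->] := unliftP ord0 i.
    by rewrite [LHS]mxE [X in (X + _)%R]mxE !cons_rVS/= !mxE.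
  by rewrite [LHS]mxE [X in (X + _)%R]mxE !cons_rV0.
have mfc : measurable_fun [set: measurableTypeR R * 'rV[R]_n] (f \o cons_rV).
  exact: (measurableT_comp mf measurable_cons_rV).
under eq_integral => t _.
  under eq_integral do rewrite E.
  rewrite (IH d' (fun x => f (cons_rV ((c * t + d ord0 ord0)%R, x))))//; last first.
    exact: (measurableT_comp mfc (pair1_measurable _)).
  over.
have mF : measurable_fun [set: measurableTypeR R]
    (fun t => \int[lebesgue_rV n]_x f (cons_rV (t, x))).
  exact: (measurable_fun_fubini_tonelli_F _ mfc (fun x => f0 (cons_rV x))).
have F0 t : 0 <= \int[lebesgue_rV n]_x f (cons_rV (t, x)) by exact: integral_ge0.
rewrite (integral_affine (d ord0 ord0)
  (f := fun t => (`|c| ^- n)%R%:E * \int[lebesgue_rV n]_x f (cons_rV (t, x))) c0).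
- rewrite ge0_integralZl_EFin ?invr_ge0 ?exprn_ge0//.
  by rewrite muleA -EFinM exprS invfM.
- exact: measurable_funeM.
- by move=> t; rewrite mule_ge0// lee_fin invr_ge0 exprn_ge0.
Qed.

End affine_change_of_variables.

Ltac mfun := repeat first
  [ assumption | exact: measurable_cst | exact: measurable_id
  | exact: measurable_fst | exact: measurable_snd
  | exact: measurable_powR | exact: measurable_expR
  | apply: measurable_fun_ifT | apply: measurable_fun_ltr
  | apply: measurable_fun_ler | apply: measurable_funD | apply: measurable_funB
  | apply: measurable_funM | apply: measurable_funX | apply: measurable_funN ].

(** * Nonnegative integrals, and powers on the half-line *)

Section nonnegative_integrals.
Context d (T : measurableType d) (R : realType) (m : {measure set T -> \bar R}).
Implicit Types f g : T -> R.

Lemma nnint_le f g : measurable_fun setT f -> measurable_fun setT g ->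
  (forall x, 0 <= f x) -> (forall x, f x <= g x) ->
  (\int[m]_x (f x)%:E <= \int[m]_x (g x)%:E)%E.
Proof.
move=> mf mg f0 fg; apply: ge0_le_integral => //.
- by move=> x _; rewrite lee_fin.
- exact/measurable_EFinP.
- exact/measurable_EFinP.
- by move=> x _; rewrite lee_fin.
Qed.

Lemma nnintZ k f : measurable_fun setT f -> (forall x, 0 <= f x) -> 0 <= k ->
  (\int[m]_x (k * f x)%:E = k%:E * \int[m]_x (f x)%:E)%E.
Proof.
move=> mf f0 k0; under eq_integral do rewrite EFinM.
rewrite ge0_integralZl_EFin//; first by move=> x _; rewrite lee_fin.
exact/measurable_EFinP.
Qed.

Lemma nnintD f g : measurable_fun setT f -> measurable_fun setT g ->
  (forall x, 0 <= f x) -> (forall x, 0 <= g x) ->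
  (\int[m]_x (f x + g x)%:E = \int[m]_x (f x)%:E + \int[m]_x (g x)%:E)%E.
Proof.
move=> mf mg f0 g0; under eq_integral do rewrite EFinD.
rewrite ge0_integralD//.
- by move=> x _; rewrite lee_fin.
- exact/measurable_EFinP.
- by move=> x _; rewrite lee_fin.
- exact/measurable_EFinP.
Qed.

Lemma nnint_ge0 f : (forall x, 0 <= f x) -> (0 <= \int[m]_x (f x)%:E)%E.
Proof. by move=> f0; apply: integral_ge0 => x _; rewrite lee_fin. Qed.

End nonnegative_integrals.

Section time_integrals.
Context {R : realType}.
Local Notation mu := (@lebesgue_measure R).
Implicit Types (a b c t : R) (f g F : R -> R).

Lemma FTC_is_derive f F a b : a < b ->
  (forall x, a <= x <= b -> is_derive x 1 F (f x)) ->
  (forall x, a <= x <= b -> {for x, continuous f}) ->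
  (\int[mu]_(x in `[a, b]) (f x)%:E = (F b - F a)%:E)%E.
Proof.
move=> ab dF cf.
have cF x : a <= x <= b -> F z @[z --> x] --> F x.
  move=> xab; have := dF x xab => -[d _].
  exact: (differentiable_continuous ((derivable1_diffP _ _).1 d)).
rewrite (continuous_FTC2 (F := F))//.
- apply: continuous_in_subspaceT => x; rewrite inE/= in_itv/=; exact: cf.
- split.
  + move=> x; rewrite in_itv/= => /andP[ax xb].
    by have [] := dF x; rewrite ?ltW.
  + by apply: cvg_at_right_filter; apply: cF; rewrite lexx ltW.
  + by apply: cvg_at_left_filter; apply: cF; rewrite lexx ltW.
- move=> x; rewrite in_itv/= => /andP[ax xb].
  by rewrite derive1E; have [_ ->] : is_derive x 1 F (f x) by apply: dF; rewrite !ltW.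
Qed.

(** Monotone convergence along intervals that exhaust the set where [f] is nonzero: explicit
    integrals over compact intervals yield upper bounds for improper ones. *)
Lemma nnint_exhaust_le f (a_ b_ : R^nat) M :
  measurable_fun [set: R] f -> (forall t, 0 <= f t) ->
  {homo a_ : n k / (n <= k)%N >-> k <= n} -> {homo b_ : n k / (n <= k)%N >-> n <= k} ->
  (forall t, f t != 0 -> exists n, a_ n <= t <= b_ n) ->
  (forall n, \int[mu]_(t in `[a_ n, b_ n]) (f t)%:E <= M)%E ->
  (\int[mu]_t (f t)%:E <= M)%E.
Proof.
move=> mf f0 ha hb hex hM.
pose A n : set (measurableTypeR R) := `[a_ n, b_ n]%classic.
have ndA : nondecreasing_seq A.
  move=> n k nk; apply/subsetPset => t; rewrite /A/= !in_itv/= => /andP[h1 h2].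
  by rewrite (le_trans (ha _ _ nk) h1) (le_trans h2 (hb _ _ nk)).
have mfA i : measurable_fun (A i) (EFin \o f).
  by apply: measurable_funTS; exact/measurable_EFinP.
have := @ge0_nondecreasing_set_cvg_integral _ _ _ A (EFin \o f) mu ndA.
move=> /(_ (fun i => measurable_itv _) mfA).
have f0' (i : nat) x : A i x -> (0 <= (EFin \o f) x)%E by rewrite lee_fin.
move=> /(_ f0') cv.
have -> : (\int[mu]_t (f t)%:E = \int[mu]_(t in \bigcup_i A i) (EFin \o f) t)%E.
  rewrite [RHS]integral_mkcond; apply: eq_integral => t _.
  rewrite patchE; case: ifPn => //.
  have [->//|/hex[n hn]] := eqVneq (f t) 0.
  by rewrite notin_setE => -[]; exists n => //; rewrite /A/= in_itv.
rewrite -(cvg_lim _ cv)//; apply: lime_le; first by apply/cvg_ex; eexists; exact: cv.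
by apply: nearW => n; exact: hM.
Qed.

(** Extended by 0 to [t <= 0], since [powR] does not vanish at negative bases. Integrals over the
    whole line then see only [t > 0]. *)
Definition tpow a t := if 0 < t then t `^ a else 0.

Lemma tpow_ge0 a t : 0 <= tpow a t.
Proof. by rewrite /tpow; case: ifP => // _; exact: powR_ge0. Qed.

Lemma tpowE a t : 0 < t -> tpow a t = t `^ a.
Proof. by rewrite /tpow => ->. Qed.

Lemma tpow_le0 a t : t <= 0 -> tpow a t = 0.
Proof. by rewrite /tpow ltNge => ->. Qed.

Lemma powRD_gt0 t a b : 0 < t -> t `^ (a + b) = t `^ a * t `^ b.
Proof. by move=> t0; rewrite powRD// (gt_eqF t0) implybT. Qed.

Lemma tpowM a c t : 0 < c -> tpow a (c * t) = c `^ a * tpow a t.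
Proof.
move=> c0; rewrite /tpow pmulr_rgt0//; case: ifP => [t0|_]; last by rewrite mulr0.
by rewrite powRM// ltW.
Qed.

Lemma measurable_tpow a : measurable_fun [set: R] (tpow a).
Proof. by rewrite /tpow; mfun. Qed.

Lemma measurable_tpow_comp d (T : measurableType d) a (g : T -> R) :
  measurable_fun setT g -> measurable_fun setT (fun x => tpow a (g x)).
Proof. by move=> mg; exact: (measurableT_comp (measurable_tpow a) mg). Qed.

Lemma measurable_expR_comp d (T : measurableType d) (g : T -> R) :
  measurable_fun setT g -> measurable_fun setT (fun x => expR (g x)).
Proof. by move=> mg; exact: (measurableT_comp (@measurable_expR R) mg). Qed.

Lemma powR_continuous a t : 0 < t -> {for t, continuous (fun x => x `^ a)}.
Proof.
move=> t0; have [d _] := @is_derive1_powR R a t t0.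
exact: (differentiable_continuous ((derivable1_diffP _ _).1 d)).
Qed.

Lemma integral_powR a b c : 0 < a -> a < b -> c != 0 ->
  (\int[mu]_(t in `[a, b]) (t `^ (c - 1))%:E = (c^-1 * b `^ c - c^-1 * a `^ c)%:E)%E.
Proof.
move=> a0 ab c0; have := @FTC_is_derive (fun t => t `^ (c - 1)) (fun t => c^-1 * t `^ c) a b ab.
apply.
- move=> x /andP[ax xb]; have x0 : 0 < x by exact: lt_le_trans ax.
  have := is_deriveZ c^-1 (@is_derive1_powR R c x x0).
  by rewrite /GRing.scale/= mulrA mulVf// mul1r.
- by move=> x /andP[ax xb]; apply: powR_continuous; exact: lt_le_trans ax.
Qed.

Let near0 b t := if t <= 1 then tpow (b - 1) t else 0.
Let nearoo c t := if 1 < t then tpow (- c - 1) t else 0.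

Let m0 b : measurable_fun [set: R] (near0 b).
Proof. by rewrite /near0; mfun; exact: measurable_tpow. Qed.

Let moo c : measurable_fun [set: R] (nearoo c).
Proof. by rewrite /nearoo; mfun; exact: measurable_tpow. Qed.

Let near0_int b : 0 < b -> (\int[mu]_t (near0 b t)%:E <= b^-1%:E)%E.
Proof.
move=> b0; apply: (@nnint_exhaust_le _ (fun n => n.+2%:R^-1) (fun=> 1)).
- exact: m0.
- by move=> t; rewrite /near0; case: ifP => // _; exact: tpow_ge0.
- by move=> n k nk; rewrite lef_pV2 ?posrE// ler_nat.
- by move=> n k _.
- move=> t; rewrite /near0; case: ifPn => t1; last by rewrite eqxx.
  rewrite /tpow; case: ifPn => t0; last by rewrite eqxx.
  move=> _; exists (Num.truncn t^-1); rewrite /= andbT invf_ple ?posrE//.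
  apply: (le_trans (ltW (truncnS_gt _))); by rewrite ler_nat.
- move=> n; rewrite (_ : (\int[mu]_(t in _) _)%E = (\int[mu]_(t in `[(n.+2%:R^-1 : R)%R, 1%R]) (t `^ (b - 1))%:E)%E).
    rewrite integral_powR ?invr_gt0 ?gt_eqF//; last by rewrite invf_lt1 ?ltr1n.
    by rewrite powR1 mulr1 lee_fin gerBl mulr_ge0 ?powR_ge0// invr_ge0 ltW.
  apply: eq_integral => t; rewrite inE/= in_itv/= /near0 => /andP[t1 ->].
  by rewrite tpowE// (lt_le_trans _ t1)// invr_gt0.
Qed.

Let nearoo_int c : 0 < c -> (\int[mu]_t (nearoo c t)%:E <= c^-1%:E)%E.
Proof.
move=> b0; apply: (@nnint_exhaust_le _ (fun=> 1) (fun n => n.+2%:R)).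
- exact: moo.
- by move=> t; rewrite /nearoo; case: ifP => // _; exact: tpow_ge0.
- by move=> n k _.
- by move=> n k nk; rewrite ler_nat.
- move=> t; rewrite /nearoo; case: ifPn => t1; last by rewrite eqxx.
  move=> _; exists (Num.truncn t); rewrite ?(ltW t1) /=.
  apply: (le_trans (ltW (truncnS_gt _))); by rewrite ler_nat.
- move=> n; apply: (@le_trans _ _ (\int[mu]_(t in `[1%R, (n.+2%:R : R)%R]) (t `^ (- c - 1))%:E)%E).
    apply: ge0_le_integral => //.
    + by move=> t _; rewrite lee_fin /nearoo; case: ifP => // _; exact: tpow_ge0.
    + apply/measurable_EFinP; apply: measurable_funTS; exact: moo.
    + apply/measurable_EFinP; apply: measurable_funTS; exact: measurable_powR.
    + move=> t /=; rewrite in_itv/= lee_fin /nearoo /tpow => /andP[t1 _].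
      rewrite (lt_le_trans ltr01 t1); case: ifP => // _; exact: powR_ge0.
  rewrite integral_powR ?ltr1n ?oppr_eq0 ?gt_eqF// invrN powR1 mulr1 lee_fin.
  by rewrite opprK gerDr mulNr oppr_le0 mulr_ge0 ?powR_ge0// invr_ge0 ltW.
Qed.

(** The integrability test used throughout: a power above -1 at the origin, a power below -1 at
    infinity. *)
Lemma nnint_lty g A b c : 0 < b -> 0 < c -> measurable_fun [set: R] g ->
  (forall t, 0 <= g t) ->
  (forall t, g t <= A * (if t <= 1 then tpow (b - 1) t else tpow (- c - 1) t)) ->
  (\int[mu]_t (g t)%:E < +oo)%E.
Proof.
move=> b0 c0 mg g0 gA.
have n0 t : 0 <= near0 b t by rewrite /near0; case: ifP => // _; exact: tpow_ge0.
have noo t : 0 <= nearoo c t by rewrite /nearoo; case: ifP => // _; exact: tpow_ge0.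
have h : (\int[mu]_t (g t)%:E <= \int[mu]_t (`|A| * (near0 b t + nearoo c t))%:E)%E.
  apply: nnint_le => //; first by mfun.
  move=> t; apply: (le_trans (gA t)); apply: (le_trans (ler_norm _)).
  rewrite normrM ler_wpM2l// /near0 /nearoo ltNge.
  by case: ifP => _ /=; rewrite ?addr0 ?add0r ger0_norm// tpow_ge0.
apply: (le_lt_trans h); rewrite nnintZ//; last 2 first.
- by mfun.
- by move=> t; exact: addr_ge0.
have D := @nnintD _ _ R mu (near0 b) (nearoo c) (m0 b) (moo c) n0 noo.
have B : (\int[mu]_t (near0 b t + nearoo c t)%:E <= (b^-1 + c^-1)%:E)%E.
  by rewrite D EFinD; apply: leeD; [exact: near0_int|exact: nearoo_int].
apply: (@le_lt_trans _ _ (`|A|%:E * (b^-1 + c^-1)%:E)%E); first exact: lee_wpmul2l.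
by rewrite -EFinM ltry.
Qed.

End time_integrals.

#[global] Hint Resolve tpow_ge0 : core.
#[global] Hint Extern 0 (measurable_fun _ (tpow _)) => exact: measurable_tpow : core.


(** The inverse is expressed by [powR], which is measurable; negative values are reflected first
    because [powR_inv1] asks for a nonnegative base. *)
Lemma measurable_invr_comp d (T : measurableType d) (R : realType) (g : T -> R) :
  measurable_fun setT g -> measurable_fun setT (fun x => (g x)^-1).
Proof.
move=> mg.
have -> : (fun x => (g x)^-1) = (fun x => if g x < 0 then - ((- g x) `^ (-1)) else (g x) `^ (-1)).
  apply/funext => x; case: ltP => h.
    by rewrite powR_inv1 ?oppr_ge0 ?ltW// invrN opprK.
  by rewrite powR_inv1.
apply: measurable_fun_ifT.
- by apply: measurable_fun_ltr.
- by apply: measurable_funN; apply: (measurableT_comp (measurable_powR _)); exact: measurable_funN.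
- exact: (measurableT_comp (measurable_powR _) mg).
Qed.

(** * The Euclidean norm *)

Section euclidean_norm.
Context {R : realType} {N : nat}.
Implicit Types (x y h : 'rV[R]_N) (c t : R).

Definition sqnorm x : R := \sum_i x ord0 i ^+ 2.

Lemma sqnorm_ge0 x : 0 <= sqnorm x.
Proof. by apply: sumr_ge0 => i _; exact: sqr_ge0. Qed.

Lemma enorm_ge0 x : 0 <= enorm x.
Proof. exact: sqrtr_ge0. Qed.

Lemma enorm_sq x : enorm x ^+ 2 = sqnorm x.
Proof. by rewrite sqr_sqrtr// sqnorm_ge0. Qed.

Lemma sqnormZ c x : sqnorm (c *: x) = c ^+ 2 * sqnorm x.
Proof. by rewrite /sqnorm mulr_sumr; apply: eq_bigr => i _; rewrite mxE exprMn. Qed.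

Lemma enormZ c x : enorm (c *: x) = `|c| * enorm x.
Proof. by rewrite /enorm -!/(sqnorm _) sqnormZ sqrtrM ?sqr_ge0// sqrtr_sqr. Qed.

Lemma enormN x : enorm (- x) = enorm x.
Proof. by rewrite -scaleN1r enormZ normrN1 mul1r. Qed.

Lemma sqnorm_eq0 x : (sqnorm x == 0) = (x == 0).
Proof.
apply/idP/eqP => [|->]; last by rewrite /sqnorm big1// => i _; rewrite mxE expr0n.
rewrite psumr_eq0 => [/allP h|i _]; last exact: sqr_ge0.
by apply/rowP => i; rewrite mxE; apply/eqP; rewrite -sqrf_eq0; exact: (h i (mem_index_enum _)).
Qed.

Lemma enorm_gt0 x : (0 < enorm x) = (x != 0).
Proof. by rewrite sqrtr_gt0 lt_neqAle sqnorm_ge0 andbT eq_sym sqnorm_eq0. Qed.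

Lemma enorm0 : enorm (0 : 'rV[R]_N) = 0.
Proof. by apply/eqP; rewrite eq_le enorm_ge0 andbT leNgt enorm_gt0 eqxx. Qed.

Definition dotp x y : R := \sum_i x ord0 i * y ord0 i.

Lemma sqnormD x y : sqnorm (x + y) = sqnorm x + 2 * dotp x y + sqnorm y.
Proof.
rewrite /sqnorm /dotp mulr_sumr -!big_split/=; apply: eq_bigr => i _.
by rewrite mxE; ring.
Qed.

Lemma dotpZr x c y : dotp x (c *: y) = c * dotp x y.
Proof. by rewrite /dotp mulr_sumr; apply: eq_bigr => i _; rewrite mxE; ring. Qed.

Lemma dotpN x y : dotp x (- y) = - dotp x y.
Proof. by rewrite -scaleN1r dotpZr mulN1r. Qed.

Lemma dotp_le x y : `|dotp x y| <= enorm x * enorm y.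
Proof.
have [->|y0] := eqVneq y 0.
  rewrite enorm0 mulr0 (_ : dotp x 0 = 0) ?normr0//.
  by rewrite -(scale0r 0) dotpZr mul0r.
have y2 : 0 < sqnorm y by rewrite lt_neqAle sqnorm_ge0 eq_sym sqnorm_eq0 y0.
rewrite -ler_sqr ?nnegrE ?mulr_ge0 ?enorm_ge0// real_normK ?num_real// exprMn !enorm_sq.
(* The component of [x] orthogonal to [y] has nonnegative square norm; multiplied by [|y|^2] this is
   Cauchy-Schwarz. *)
have := sqnorm_ge0 (x + (- (dotp x y / sqnorm y)) *: y).
rewrite sqnormD dotpZr sqnormZ => h.
have {h} : 0 <= sqnorm y * (sqnorm x + 2 * (- (dotp x y / sqnorm y) * dotp x y) +
  (- (dotp x y / sqnorm y)) ^+ 2 * sqnorm y) by rewrite mulr_ge0// ltW.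
rewrite (_ : sqnorm y * _ = sqnorm x * sqnorm y - dotp x y ^+ 2) ?subr_ge0//.
by field; rewrite gt_eqF.
Qed.

Lemma enormD x y : enorm (x + y) <= enorm x + enorm y.
Proof.
rewrite -ler_sqr ?nnegrE ?addr_ge0 ?enorm_ge0// enorm_sq sqnormD -!enorm_sq.
have := ler_norm (dotp x y); have := dotp_le x y; nra.
Qed.

Lemma enormB_le x y : enorm x - enorm y <= enorm (x + y).
Proof. by rewrite lerBlDr -(enormN y); apply: le_trans (enormD _ _); rewrite addrK. Qed.

Lemma ler_enorm i x : `|x ord0 i| <= enorm x.
Proof.
rewrite -ler_sqr ?nnegrE ?enorm_ge0// real_normK ?num_real// enorm_sq.
by rewrite /sqnorm (bigD1 i)//= lerDl; apply: sumr_ge0 => j _; exact: sqr_ge0.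
Qed.

Lemma enorm_le_sum x : enorm x <= \sum_i `|x ord0 i|.
Proof.
have s0 : 0 <= \sum_i `|x ord0 i| by exact: sumr_ge0.
rewrite -ler_sqr ?nnegrE ?enorm_ge0// enorm_sq /sqnorm expr2 mulr_suml.
apply: ler_sum => i _; rewrite -real_normK ?num_real// expr2 ler_wpM2l//.
by rewrite (bigD1 i)//= lerDl sumr_ge0.
Qed.

Lemma measurable_sqnorm : measurable_fun [set: 'rV[R]_N] sqnorm.
Proof.
by apply: measurable_sum => i; apply: measurable_funX; exact: measurable_coor_rV.
Qed.

Lemma measurable_enorm : measurable_fun [set: 'rV[R]_N] (@enorm R N).
Proof.
rewrite (_ : @enorm R N = fun x => (sqnorm x) `^ 2^-1).
  exact: (measurableT_comp (measurable_powR _) measurable_sqnorm).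
by apply/funext => x; rewrite powR12_sqrt// sqnorm_ge0.
Qed.

End euclidean_norm.

(** * Gaussian integrals and the heat semigroup *)

Section heat_kernel.
Context {R : realType} {N : nat}.
Implicit Types (x y h : 'rV[R]_N) (t r : R).

Definition gaussI : R := Num.sqrt pi ^+ N.

Lemma gaussI_gt0 : 0 < gaussI.
Proof. by rewrite exprn_gt0// sqrtr_gt0 pi_gt0. Qed.

Lemma measurable_expN_sqnorm n : measurable_fun [set: 'rV[R]_n] (fun x : 'rV[R]_n => expR (- sqnorm x)).
Proof. by apply: measurable_expR_comp; apply: measurable_funN; exact: measurable_sqnorm. Qed.

End heat_kernel.

Lemma integral_gauss_rV {R : realType} (n : nat) :
  (\int[lebesgue_rV n]_x (expR (- sqnorm x))%:E = (@gaussI R n)%:E)%E.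
Proof.
elim: n => [|n IH].
  rewrite /= integral_dirac//; last first.
    by apply/measurable_EFinP; exact: measurable_expN_sqnorm.
  by rewrite diracT mul1e /sqnorm big_ord0 oppr0 expR0.
rewrite integral_rVS; last 2 first.
- by apply/measurable_EFinP; exact: measurable_expN_sqnorm.
- by move=> x; rewrite lee_fin expR_ge0.
transitivity (\int[lebesgue_measure]_t ((@gaussI R n) * gauss_fun t)%:E)%E.
  apply: eq_integral => t _; rewrite mulrC EFinM -IH -ge0_integralZl_EFin ?gauss_fun_ge0//.
  - apply: eq_integral => x _; rewrite -EFinM -expRD; congr (expR _)%:E.
    rewrite /sqnorm big_ord_recl cons_rV0 opprD; congr (_ - _).
    by apply: eq_bigr => i _; rewrite cons_rVS.
  - by apply/measurable_EFinP; exact: measurable_expN_sqnorm.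
rewrite nnintZ ?integralT_gauss -?EFinM; last 3 first.
- exact: measurable_gauss_fun.
- exact: gauss_fun_ge0.
- by rewrite ltW// gaussI_gt0.
by rewrite /gaussI exprSr.
Qed.

Section heat_kernel.
Context {R : realType} {N : nat}.
Implicit Types (x y h : 'rV[R]_N) (t r : R).

Lemma integral_gauss_affine (A c : R) (d : 'rV[R]_N) : 0 <= A -> 0 < c ->
  (\int[lebesgue_rV N]_x (A * expR (- sqnorm (c `^ 2^-1 *: x + d)))%:E =
   (A * (c `^ (- (N%:R / 2)) * @gaussI R N))%:E)%E.
Proof.
move=> A0 c0.
have mg : measurable_fun [set: 'rV[R]_N] (fun x => (expR (- sqnorm x))%:E).
  by apply/measurable_EFinP; exact: measurable_expN_sqnorm.
rewrite nnintZ//; last first.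
  exact: (measurableT_comp (@measurable_expN_sqnorm R N) (measurable_affine_rV _ _)).
rewrite (integral_affine_rV d (f := fun x => (expR (- sqnorm x))%:E))//; last first.
  by rewrite gt_eqF// powR_gt0.
rewrite integral_gauss_rV -!EFinM; congr (_ * (_ * _))%:E.
by rewrite ger0_norm ?powR_ge0// -powR_mulrn ?powR_ge0// -powRrM -powRN mulrC.
Qed.

(** The heat kernel at time [t/4] without its factor [pi^(-N/2)]; hence the mass [gaussI] instead of
    1. *)
Definition heat t x : R := t `^ (- (N%:R / 2)) * expR (- (sqnorm x / t)).

Lemma heat_ge0 t x : 0 <= heat t x.
Proof. by rewrite mulr_ge0// ?powR_ge0// expR_ge0. Qed.

Lemma integral_heat t : 0 < t -> (\int[lebesgue_rV N]_x (heat t x)%:E = (@gaussI R N)%:E)%E.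
Proof.
move=> t0; transitivity (\int[lebesgue_rV N]_x (t `^ (- (N%:R / 2)) *
    expR (- sqnorm (t^-1 `^ 2^-1 *: x + 0)))%:E)%E.
  apply: eq_integral => x _; rewrite addr0 sqnormZ -powR_mulrn ?powR_ge0//.
  by rewrite -powRrM mulVf// powRr1 ?invr_ge0 ?ltW// [_^-1 * _]mulrC.
rewrite integral_gauss_affine ?powR_ge0 ?invr_gt0// mulrA -powRM ?invr_ge0 ?ltW//.
by rewrite divff ?gt_eqF// powR1 mul1r.
Qed.

(** The semigroup law, by completing the square: with [c = 1/t + 1/r], [|h|^2/t + |y+h|^2/r = c |h +
    (t/(t+r)) y|^2 + |y|^2/(t+r)]. *)
Lemma heat_convolution t r y : 0 < t -> 0 < r ->
  (\int[lebesgue_rV N]_h (heat t h * heat r (y + h))%:E =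
   (@gaussI R N * heat (t + r) y)%:E)%E.
Proof.
move=> t0 r0; pose c := (t + r) / (t * r).
have tr0 : 0 < t + r by exact: addr_gt0.
have c0 : 0 < c by rewrite divr_gt0// mulr_gt0.
transitivity (\int[lebesgue_rV N]_h ((t `^ (- (N%:R / 2)) * r `^ (- (N%:R / 2)) *
   expR (- (sqnorm y / (t + r)))) * expR (- sqnorm (c `^ 2^-1 *: h +
     (c `^ 2^-1 * (t / (t + r))) *: y)))%:E)%E.
  apply: eq_integral => h _; congr EFin.
  rewrite /heat mulrACA -expRD -[RHS]mulrA -expRD; congr (_ * expR _).
  rewrite -scalerA -scalerDr sqnormZ -powR_mulrn ?powR_ge0// -powRrM mulVf// powRr1 ?ltW//.
  rewrite (addrC y) !sqnormD dotpZr sqnormZ /c; field.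
  by rewrite !gt_eqF.
rewrite integral_gauss_affine//; last by rewrite !mulr_ge0 ?powR_ge0 ?expR_ge0.
rewrite /heat.
have <- : t `^ (- (N%:R / 2)) * r `^ (- (N%:R / 2)) * c `^ (- (N%:R / 2)) =
    (t + r) `^ (- (N%:R / 2)).
  rewrite -powRM ?ltW// -powRM ?ltW ?mulr_gt0 ?invr_gt0//; last exact: mulr_gt0.
  by rewrite (_ : t * r * c = t + r)// /c; field; rewrite !gt_eqF.
by congr EFin; ring.
Qed.

Lemma measurable_heat2 d (T : measurableType d) (a : T -> R) (b : T -> 'rV[R]_N) :
  measurable_fun setT a -> measurable_fun setT b ->
  measurable_fun setT (fun z => heat (a z) (b z)).
Proof.
move=> ma mb; apply: measurable_funM.
  exact: (measurableT_comp (measurable_powR _) ma).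
apply: measurable_expR_comp; apply: measurable_funN; apply: measurable_funM.
  exact: (measurableT_comp measurable_sqnorm mb).
exact: measurable_invr_comp.
Qed.

End heat_kernel.

(** * Powers of the norm as mixtures of heat kernels *)

Section power_mixtures.
Context {R : realType}.
Local Notation mu := (@lebesgue_measure R).
Implicit Types (a c r t z : R).

Lemma powR_expRN_le c z : 0 < c -> 0 < z -> z `^ c * expR (- z) <= c `^ c.
Proof.
move=> c0 z0; rewrite /powR !gt_eqF// -expRD ler_expR.
have h : ln (z / c) <= z / c - 1.
  have := @le_ln1Dx R (z / c - 1); rewrite addrCA subrr addr0; apply.
  by rewrite ltrBrDr addNr divr_gt0.
rewrite lnM ?posrE ?invr_gt0// lnV ?posrE// in h.
have : c * (ln z - ln c) <= c * (z / c - 1) by rewrite ler_pM2l.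
rewrite !mulrBr mulrCA divff ?gt_eqF// mulr1; lra.
Qed.

Definition mix_fun a t : R := tpow (- (a / 2) - 1) t * expR (- (1 / t)).

Lemma mix_fun_ge0 a t : 0 <= mix_fun a t.
Proof. by rewrite mulr_ge0// ?tpow_ge0// expR_ge0. Qed.

Lemma measurable_mix a r : measurable_fun [set: measurableTypeR R]
  (fun t => tpow (- (a / 2) - 1) t * expR (- (r / t))).
Proof.
apply: measurable_funM => //; apply: measurable_expR_comp; apply: measurable_funN.
by apply: measurable_funM => //; exact: measurable_invr_comp.
Qed.

Lemma mix_lty a : 0 < a -> (\int[mu]_t (mix_fun a t)%:E < +oo)%E.
Proof.
move=> a0; pose c := a / 2 + 1; have c0 : 0 < c by rewrite /c; lra.
apply: (@nnint_lty _ _ (c `^ c + 1) 1 (a / 2)) => //.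
- by rewrite divr_gt0.
- exact: measurable_mix.
- exact: mix_fun_ge0.
- move=> t; rewrite /mix_fun subrr.
  have [t0|t0] := leP t 0; first by rewrite !tpow_le0// mul0r; case: ifP; rewrite mulr0.
  rewrite !tpowE// powRr0; case: (leP t 1) => t1.
    rewrite mulr1; apply: (@le_trans _ _ (c `^ c)); last by rewrite lerDl.
    apply: le_trans (powR_expRN_le c0 (_ : 0 < 1 / t)); last by rewrite divr_gt0.
    by rewrite ler_wpM2r ?expR_ge0// div1r -(powR_inv1 (ltW t0)) -powRrM mulN1r /c opprD.
  rewrite mulrC ler_wpM2r ?powR_ge0//.
  apply: (@le_trans _ _ 1); last by rewrite lerDr powR_ge0.
  by rewrite -expR0 ler_expR oppr_le0 divr_ge0// ltW.
Qed.

(** This is [Gamma(a/2)], written in the variable [1/t]. *)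
Definition mix a : R := fine (\int[mu]_t (mix_fun a t)%:E).

Lemma mixE a : 0 < a -> (\int[mu]_t (mix_fun a t)%:E = (mix a)%:E)%E.
Proof.
move=> a0; rewrite fineK// ge0_fin_numE ?mix_lty//.
by apply: nnint_ge0; exact: mix_fun_ge0.
Qed.

Lemma mix_ge a : 0 < a -> 2 `^ (- (a / 2) - 1) * expR (- 1) <= mix a.
Proof.
move=> a0; rewrite -lee_fin -mixE//.
pose k : R := 2 `^ (- (a / 2) - 1) * expR (- 1).
have k0 : 0 < k by rewrite mulr_gt0 ?expR_gt0// powR_gt0.
apply: (@le_trans _ _ (\int[mu]_(t in `[1%R, 2%R]) (cst k%:E t))%E).
  rewrite integral_cst//= lebesgue_measure_itv/= lte_fin ltr1n -EFinB -EFinM lee_fin.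
  by rewrite (_ : 2 - 1 = 1 :> R) ?mulr1//; lra.
apply: (@le_trans _ _ (\int[mu]_(t in `[1%R, 2%R]) (mix_fun a t)%:E)%E); last first.
  apply: ge0_subset_integral => //.
  - by apply/measurable_EFinP; exact: measurable_mix.
  - by move=> t _; rewrite lee_fin mix_fun_ge0.
apply: ge0_le_integral => //.
- by move=> t _; rewrite lee_fin ltW.
- by apply/measurable_EFinP; apply: measurable_funTS; exact: measurable_mix.
- move=> t /=; rewrite in_itv/= lee_fin => /andP[t1 t2].
  have t0 : 0 < t by exact: lt_le_trans t1.
  rewrite /mix_fun tpowE// ler_pM ?powR_ge0 ?expR_ge0//; last first.
    by rewrite ler_expR lerN2 ler_pdivrMr// mul1r.
  rewrite -opprD !powRN lef_pV2 ?posrE ?powR_gt0//.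
  by rewrite ge0_ler_powR ?nnegrE//; lra.
Qed.

Lemma mix_gt0 a : 0 < a -> 0 < mix a.
Proof.
move=> a0; apply: lt_le_trans (mix_ge a0).
by rewrite mulr_gt0 ?expR_gt0// powR_gt0.
Qed.

(** Whether [t] is above or below 1, [t^-k <= 1 + t^(-1/2)] for [0 <= k <= 1/2]. The bound makes the
    constant of [power_gap_ge] independent of [k]. *)
Lemma mix_le a k : 0 < a -> 0 <= k <= 1 / 2 -> mix (a + 2 * k) <= mix a + mix (a + 1).
Proof.
move=> a0 /andP[k0 k1]; rewrite -lee_fin EFinD -!mixE; [|lra|lra|lra].
rewrite -nnintD; [|exact: measurable_mix|exact: measurable_mix
  |exact: mix_fun_ge0|exact: mix_fun_ge0].
apply: nnint_le; [exact: measurable_mix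
  |by apply: measurable_funD; exact: measurable_mix|exact: mix_fun_ge0|].
move=> t; have [t0|t0] := leP t 0.
  by rewrite /mix_fun !tpow_le0// !mul0r addr0.
rewrite /mix_fun -mulrDl ler_wpM2r ?expR_ge0// !tpowE//.
rewrite (_ : - ((a + 2 * k) / 2) - 1 = - (a / 2) - 1 + - k); last by field.
rewrite (_ : - ((a + 1) / 2) - 1 = - (a / 2) - 1 + - (1 / 2)); last by field.
rewrite (powRD_gt0 _ (- k) t0) (powRD_gt0 _ (- (1 / 2)) t0).
set T := t `^ _; have T0 : 0 <= T by exact: powR_ge0.
rewrite -[X in _ <= X + _]mulr1 -mulrDr ler_wpM2l//.
have [t1|t1] := leP 1 t.
  rewrite (@le_trans _ _ 1)// ?lerDl ?powR_ge0//.
  by rewrite -[leRHS](@powRr0 R t) ler_powR//; lra.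
rewrite (@le_trans _ _ (t `^ (- (1 / 2))))// ?lerDr//.
by apply: ger_powR; rewrite ?t0 ?(ltW t1)//; lra.
Qed.

Lemma integral_mix a r : 0 < a -> 0 < r ->
  (\int[mu]_t (tpow (- (a / 2) - 1) t * expR (- (r / t)))%:E = (mix a * r `^ (- (a / 2)))%:E)%E.
Proof.
move=> a0 r0; pose g t := ((tpow (- (a / 2) - 1) t * expR (- (r / t)))%:E : \bar R).
have mg : measurable_fun [set: measurableTypeR R] g.
  by apply/measurable_EFinP; exact: measurable_mix.
have g0 t : (0 <= g t)%E by rewrite lee_fin mulr_ge0 ?tpow_ge0 ?expR_ge0.
have := @integral_affine R r 0 g (lt0r_neq0 r0) mg g0.
rewrite gtr0_norm// => /(congr1 (mule r%:E)).
rewrite muleA -EFinM divff ?gt_eqF// mul1e => <-.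
transitivity (r%:E * \int[mu]_t (r `^ (- (a / 2) - 1) * mix_fun a t)%:E)%E.
  congr (_ * _)%E; apply: eq_integral => t _; rewrite /g addr0 tpowM//.
  rewrite /mix_fun mulrA; have [->|t0] := eqVneq t 0; first by rewrite !(mulr0, mul0r) tpow_le0// mulr0 !mul0r.
  by congr (_ * expR _)%:E; field; rewrite t0 gt_eqF.
rewrite nnintZ ?powR_ge0//; last 2 first.
- exact: measurable_mix.
- exact: mix_fun_ge0.
have <- : r * r `^ (- (a / 2) - 1) = r `^ (- (a / 2)).
  by rewrite -{1}(powRr1 (ltW r0)) -powRD_gt0//; congr (_ `^ _); ring.
by rewrite mixE// -!EFinM; congr EFin; ring.
Qed.

End power_mixtures.

Section heat_mixtures.
Context {R : realType} {N : nat}.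
Local Notation mu := (@lebesgue_measure R).
Implicit Types (x : 'rV[R]_N) (a c t : R).

Definition pw a x : R := enorm x `^ (- a).

Lemma pw_ge0 a x : 0 <= pw a x.
Proof. exact: powR_ge0. Qed.

Lemma pw_gt0 a x : x != 0 -> 0 < pw a x.
Proof. by move=> x0; rewrite powR_gt0// enorm_gt0. Qed.

Lemma measurable_pw a : measurable_fun [set: 'rV[R]_N] (pw a).
Proof. exact: (measurableT_comp (measurable_powR _) measurable_enorm). Qed.

Lemma heat_mixture a x : 0 < a -> x != 0 ->
  (\int[mu]_t (tpow ((N%:R - a) / 2 - 1) t * heat t x)%:E = (mix a * pw a x)%:E)%E.
Proof.
move=> a0 x0.
have r0 : 0 < sqnorm x by rewrite -enorm_sq exprn_gt0// enorm_gt0.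
transitivity (\int[mu]_t (tpow (- (a / 2) - 1) t * expR (- (sqnorm x / t)))%:E)%E.
  apply: eq_integral => t _; rewrite /heat mulrA; congr (_ * _)%:E.
  have [t0|t0] := leP t 0; first by rewrite !tpow_le0// mul0r.
  by rewrite !tpowE// -powRD_gt0//; congr (_ `^ _); lra.
rewrite integral_mix// /pw -enorm_sq; congr (_ * _)%:E.
rewrite -powR_mulrn ?enorm_ge0// -powRrM; congr (_ `^ _); by field.
Qed.

(** At the origin [pw a] is 0 by the convention for [powR]; weakening the equality to an inequality
    makes it valid everywhere. *)
Lemma heat_mixture0 a x : 0 < a ->
  ((mix a * pw a x)%:E <= \int[mu]_t (tpow ((N%:R - a) / 2 - 1) t * heat t x)%:E)%E.
Proof.
move=> a0; have [->|x0] := eqVneq x 0; last by rewrite heat_mixture.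
rewrite /pw enorm0 powR0 ?oppr_eq0 ?gt_eqF// mulr0.
by apply: nnint_ge0 => t; rewrite mulr_ge0 ?tpow_ge0 ?heat_ge0.
Qed.

End heat_mixtures.

(** * One-dimensional convolutions in the heat time *)

Lemma bernoulli_powR {R : realType} (k z : R) : 0 <= k <= 1 -> 0 < z ->
  z `^ k <= 1 + k * (z - 1).
Proof.
move=> /andP[k0 k1] z0; rewrite /powR gt_eqF//; set m := k * ln z.
(* Jensen's inequality for [expR]: the tangent at [m], evaluated at [0] and at [ln z], is averaged
   with weights [1 - k] and [k]. *)
have h0 : 1 >= expR m * (1 - m).
  have := expR_ge1Dx (- m) => /(ler_wpM2l (expR_ge0 m)).
  by rewrite -expRD subrr expR0.
have h1 : z >= expR m * (1 + (ln z - m)).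
  have := expR_ge1Dx (ln z - m) => /(ler_wpM2l (expR_ge0 m)).
  rewrite -expRD (_ : m + (ln z - m) = ln z); last by ring.
  by rewrite lnK.
have : (1 - k) * (expR m * (1 - m)) + k * (expR m * (1 + (ln z - m))) <= (1 - k) * 1 + k * z.
  by rewrite lerD// ler_wpM2l// subr_ge0.
rewrite (_ : (1 - k) * (expR m * (1 - m)) + _ = expR m); last by rewrite /m; ring.
lra.
Qed.

(* [trunc e] is the truncation of [t^(-1-s)], whose mixture of heat kernels is
   the kernel of the fractional Laplacian. *)
Section truncated_convolution.
Context {R : realType} (s : R).
Context (hs : 0 < s < 1).
Local Notation mu := (@lebesgue_measure R).
Implicit Types (a b c e k r t : R).

Let s0 : 0 < s. Proof. by case/andP: hs. Qed.
Let s1 : s < 1. Proof. by case/andP: hs. Qed.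

Definition trunc e t : R := if e <= t then t `^ (- 1 - s) else 0.

Lemma trunc_ge0 e t : 0 <= trunc e t.
Proof. by rewrite /trunc; case: ifP => // _; exact: powR_ge0. Qed.

Lemma measurable_trunc e : measurable_fun [set: R] (trunc e).
Proof. by rewrite /trunc; mfun. Qed.

Definition trunc_conv b e r : \bar R := (\int[mu]_t (trunc e t * tpow (b - 1) (r - t))%:E)%E.

Lemma measurable_conv b e r : measurable_fun [set: R] (fun t => trunc e t * tpow (b - 1) (r - t)).
Proof.
apply: measurable_funM; first exact: measurable_trunc.
by apply: measurable_tpow_comp; mfun.
Qed.

Lemma conv_ge0 b e r t : 0 <= trunc e t * tpow (b - 1) (r - t).
Proof. by rewrite mulr_ge0 ?trunc_ge0 ?tpow_ge0. Qed.

(** The exponents [-1-s] and [s-1] add up to -2, so the integrand is [(r/t - 1)^(s-1) t^-2], which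
    has an explicit primitive. This makes [b = s], the exponent belonging to [|x|^-sigma], exactly
    computable. *)
Let F r t := - (s * r)^-1 * (r / t - 1) `^ s.

Let F_is_derive r t : 0 < t < r -> is_derive t 1 (F r) (t `^ (- 1 - s) * (r - t) `^ (s - 1)).
Proof.
move=> /andP[t0 tr].
have r0 : 0 < r by exact: lt_trans tr.
have pos : 0 < r / t - 1 by rewrite subr_gt0 ltr_pdivlMr// mul1r.
have d1 : is_derive t 1 (fun t => r / t - 1) (r * (- t ^- 2)).
  have h : is_derive t 1 (fun x : R => x^-1) (- t ^- 2).
    have := @is_deriveV R (@id R) t 1 1 (lt0r_neq0 t0) (is_derive_id _ _).
    by rewrite /GRing.scale/= mulr1.
  have h2 := is_deriveB (is_deriveZ r h) (is_derive_cst (1 : R) t 1).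
  by rewrite subr0 in h2; exact: h2.
have d2 := @is_derive1_comp R (fun y => y `^ s) (fun t => r / t - 1) t _ _ (is_derive1_powR s pos) d1.
have d3 := is_deriveZ (- (s * r)^-1) d2.
rewrite /GRing.scale/= in d3.
apply: (is_derive_eq d3).
have -> : r / t - 1 = (r - t) * t^-1 by field; rewrite gt_eqF.
rewrite powRM ?invr_ge0 ?subr_ge0 ?ltW// -(powR_inv1 (ltW t0)) -powRrM.
have -> : t ^- 2 = t `^ (- 2) by rewrite powRN powR_mulrn// ltW.
have -> : t `^ (- 1 - s) = t `^ (- 1 * (s - 1)) * t `^ (- 2).
  by rewrite -powRD_gt0//; congr (_ `^ _); ring.
by field; rewrite !gt_eqF.
Qed.

Let intF r a b : 0 < a -> a < b -> b < r ->
  (\int[mu]_(t in `[a, b]) (trunc a t * tpow (s - 1) (r - t))%:E = (F r b - F r a)%:E)%E.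
Proof.
move=> a0 ab br.
apply: etrans (@FTC_is_derive R (fun t => t `^ (- 1 - s) * (r - t) `^ (s - 1)) (F r) a b ab _ _).
- apply: eq_integral => t; rewrite inE/= in_itv/= => /andP[at_ tb].
  by rewrite /trunc at_ tpowE// subr_gt0 (le_lt_trans tb).
- move=> t /andP[at_ tb]; apply: F_is_derive.
  by rewrite (lt_le_trans a0 at_) (le_lt_trans tb).
- move=> t /andP[at_ tb]; have t0 := lt_le_trans a0 at_; have tr := le_lt_trans tb br.
  apply: cvgM; first exact: powR_continuous.
  apply: (@continuous_comp _ _ _ (fun t => r - t) (fun t => t `^ (s - 1))).
    by apply: cvgB; [exact: cvg_cst|exact: cvg_id].
  by apply: powR_continuous; rewrite subr_gt0.
Qed.

Let G e r := s^-1 * r^-1 * (r / e - 1) `^ s.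

Let conv_le e r : 0 < e -> e < r -> (trunc_conv s e r <= (G e r)%:E)%E.
Proof.
move=> e0 er; pose d n : R := (r - e) / n.+2%:R.
have re : 0 < r - e by rewrite subr_gt0.
have r0 : 0 < r by exact: lt_trans er.
have dn n : d n < r - e by rewrite /d gtr_pMr// invf_lt1// ltr1n.
have d0 n : 0 < d n by rewrite divr_gt0.
apply: (@nnint_exhaust_le _ _ (fun=> e) (fun n => r - d n)).
- exact: measurable_conv.
- exact: conv_ge0.
- by [].
- by move=> n k nk; rewrite lerB// /d ler_pM2l// lef_pV2 ?posrE// ler_nat.
- move=> t; rewrite /trunc; case: ifPn => et; last by rewrite mul0r eqxx.
  rewrite /tpow; case: ifPn => rt; last by rewrite mulr0 eqxx.
  rewrite subr_gt0 in rt; have rt0 : 0 < r - t by rewrite subr_gt0.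
  move=> _; exists (Num.truncn ((r - e) / (r - t))); rewrite ?et /= lerBrDr -lerBrDl.
  rewrite /d ler_pdivrMr// mulrC -ler_pdivrMr//.
  by apply: (le_trans (ltW (truncnS_gt _))); rewrite ler_nat.
- move=> n; rewrite intF//; last 2 first.
  + by have := dn n; lra.
  + by have := d0 n; lra.
  rewrite lee_fin /F /G invfM; set P := (_ / _ - 1) `^ s; set Q := (_ / _ - 1) `^ s.
  have P0 : 0 <= P by exact: powR_ge0.
  have : 0 <= s^-1 / r by rewrite divr_ge0// ?ltW// invr_gt0.
  by nra.
Qed.

Let conv_ge e r : 0 < e -> e < r -> ((G e r)%:E <= trunc_conv s e r)%E.
Proof.
move=> e0 er; have r0 : 0 < r by exact: lt_trans er.
have re1 : 0 < r / e - 1 by rewrite subr_gt0 ltr_pdivlMr// mul1r.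
apply/lee_addgt0Pr => eta eta0.
(* Stopping at [b = r/(1+k)], where [r/b - 1 = k], loses [k^s/(s r)], which is at most [eta] by the
   choice of [k]. *)
pose k := Num.min ((r / e - 1) / 2) ((s * r * eta) `^ s^-1).
have k0 : 0 < k by rewrite lt_min divr_gt0//= powR_gt0// !mulr_gt0.
have ke : k < r / e - 1 by rewrite gt_min; apply/orP; left; lra.
have ks : k `^ s <= s * r * eta.
  have h : k <= (s * r * eta) `^ s^-1 by rewrite ge_min lexx orbT.
  have : k `^ s <= ((s * r * eta) `^ s^-1) `^ s.
    by rewrite ge0_ler_powR ?nnegrE ?powR_ge0// ltW.
  by rewrite -powRrM mulVf ?gt_eqF// powRr1// ltW// !mulr_gt0.
pose b := r / (1 + k).
have k1 : 0 < 1 + k by rewrite addr_gt0.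
have br : b < r by rewrite /b ltr_pdivrMr// ltr_pMr// ltrDl.
have eb : e < b by rewrite /b ltr_pdivlMr// mulrC -ltr_pdivlMr//; lra.
have step : ((F r b - F r e)%:E <= trunc_conv s e r)%E.
  rewrite -intF//; apply: ge0_subset_integral => //.
  - by apply/measurable_EFinP; exact: measurable_conv.
  - by move=> t _; rewrite lee_fin conv_ge0.
apply: le_trans (leeD step (lexx _)).
rewrite -EFinD lee_fin /F /G invfM (_ : r / b - 1 = k); last first.
  by rewrite /b; field; rewrite !gt_eqF.
have : (s^-1 / r) * k `^ s <= (s^-1 / r) * (s * r * eta).
  by rewrite ler_wpM2l// divr_ge0// ?ltW// invr_gt0.
rewrite (_ : (s^-1 / r) * (s * r * eta) = eta); last by field; rewrite !gt_eqF.
lra.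
Qed.

Lemma trunc_convE e r : 0 < e -> e < r ->
  trunc_conv s e r = (s^-1 * r^-1 * (r / e - 1) `^ s)%:E.
Proof. by move=> e0 er; apply/eqP; rewrite eq_le conv_le// conv_ge. Qed.

Lemma trunc_conv_le0 b e r : r <= e -> trunc_conv b e r = 0%E.
Proof.
move=> re; rewrite /trunc_conv integral0_eq// => t _; congr EFin.
rewrite /trunc; case: ifPn => et; last by rewrite mul0r.
by rewrite tpow_le0 ?mulr0// subr_le0 (le_trans re).
Qed.

Lemma trunc_conv_critical_le e r : 0 < e -> 0 < r ->
  (trunc_conv s e r <= (s^-1 * e `^ (- s) * r `^ (s - 1))%:E)%E.
Proof.
move=> e0 r0; have [re|er] := leP r e.
  by rewrite trunc_conv_le0// lee_fin !mulr_ge0 ?powR_ge0// invr_ge0 ltW.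
rewrite trunc_convE// lee_fin -!mulrA ler_wpM2l ?invr_ge0 ?(ltW s0)//.
have re1 : 0 < r / e - 1 by rewrite subr_gt0 ltr_pdivlMr// mul1r.
apply: (@le_trans _ _ (r^-1 * (r / e) `^ s)).
  rewrite ler_wpM2l ?invr_ge0 ?(ltW r0)// ge0_ler_powR ?nnegrE ?(ltW s0)//; first exact: ltW.
    by rewrite divr_ge0// ltW.
  by rewrite gerBl.
rewrite powRM ?invr_ge0 ?(ltW e0) ?(ltW r0)// -(powR_inv1 (ltW e0)) -powRrM mulN1r.
have <- : r^-1 * r `^ s = r `^ (s - 1).
  by rewrite -(powR_inv1 (ltW r0)) -powRD_gt0// addrC.
by rewrite le_eqVlt; apply/orP; left; apply/eqP; ring.
Qed.

(** From [(1-z)^s >= 1-z] with [z = e/r]; for [r <= e] the left-hand side is nonpositive. Together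
    with [trunc_conv_critical_le], the deviation from the mass of [trunc] times [r^(s-1)] has order
    [e^(1-s)] and disappears as [e -> 0]. *)
Lemma trunc_conv_critical_ge e r : 0 < e -> 0 < r ->
  ((s^-1 * (e `^ (- s) * r `^ (s - 1) - e `^ (1 - s) * r `^ (s - 2)))%:E <= trunc_conv s e r)%E.
Proof.
move=> e0 r0.
have -> : e `^ (- s) * r `^ (s - 1) - e `^ (1 - s) * r `^ (s - 2) =
   e `^ (- s) * r `^ (s - 2) * (r - e).
  rewrite (powRD_gt0 _ _ e0) powRr1 ?(ltW e0)//.
  by rewrite (_ : s - 1 = 1 + (s - 2)) ?(powRD_gt0 _ _ r0) ?powRr1 ?(ltW r0)//; ring.
have [re|er] := leP r e.
  rewrite trunc_conv_le0// lee_fin.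
  rewrite mulr_ge0_le0 ?invr_ge0 ?(ltW s0)// mulr_ge0_le0 ?mulr_ge0 ?powR_ge0//.
  by rewrite subr_le0.
rewrite trunc_convE// lee_fin -!mulrA ler_wpM2l ?invr_ge0 ?(ltW s0)//.
have z0 : 0 < 1 - e / r by rewrite subr_gt0 ltr_pdivrMr// mul1r.
have z1 : 1 - e / r <= 1 by rewrite gerBl divr_ge0// ltW.
have -> : r / e - 1 = r * e^-1 * (1 - e / r) by field; rewrite !gt_eqF.
rewrite powRM ?mulr_ge0 ?invr_ge0 ?(ltW e0) ?(ltW r0) ?(ltW z0)// powRM ?invr_ge0 ?(ltW e0) ?(ltW r0)//.
rewrite -(powR_inv1 (ltW e0)) -powRrM mulN1r.
rewrite (_ : _ * (r `^ _ * (r - e)) = r^-1 * (r `^ s * e `^ (- s) * (1 - e / r))); last first.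
  rewrite (_ : s - 2 = s + (- (2%:R : R))) ?(powRD_gt0 _ _ r0)// (powR_invn 2 (ltW r0)).
  by field; rewrite gt_eqF.
rewrite ler_wpM2l ?invr_ge0 ?(ltW r0)// ler_wpM2l ?mulr_ge0 ?powR_ge0//.
rewrite -{1}(powRr1 (ltW z0)); by apply: ger_powR; rewrite ?z0 ?z1 ?(ltW s1).
Qed.

End truncated_convolution.

Section truncated_convolution_bounds.
Context {R : realType} (s : R) (hs : 0 < s < 1).
Local Notation mu := (@lebesgue_measure R).
Implicit Types (a b c e k r t : R).

Let s0 : 0 < s. Proof. by case/andP: hs. Qed.
Let s1 : s < 1. Proof. by case/andP: hs. Qed.

Lemma integral_trunc e : 0 < e ->
  (\int[mu]_t (trunc s e t)%:E <= (s^-1 * e `^ (- s))%:E)%E.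
Proof.
move=> e0; apply: (@nnint_exhaust_le _ _ (fun=> e) (fun n => e + n.+1%:R)).
- exact: measurable_trunc.
- exact: trunc_ge0.
- by [].
- by move=> n k nk; rewrite lerD2l ler_nat.
- move=> t; rewrite /trunc; case: ifPn => et; last by rewrite eqxx.
  move=> _; exists (Num.truncn t); rewrite ?et /=.
  by apply: (le_trans (ltW (truncnS_gt _))); rewrite lerDr ltW.
- move=> n; rewrite (_ : (\int[mu]_(t in _) _)%E =
      (\int[mu]_(t in `[e, (e + n.+1%:R)%R]) (t `^ (- s - 1))%:E)%E).
    rewrite integral_powR ?ltrDl ?oppr_eq0 ?gt_eqF// lee_fin invrN !mulNr opprK.
    by rewrite gerDr oppr_le0 mulr_ge0 ?powR_ge0// invr_ge0 ltW.
  apply: eq_integral => t; rewrite inE/= in_itv/= /trunc => /andP[-> _].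
  by congr ((_ `^ _)%:E); ring.
Qed.

(** The integrand of the Beta integral [B(1-s, b)]. *)
Definition beta_fun b t : R := tpow (- s) t * tpow (b - 1) (1 - t).

Lemma beta_fun_ge0 b t : 0 <= beta_fun b t.
Proof. by rewrite mulr_ge0 ?tpow_ge0. Qed.

Lemma measurable_beta b : measurable_fun [set: R] (beta_fun b).
Proof. by apply: measurable_funM => //; apply: measurable_tpow_comp; mfun. Qed.

Let near0 c t := if t <= 1 then tpow (c - 1) t else 0.

Let near0_ge0 c t : 0 <= near0 c t.
Proof. by rewrite /near0; case: ifP. Qed.

Let near0_measurable c : measurable_fun [set: R] (near0 c).
Proof. by rewrite /near0; mfun. Qed.

Let near0_lty c : 0 < c -> (\int[mu]_t (near0 c t)%:E < +oo)%E.
Proof.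
move=> c0; apply: (@nnint_lty _ _ 1 c 1) => // t; rewrite mul1r /near0.
by case: ifP; rewrite ?tpow_ge0.
Qed.

Lemma beta_lty b : 0 < b -> b < 1 -> (\int[mu]_t (beta_fun b t)%:E < +oo)%E.
Proof.
move=> b0 b1.
pose g1 t := 2 `^ (1 - b) * near0 (1 - s) t; pose g2 t := 2 `^ s * near0 b (- 1 * t + 1).
have m2' : measurable_fun [set: R] (fun t => near0 b (- 1 * t + 1)).
  apply: (measurableT_comp (near0_measurable b)); mfun.
have m1 : measurable_fun [set: R] g1 by rewrite /g1; mfun; exact: near0_measurable.
have m2 : measurable_fun [set: R] g2 by rewrite /g2; mfun.
have g10 t : 0 <= g1 t by rewrite mulr_ge0 ?powR_ge0.
have g20 t : 0 <= g2 t by rewrite mulr_ge0 ?powR_ge0.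
apply: (@le_lt_trans _ _ (\int[mu]_t (g1 t + g2 t)%:E)%E).
  apply: nnint_le => //.
  - exact: measurable_beta.
  - by mfun.
  - exact: beta_fun_ge0.
  move=> t; have [t0|t0] := leP t 0.
    by rewrite /beta_fun tpow_le0// mul0r addr_ge0.
  have [t1|t1] := leP 1 t.
    by rewrite /beta_fun [tpow _ (1 - t)]tpow_le0 ?mulr0 ?addr_ge0// subr_le0.
  have u0 : 0 < 1 - t by rewrite subr_gt0.
  rewrite /beta_fun /g1 /g2 /near0 (ltW t1) (_ : - 1 * t + 1 = 1 - t); last by ring.
  rewrite gerBl (ltW t0) !tpowE//.
  rewrite (_ : 1 - s - 1 = - s); last by ring.
  have [h|h] := leP t 2^-1.
    rewrite (@le_trans _ _ (2 `^ (1 - b) * t `^ (- s)))// ?lerDl ?mulr_ge0 ?powR_ge0//.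
    rewrite mulrC ler_wpM2r ?powR_ge0// -(opprB 1 b) powRN -powR_inv1 ?powR_ge0// powRAC.
    rewrite ge0_ler_powR ?nnegrE ?powR_ge0// ?subr_ge0 ?(ltW b1)// powR_inv1 ?(ltW u0)//.
    by rewrite invf_ple ?posrE//; lra.
  rewrite (@le_trans _ _ (2 `^ s * (1 - t) `^ (b - 1)))// ?lerDr ?mulr_ge0 ?powR_ge0//.
  rewrite ler_wpM2r ?powR_ge0// powRN -powR_inv1 ?powR_ge0// powRAC.
  rewrite ge0_ler_powR ?nnegrE ?powR_ge0// ?(ltW s0)// powR_inv1 ?(ltW t0)//.
  by rewrite invf_ple ?posrE// ltW.
have := @nnintD _ _ R mu _ _ m1 m2 g10 g20 => ->; rewrite lte_add_pinfty//.
  rewrite nnintZ ?powR_ge0//; last exact: near0_measurable.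
  by apply: lte_mul_pinfty; rewrite ?lee_fin ?powR_ge0// near0_lty// subr_gt0.
rewrite nnintZ ?powR_ge0//.
apply: lte_mul_pinfty; rewrite ?lee_fin ?powR_ge0//.
rewrite (@integral_affine R (- 1) 1 (fun t => (near0 b t)%:E)) ?oppr_eq0 ?oner_eq0//.
- by rewrite normrN1 invr1 mul1e near0_lty.
- by apply/measurable_EFinP; exact: near0_measurable.
- by move=> t; rewrite lee_fin near0_ge0.
Qed.

Lemma integral_beta_scaled b r : 0 < b -> b < 1 -> 0 < r ->
  (\int[mu]_t (tpow (- s) t * tpow (b - 1) (r - t))%:E =
   (r `^ (b - s) * fine (\int[mu]_t (beta_fun b t)%:E))%:E)%E.
Proof.
move=> b0 b1 r0; pose g t := ((tpow (- s) t * tpow (b - 1) (r - t))%:E : \bar R).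
have mg : measurable_fun [set: measurableTypeR R] g.
  apply/measurable_EFinP; apply: measurable_funM => //.
  by apply: measurable_tpow_comp; mfun.
have g0 t : (0 <= g t)%E by rewrite lee_fin mulr_ge0 ?tpow_ge0.
have := @integral_affine R r 0 g (lt0r_neq0 r0) mg g0.
rewrite gtr0_norm// => /(congr1 (mule r%:E)).
rewrite muleA -EFinM divff ?gt_eqF// mul1e => <-.
transitivity (r%:E * \int[mu]_t ((r `^ (- s) * r `^ (b - 1)) * beta_fun b t)%:E)%E.
  congr (_ * _)%E; apply: eq_integral => t _; rewrite /g addr0 tpowM// /beta_fun.
  by rewrite (_ : r - r * t = r * (1 - t)) ?tpowM//; [congr EFin; ring|ring].
rewrite nnintZ ?mulr_ge0 ?powR_ge0//; last 2 first.
- exact: measurable_beta.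
- by move=> t; exact: beta_fun_ge0.
rewrite -[X in (_ * (_ * X))%E]fineK; last first.
  by rewrite ge0_fin_numE ?beta_lty// nnint_ge0//; exact: beta_fun_ge0.
rewrite -!EFinM mulrA; congr (_ * _)%:E.
by rewrite -{1}(powRr1 (ltW r0)) -!powRD_gt0//; congr (_ `^ _); ring.
Qed.

(* From [(1-z)^(b-1) <= 1 + z (1-z)^(b-1)]: the excess over [t^(-1-s)]'s own
   mass is a beta integral, bounded independently of the truncation. *)
Lemma trunc_conv_le b : 0 < b -> b < 1 -> exists2 C, 0 <= C &
  forall e r, 0 < e -> 0 < r ->
  (trunc_conv s b e r <= (s^-1 * e `^ (- s) * r `^ (b - 1) + C * r `^ (b - 1 - s))%:E)%E.
Proof.
move=> b0 b1; exists (fine (\int[mu]_t (beta_fun b t)%:E)).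
  by rewrite fine_ge0// nnint_ge0//; exact: beta_fun_ge0.
move=> e r e0 r0.
pose g t := tpow (- s) t * tpow (b - 1) (r - t).
have mg : measurable_fun [set: R] g.
  by apply: measurable_funM => //; apply: measurable_tpow_comp; mfun.
have g0 t : 0 <= g t by rewrite mulr_ge0 ?tpow_ge0.
apply: (@le_trans _ _ (\int[mu]_t (r `^ (b - 1) * trunc s e t + r^-1 * g t)%:E)%E).
  apply: nnint_le.
  - exact: measurable_conv.
  - by mfun; exact: measurable_trunc.
  - by move=> t; exact: conv_ge0.
  move=> t; rewrite /trunc; case: ifPn => et; last first.
    by rewrite mul0r mulr0 add0r mulr_ge0 ?mulr_ge0 ?tpow_ge0 ?invr_ge0 ?(ltW r0).
  have t0 : 0 < t by exact: lt_le_trans et.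
  have [rt|tr] := leP r t.
    by rewrite tpow_le0 ?subr_le0// mulr0 addr_ge0 ?mulr_ge0 ?powR_ge0 ?tpow_ge0 ?invr_ge0 ?(ltW r0).
  have u0 : 0 < r - t by rewrite subr_gt0.
  rewrite /g !tpowE//.
  rewrite (_ : t `^ (- s) = t * t `^ (- 1 - s)); last first.
    by rewrite -{2}(powRr1 (ltW t0)) -powRD_gt0//; congr (_ `^ _); ring.
  set T := t `^ (- 1 - s); have T0 : 0 <= T by exact: powR_ge0.
  have key : (r - t) `^ b <= r `^ b.
    by rewrite ge0_ler_powR ?nnegrE ?(ltW b0) ?(ltW u0) ?(ltW r0)// gerBl ltW.
  have key2 : (r - t) * (r - t) `^ (b - 1) <= r * r `^ (b - 1).
    by rewrite !mulr_powRB1// ltW.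
  have -> : T * (r - t) `^ (b - 1) = T * r^-1 * ((r - t) * (r - t) `^ (b - 1)) +
     r^-1 * (t * T * (r - t) `^ (b - 1)) by field; rewrite gt_eqF.
  rewrite lerD2r (_ : r `^ (b - 1) * T = T * r^-1 * (r * r `^ (b - 1))); last first.
    by field; rewrite gt_eqF.
  by rewrite ler_wpM2l// mulr_ge0// invr_ge0 ltW.
rewrite nnintD; last 4 first.
- by mfun; exact: measurable_trunc.
- by mfun.
- by move=> t; rewrite mulr_ge0 ?powR_ge0 ?trunc_ge0.
- by move=> t; rewrite mulr_ge0 ?invr_ge0 ?(ltW r0).
have ri0 : 0 <= r^-1 by rewrite invr_ge0 ltW.
have -> := @nnintZ _ _ R mu _ _ (measurable_trunc s e) (trunc_ge0 s e) (powR_ge0 r (b - 1)).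
have -> := @nnintZ _ _ R mu _ _ mg g0 ri0.
rewrite integral_beta_scaled// EFinD leeD//.
  rewrite mulrC EFinM lee_wpmul2l ?lee_fin ?powR_ge0//.
  exact: integral_trunc.
rewrite -EFinM lee_fin mulrA mulrC ler_wpM2l//.
  by rewrite fine_ge0// nnint_ge0//; exact: beta_fun_ge0.
by rewrite -(powR_inv1 (ltW r0)) -powRD_gt0// (_ : -1 + (b - s) = b - 1 - s)//; ring.
Qed.

(** [(r-t)^-k] is at least [r^-k], and at least [2^k r^-k] once [t >= r/2]. The gain is
    [(2^k - 1) r^-k] times the convolution cut off at [r/2], which [trunc_convE] evaluates to
    [1/(s r)]. For [k > 0] it is the source of the negative fractional Laplacian. *)
Lemma trunc_conv_subcritical_ge k e r : 0 <= k -> 0 < e -> 2 * e < r ->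
  ((r `^ (- k))%:E * trunc_conv s s e r + (((2 `^ k - 1) / s) * r `^ (- k - 1))%:E <=
   trunc_conv s (s - k) e r)%E.
Proof.
move=> k0 e0 er; have r0 : 0 < r by lra.
have kk : 0 <= 2 `^ k - 1.
  by rewrite subr_ge0 -[leLHS](@powRr0 R 2) ler_powR// ler1n.
have -> : (((2 `^ k - 1) / s) * r `^ (- k - 1))%:E =
    (((2 `^ k - 1) * r `^ (- k))%:E * trunc_conv s s (r / 2) r)%E.
  rewrite trunc_convE//; [|by lra|by lra].
  have -> : r / (r / 2) - 1 = 1 by field; rewrite gt_eqF.
  rewrite powR1 mulr1 -EFinM powRD_gt0// powR_inv1 ?(ltW r0)//.
  by congr EFin; ring.
rewrite /trunc_conv -nnintZ; last 3 first.
- exact: measurable_conv.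
- by move=> t; exact: conv_ge0.
- exact: powR_ge0.
rewrite -nnintZ; last 3 first.
- exact: measurable_conv.
- by move=> t; exact: conv_ge0.
- by rewrite mulr_ge0 ?powR_ge0.
rewrite -nnintD; last 4 first.
- by apply: measurable_funM => //; exact: measurable_conv.
- by apply: measurable_funM => //; exact: measurable_conv.
- by move=> t; rewrite mulr_ge0 ?powR_ge0// ?conv_ge0.
- by move=> t; apply: mulr_ge0; [rewrite mulr_ge0 ?powR_ge0|exact: conv_ge0].
apply: nnint_le.
- by apply: measurable_funD; apply: measurable_funM => //; exact: measurable_conv.
- exact: measurable_conv.
- by move=> t; rewrite addr_ge0 ?mulr_ge0 ?powR_ge0 ?trunc_ge0 ?tpow_ge0.
move=> t; have [rt|tr] := leP r t.
  by rewrite !tpow_le0 ?subr_le0// !mulr0 addr0.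
have u0 : 0 < r - t by rewrite subr_gt0.
rewrite !tpowE// (_ : s - k - 1 = (s - 1) + (- k)); last by ring.
rewrite (powRD_gt0 (s - 1) (- k) u0); set A := (r - t) `^ (s - 1).
have A0 : 0 <= A by exact: powR_ge0.
have h1 : r - t <= r -> r `^ (- k) <= (r - t) `^ (- k).
  by move=> h; rewrite !powRN lef_pV2 ?posrE ?powR_gt0// ge0_ler_powR ?nnegrE ?(ltW r0) ?(ltW u0).
rewrite /trunc; case: ifPn => et.
  have t0 : 0 < t by exact: lt_le_trans et.
  set T := t `^ _; have T0 : 0 <= T by exact: powR_ge0.
  case: ifPn => rt.
    have h2 : 2 `^ k * r `^ (- k) <= (r - t) `^ (- k).
      rewrite (_ : 2 `^ k = 2^-1 `^ (- k)); last first.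
        by rewrite -(@powR_inv1 R 2)// -powRrM; congr (_ `^ _); ring.
      rewrite -powRM ?(ltW r0)// !powRN lef_pV2 ?posrE ?powR_gt0//; last by lra.
      by rewrite ge0_ler_powR ?nnegrE ?(ltW u0)//; lra.
    rewrite (_ : _ + _ = (T * A) * (2 `^ k * r `^ (- k))); last by ring.
    by rewrite [leRHS]mulrA ler_wpM2l// mulr_ge0.
  rewrite !mul0r mulr0 addr0 mulrC mulrA ler_wpM2l ?mulr_ge0//.
  by apply: h1; rewrite gerBl ltW.
case: ifPn => rt; last by rewrite !mul0r !mulr0 addr0.
by move: et; rewrite -ltNge => te; exfalso; lra.
Qed.

(** Interpolation in [k]: by [bernoulli_powR] with exponent [2k], [(r/(r-t))^k <= 1 + 2k
    ((r/(r-t))^(1/2) - 1)]. The endpoint [k = 0] leaves no remainder, so the remainder carries a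
    factor [k] and [C] comes from the endpoint [k = 1/2] alone, where [s > 1/2] keeps
    [(r-t)^(s-1/2-1)] integrable. *)
Lemma trunc_conv_subcritical_le : 1 / 2 < s -> exists2 C, 0 <= C &
  forall k e r, 0 <= k <= 1 / 2 -> 0 < e -> 0 < r ->
  (trunc_conv s (s - k) e r <=
   (s^-1 * e `^ (- s) * r `^ (s - k - 1) + k * C * r `^ (- k - 1))%:E)%E.
Proof.
move=> s2; have h0 := s0; have h1 := s1; have [||C C0 HC] := @trunc_conv_le (s - 1 / 2); [lra|lra|].
exists (2 * C); first by rewrite mulr_ge0.
move=> k e r /andP[k0 k1] e0 r0.
have P := powR_gt0 _ r0.
apply: (@le_trans _ _ (((1 - 2 * k) * r `^ (- k))%:E * trunc_conv s s e r +
    (2 * k * r `^ (1 / 2 - k))%:E * trunc_conv s (s - 1 / 2) e r)%E).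
  have c1 : 0 <= (1 - 2 * k) * r `^ (- k) by rewrite mulr_ge0 ?(ltW (P _))//; lra.
  have c2 : 0 <= 2 * k * r `^ (1 / 2 - k) by rewrite !mulr_ge0 ?(ltW (P _))//; lra.
  rewrite /trunc_conv -!nnintZ ?powR_ge0//; last 4 first.
  - exact: measurable_conv.
  - by move=> t; exact: conv_ge0.
  - exact: measurable_conv.
  - by move=> t; exact: conv_ge0.
  rewrite -nnintD; last 4 first.
  - by apply: measurable_funM => //; exact: measurable_conv.
  - by apply: measurable_funM => //; exact: measurable_conv.
  - by move=> t; rewrite mulr_ge0// ?conv_ge0.
  - by move=> t; rewrite mulr_ge0// ?conv_ge0.
  apply: nnint_le.
  - exact: measurable_conv.
  - by apply: measurable_funD; apply: measurable_funM => //; exact: measurable_conv.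
  - by move=> t; exact: conv_ge0.
  move=> t; have [rt|tr] := leP r t.
    by rewrite !tpow_le0 ?subr_le0// !mulr0 addr0.
  have u0 : 0 < r - t by rewrite subr_gt0.
  have [e1|te] := ltP t e.
    by rewrite /trunc [e <= t]leNgt e1/= !mul0r !mulr0 addr0.
  rewrite !tpowE// (_ : s - k - 1 = (s - 1) + (- k)); last by ring.
  rewrite (_ : s - 1 / 2 - 1 = (s - 1) + (- (1 / 2))); last by ring.
  rewrite (powRD_gt0 (s - 1) (- k) u0) (powRD_gt0 (s - 1) (- (1 / 2)) u0); set A := (r - t) `^ (s - 1).
  have A0 : 0 <= A by exact: powR_ge0.
  have z0 : 0 < (r / (r - t)) `^ (1 / 2) by rewrite powR_gt0// divr_gt0.
  have h : r `^ k * (r - t) `^ (- k) <= 1 + 2 * k * (r `^ (1 / 2) * (r - t) `^ (- (1 / 2)) - 1).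
    have : 0 <= 2 * k <= 1 by lra.
    move/(bernoulli_powR (k := 2 * k)) => /(_ _ z0); rewrite -powRrM.
    have e2 : 1 / 2 * (2 * k) = k by field.
    rewrite e2 !powRM ?invr_ge0 ?(ltW r0) ?(ltW u0)//.
    by rewrite -(powR_inv1 (ltW u0)) -!powRrM !mulN1r.
  have {h} := ler_wpM2l (ltW (P (- k))) h.
  have E : r `^ (- k) * r `^ k = 1 by rewrite -powRD_gt0// addNr powRr0.
  rewrite [X in X <= _ -> _]mulrA E [X in X <= _ -> _]mul1r => h.
  rewrite (_ : 1 / 2 - k = - k + 1 / 2) ?[r `^ (_ + 1 / 2)]powRD_gt0//; last by ring.
  have TA : 0 <= trunc s e t * A by rewrite mulr_ge0// trunc_ge0.
  have := ler_wpM2l TA h; lra.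
rewrite (_ : s^-1 * e `^ (- s) * r `^ (s - k - 1) + k * (2 * C) * r `^ (- k - 1) =
   (1 - 2 * k) * r `^ (- k) * (s^-1 * e `^ (- s) * r `^ (s - 1)) +
   2 * k * r `^ (1 / 2 - k) * (s^-1 * e `^ (- s) * r `^ (s - 1 / 2 - 1) + C * r `^ (s - 1 / 2 - 1 - s))).
  rewrite EFinD; apply: leeD; rewrite [leRHS]EFinM; apply: lee_wpmul2l.
  - by rewrite lee_fin mulr_ge0 ?(ltW (P _))//; lra.
  - exact: trunc_conv_critical_le.
  - by rewrite lee_fin !mulr_ge0 ?(ltW (P _))//; lra.
  - exact: HC.
have E1 : r `^ (- k) * r `^ (s - 1) = r `^ (s - k - 1).
  by rewrite -powRD_gt0//; congr (_ `^ _); ring.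
have E2 : r `^ (1 / 2 - k) * r `^ (s - 1 / 2 - 1) = r `^ (s - k - 1).
  by rewrite -powRD_gt0//; congr (_ `^ _); ring.
have E3 : r `^ (1 / 2 - k) * r `^ (s - 1 / 2 - 1 - s) = r `^ (- k - 1).
  by rewrite -powRD_gt0//; congr (_ `^ _); field.
rewrite [RHS](_ : _ = (1 - 2 * k) * (s^-1 * e `^ (- s)) * (r `^ (- k) * r `^ (s - 1)) +
   2 * k * (s^-1 * e `^ (- s)) * (r `^ (1 / 2 - k) * r `^ (s - 1 / 2 - 1)) +
   2 * k * C * (r `^ (1 / 2 - k) * r `^ (s - 1 / 2 - 1 - s))); last by ring.
rewrite E1 E2 E3; ring.
Qed.

End truncated_convolution_bounds.

Section truncated_convolution_lower.
Context {R : realType} (s : R) (hs : 0 < s < 1).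
Local Notation mu := (@lebesgue_measure R).
Implicit Types (e k r t : R).

Let s0 : 0 < s. Proof. by case/andP: hs. Qed.

Lemma integral_truncE e : 0 < e ->
  (\int[mu]_t (trunc s e t)%:E = (s^-1 * e `^ (- s))%:E)%E.
Proof.
move=> e0; apply/eqP; rewrite eq_le integral_trunc//=.
apply/lee_addgt0Pr => eta eta0.
(* [X^s >= 1/(s eta)], so the tail [X^-s / s] beyond [X] is at most [eta]. *)
pose X := e + 1 + (s * eta) `^ (- s^-1).
have P0 : 0 < (s * eta) `^ (- s^-1) by rewrite powR_gt0// mulr_gt0.
have eX : e < X by rewrite /X; lra.
have X0 : 0 < X by exact: lt_trans eX.
have step : ((- s^-1 * X `^ (- s) + s^-1 * e `^ (- s))%:E <= \int[mu]_t (trunc s e t)%:E)%E.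
  have := @integral_powR R e X (- s) e0 eX; rewrite oppr_eq0 gt_eqF// => /(_ isT).
  rewrite invrN !mulNr opprK => <-.
  rewrite (_ : (\int[mu]_(t in _) _)%E = (\int[mu]_(t in `[e, X]) (trunc s e t)%:E)%E).
    apply: ge0_subset_integral => //.
    - by apply/measurable_EFinP; exact: measurable_trunc.
    - by move=> t _; rewrite lee_fin trunc_ge0.
  apply: eq_integral => t; rewrite inE/= in_itv/= /trunc => /andP[-> _].
  by congr ((_ `^ _)%:E); ring.
apply: le_trans (leeD step (lexx _)); rewrite -EFinD lee_fin.
suff : s^-1 * X `^ (- s) <= eta by lra.
rewrite mulrC ler_pdivrMr// mulrC powRN invf_ple ?posrE ?powR_gt0 ?mulr_gt0//.
have : ((s * eta) `^ (- s^-1)) `^ s <= X `^ s.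
  by rewrite ge0_ler_powR ?nnegrE ?(ltW s0) ?(ltW P0) ?(ltW X0)// /X; lra.
by rewrite -powRrM mulNr mulVf ?gt_eqF// powR_inv1// ltW// mulr_gt0.
Qed.

(** Both brackets carry the factor [r - 2e]: for [r <= 2e], outside the range of
    [trunc_conv_subcritical_ge], the left-hand side is nonpositive. The estimate can thus be
    integrated over all [r > 0]. *)
Lemma trunc_conv_lower k e r : 0 <= k -> 0 < e -> 0 < r ->
  ((s^-1 * (e `^ (- s) * r `^ (s - k - 1) - 2 * e `^ (1 - s) * r `^ (s - k - 2)) +
    ((2 `^ k - 1) / s) * (r `^ (- k - 1) - 2 * e * r `^ (- k - 2)))%:E <=
   trunc_conv s (s - k) e r)%E.
Proof.
move=> k0 e0 r0.
have h0 := s0; have si0 : 0 < s^-1 by rewrite invr_gt0.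
have c0 : 0 <= (2 `^ k - 1) / s.
  by rewrite divr_ge0 ?(ltW s0)// subr_ge0 -[leLHS](@powRr0 R 2) ler_powR// ler1n.
have E0 (c : R) : r `^ (c - 1) = r * r `^ (c - 2).
  by rewrite (_ : c - 1 = 1 + (c - 2)) ?powRD_gt0 ?powRr1 ?(ltW r0)//; ring.
have Ee : e `^ (1 - s) = e * e `^ (- s) by rewrite powRD_gt0// powRr1 ?(ltW e0).
have [re|er] := leP r (2 * e).
  apply: (@le_trans _ _ 0%E); last first.
    by apply: nnint_ge0 => t; exact: conv_ge0.
  rewrite lee_fin !E0 Ee.
  have P1 := powR_ge0 r (s - k - 2); have P2 := powR_ge0 r (- k - 2).
  have P3 := powR_ge0 e (- s).
  have h1 : (r - 2 * e) * (e `^ (- s) * r `^ (s - k - 2)) <= 0.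
    by rewrite mulr_le0_ge0 ?mulr_ge0// subr_le0.
  have h2 : (r - 2 * e) * r `^ (- k - 2) <= 0 by rewrite mulr_le0_ge0// subr_le0.
  have h3 : s^-1 * ((r - 2 * e) * (e `^ (- s) * r `^ (s - k - 2))) <= 0.
    by rewrite mulr_ge0_le0// ltW.
  have h4 : (2 `^ k - 1) / s * ((r - 2 * e) * r `^ (- k - 2)) <= 0.
    by rewrite mulr_ge0_le0.
  lra.
apply: le_trans (trunc_conv_subcritical_ge hs k0 e0 er).
have P := powR_ge0 r (- k).
have -> : s^-1 * (e `^ (- s) * r `^ (s - k - 1) - 2 * e `^ (1 - s) * r `^ (s - k - 2)) =
    r `^ (- k) * (s^-1 * (e `^ (- s) * r `^ (s - 1) - 2 * e `^ (1 - s) * r `^ (s - 2))).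
  rewrite (_ : s - k - 1 = - k + (s - 1)); last by ring.
  rewrite (_ : s - k - 2 = - k + (s - 2)); last by ring.
  rewrite (powRD_gt0 (- k) (s - 1) r0) (powRD_gt0 (- k) (s - 2) r0); ring.
rewrite EFinD; apply: leeD; last first.
  rewrite lee_fin ler_wpM2l// gerBl !mulr_ge0 ?powR_ge0//; exact: ltW.
rewrite EFinM; apply: lee_wpmul2l; first by rewrite lee_fin.
apply: le_trans (trunc_conv_critical_ge hs e0 r0).
rewrite lee_fin ler_wpM2l ?(ltW si0)// lerD2l lerN2 -mulrA ler_peMl ?ler1n//.
by rewrite mulr_ge0 ?powR_ge0.
Qed.

End truncated_convolution_lower.

(** * Null points, and Tonelli for curried functions *)

Lemma lebesgue_rV_set1 {R : realType} n (x : 'rV[R]_n.+1) : lebesgue_rV n.+1 [set x] = 0%E.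
Proof.
rewrite /= /lebesgue_rVS /pushforward.
have -> : cons_rV @^-1` [set x] = [set (uncons_rV x).1] `*` [set (uncons_rV x).2].
  apply/seteqP; split=> [z <-|[t v] [h1 h2]].
    by rewrite cons_rVK; split.
  rewrite /= in h1 h2; rewrite /= h1 h2; exact: (uncons_rVK x).
rewrite product_measure1E//=; first by rewrite lebesgue_measure_set1 mul0e.
rewrite (_ : [set _] = (fun y => sqnorm (1 *: y + - (uncons_rV x).2)) @^-1` [set 0]).
  rewrite -[X in measurable X]setTI.
  exact: (measurableT_comp measurable_sqnorm (measurable_affine_rV _ _)).
apply/seteqP; split=> y /=; rewrite scale1r.
  by move=> ->; apply/eqP; rewrite sqnorm_eq0 subrr.
by move/eqP; rewrite sqnorm_eq0 subr_eq0 => /eqP.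
Qed.

(** Points are null in positive dimension. It is applied at [h = -y], where [y + h] is the origin
    excluded by [heat_mixture]. *)
Lemma ge0_integral_off_point {R : realType} n (x : 'rV[R]_n.+1) (f g : 'rV[R]_n.+1 -> \bar R) :
  measurable_fun setT f -> measurable_fun setT g -> (forall y, 0 <= f y)%E ->
  (forall y, 0 <= g y)%E -> (forall y, y != x -> f y = g y) ->
  (\int[lebesgue_rV n.+1]_y f y = \int[lebesgue_rV n.+1]_y g y)%E.
Proof.
move=> mf mg f0 g0 fg; apply: ge0_ae_eq_integral => //.
exists [set x]; split.
- rewrite (_ : [set x] = (fun y => sqnorm (1 *: y + - x)) @^-1` [set 0]).
    rewrite -[X in measurable X]setTI.
    exact: (measurableT_comp measurable_sqnorm (measurable_affine_rV _ _)).
  apply/seteqP; split=> y /=; rewrite scale1r.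
    by move=> ->; apply/eqP; rewrite sqnorm_eq0 subrr.
  by move/eqP; rewrite sqnorm_eq0 subr_eq0 => /eqP.
- exact: lebesgue_rV_set1.
- by move=> y /= h; apply/eqP; apply: contra_notT h => yx _; exact: fg.
Qed.

Lemma tonelli_curry d1 d2 (T1 : measurableType d1) (T2 : measurableType d2) (R : realType)
    (m1 : {sigma_finite_measure set T1 -> \bar R}) (m2 : {sigma_finite_measure set T2 -> \bar R})
    (f : T1 -> T2 -> \bar R) :
  measurable_fun setT (fun z : T1 * T2 => f z.1 z.2) -> (forall x y, 0 <= f x y)%E ->
  (\int[m1]_x \int[m2]_y f x y = \int[m2]_y \int[m1]_x f x y)%E.
Proof. by move=> mf f0; apply: (@fubini_tonelli _ _ _ _ _ m1 m2 (fun z => f z.1 z.2)). Qed.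

Lemma tonelli_real d1 d2 (T1 : measurableType d1) (T2 : measurableType d2) (R : realType)
    (m1 : {sigma_finite_measure set T1 -> \bar R}) (m2 : {sigma_finite_measure set T2 -> \bar R})
    (f : T1 -> T2 -> R) :
  measurable_fun setT (fun z : T1 * T2 => f z.1 z.2) -> (forall x y, 0 <= f x y) ->
  (\int[m1]_x \int[m2]_y (f x y)%:E = \int[m2]_y \int[m1]_x (f x y)%:E)%E.
Proof.
move=> mf f0; apply: (@tonelli_curry _ _ _ _ _ m1 m2 (fun x y => (f x y)%:E)).
- exact/measurable_EFinP.
- by move=> x y; rewrite lee_fin.
Qed.

(** * The kernel truncated in the heat time *)

Section fractional_kernel.
Context {R : realType} {N : nat} (s : R) (hs : 0 < s < 1).
Local Notation mu := (@lebesgue_measure R).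
Local Notation ell := (@lebesgue_rV R N).
Implicit Types (a b e t : R) (h y : 'rV[R]_N).


Lemma measurable_trunc_heat e h : measurable_fun [set: R] (fun t => trunc s e t * heat t h).
Proof.
apply: measurable_funM; first exact: measurable_trunc.
exact: measurable_heat2.
Qed.

Lemma trunc_heat_ge0 e t h : 0 <= trunc s e t * heat t h.
Proof. by rewrite mulr_ge0 ?trunc_ge0 ?heat_ge0. Qed.

(** For [t >= e] the heat kernel is at most [e^(-N/2)]: the truncated kernel is finite even at
    [h = 0]. *)
Lemma trunc_heat_lty e h : 0 < e -> (\int[mu]_t (trunc s e t * heat t h)%:E < +oo)%E.
Proof.
move=> e0; apply: (@le_lt_trans _ _ (\int[mu]_t (e `^ (- (N%:R / 2)) * trunc s e t)%:E)%E).
  apply: nnint_le.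
  - exact: measurable_trunc_heat.
  - by apply: measurable_funM => //; exact: measurable_trunc.
  - by move=> t; exact: trunc_heat_ge0.
  move=> t; rewrite mulrC /trunc; case: ifPn => et; last by rewrite !mulr0.
  have t0 : 0 < t by exact: lt_le_trans et.
  rewrite ler_wpM2r ?powR_ge0// /heat -[leRHS]mulr1 ler_pM ?powR_ge0 ?expR_ge0//.
    rewrite !powRN lef_pV2 ?posrE ?powR_gt0// ge0_ler_powR ?nnegrE ?(ltW t0) ?(ltW e0)//.
  by rewrite -expR0 ler_expR oppr_le0 divr_ge0 ?sqnorm_ge0// ltW.
rewrite nnintZ ?powR_ge0//; [|exact: measurable_trunc|exact: trunc_ge0].
by rewrite integral_truncE// -EFinM ltry.
Qed.

(* As [e] decreases to [0], [tkernel e h] increases to [mix (N + 2s) |h|^-(N+2s)]. *)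
Definition tkernel e h : R := fine (\int[mu]_t (trunc s e t * heat t h)%:E).

Lemma tkernelE e h : 0 < e ->
  (\int[mu]_t (trunc s e t * heat t h)%:E = (tkernel e h)%:E)%E.
Proof.
move=> e0; rewrite fineK// ge0_fin_numE ?trunc_heat_lty//.
by apply: nnint_ge0 => t; exact: trunc_heat_ge0.
Qed.

Lemma tkernel_ge0 e h : 0 <= tkernel e h.
Proof. by rewrite fine_ge0// nnint_ge0// => t; exact: trunc_heat_ge0. Qed.

Lemma measurable_heat_pair d (T : measurableType d) (a : T -> R) (b : T -> 'rV[R]_N) e :
  measurable_fun setT a -> measurable_fun setT b ->
  measurable_fun setT (fun z => trunc s e (a z) * heat (a z) (b z)).
Proof.
move=> ma mb; apply: measurable_funM; last exact: measurable_heat2.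
exact: (measurableT_comp (measurable_trunc s e) ma).
Qed.

Lemma measurable_tkernel e : measurable_fun [set: 'rV[R]_N] (tkernel e).
Proof.
apply: (measurableT_comp (@fine_measurable R _ measurableT)).
apply: (@measurable_fun_fubini_tonelli_F _ _ _ _ _ mu (fun z => (trunc s e z.2 * heat z.2 z.1)%:E)).
- apply/measurable_EFinP; apply: measurable_heat_pair.
    exact: measurable_snd.
  exact: measurable_fst.
- by move=> z; rewrite lee_fin trunc_heat_ge0.
Qed.

Lemma integral_tkernel e : 0 < e ->
  (\int[ell]_h (tkernel e h)%:E = (@gaussI R N * (s^-1 * e `^ (- s)))%:E)%E.
Proof.
move=> e0; under eq_integral => h _ do rewrite -tkernelE//.
rewrite (@tonelli_real _ _ _ _ _ ell mu (fun h t => trunc s e t * heat t h)); last 2 first.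
- apply: measurable_heat_pair; [exact: measurable_snd|exact: measurable_fst].
- by move=> h t; exact: trunc_heat_ge0.
transitivity (\int[mu]_t (@gaussI R N * trunc s e t)%:E)%E.
  apply: eq_integral => t _; have [t0|t0] := leP t 0.
    have -> : trunc s e t = 0 by rewrite /trunc leNgt (le_lt_trans t0 e0).
    by rewrite mulr0 integral0_eq// => h _; rewrite mul0r.
  rewrite nnintZ ?trunc_ge0//; last 2 first.
  - apply: measurable_heat2 => //.
  - exact: heat_ge0.
  by rewrite integral_heat// -EFinM mulrC.
have g0 : 0 <= @gaussI R N by rewrite ltW// gaussI_gt0.
have -> := @nnintZ _ _ R mu _ _ (measurable_trunc s e) (trunc_ge0 s e) g0.
by rewrite integral_truncE.
Qed.

(** Tonelli brings the space integral inside, the semigroup law merges [heat t] and [heat r] into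
    [heat (t + r)], and taking [t + r] as the new variable leaves a one-dimensional convolution. *)
Lemma tkernel_heat_mixture b e y : 0 < e ->
  (\int[ell]_h ((tkernel e h)%:E * \int[mu]_t (tpow (b - 1) t * heat t (y + h))%:E) =
   \int[mu]_r ((@gaussI R N * heat r y)%:E * trunc_conv s b e r))%E.
Proof.
move=> e0.
have g0 : 0 <= @gaussI R N by rewrite ltW// gaussI_gt0.
have myh d (T : measurableType d) (g : T -> 'rV[R]_N) :
    measurable_fun setT g -> measurable_fun setT (fun z => y + g z).
  move=> mg; rewrite (_ : (fun z => _) = (fun x => 1 *: x + y) \o g).
    exact: (measurableT_comp (measurable_affine_rV _ _) mg).
  by apply/funext => z /=; rewrite scale1r addrC.
have mV d (T : measurableType d) (f : T -> R) (g : T -> 'rV[R]_N) :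
    measurable_fun setT f -> measurable_fun setT g ->
    measurable_fun setT (fun z => tpow (b - 1) (f z) * heat (f z) (y + g z)).
  move=> mf mg; apply: measurable_funM; first exact: measurable_tpow_comp.
  by apply: measurable_heat2 => //; exact: myh.
have V0 t h : 0 <= tpow (b - 1) t * heat t (y + h) by rewrite mulr_ge0 ?tpow_ge0 ?heat_ge0.
pose J h := (\int[mu]_r (tpow (b - 1) r * heat r (y + h))%:E)%E.
have J0 h : (0 <= J h)%E by apply: nnint_ge0 => t.
have mJ : measurable_fun [set: 'rV[R]_N] J.
  apply: (@measurable_fun_fubini_tonelli_F _ _ _ _ _ mu
    (fun z => (tpow (b - 1) z.2 * heat z.2 (y + z.1))%:E)).
  - apply/measurable_EFinP; apply: mV; [exact: measurable_snd|exact: measurable_fst].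
  - by move=> z; rewrite lee_fin.
transitivity (\int[ell]_h \int[mu]_t ((trunc s e t * heat t h)%:E * J h))%E.
  apply: eq_integral => h _; rewrite -tkernelE// -ge0_integralZr//.
  - by apply/measurable_EFinP; exact: measurable_trunc_heat.
  - by move=> t _; rewrite lee_fin trunc_heat_ge0.
  - exact: J0.
rewrite (@tonelli_curry _ _ _ _ _ ell mu (fun h t => (trunc s e t * heat t h)%:E * J h)%E); last 2 first.
- apply: emeasurable_funM.
    apply/measurable_EFinP; apply: measurable_heat_pair; [exact: measurable_snd|exact: measurable_fst].
  exact: (measurableT_comp mJ measurable_fst).
- by move=> h t; rewrite mule_ge0// lee_fin trunc_heat_ge0.
transitivity (\int[mu]_t \int[mu]_r (trunc s e t * tpow (b - 1) (r - t) * (@gaussI R N * heat r y))%:E)%E.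
  apply: eq_integral => t _ /=.
  have [t0|t0] := leP t 0.
    have -> : trunc s e t = 0 by rewrite /trunc leNgt (le_lt_trans t0 e0).
    rewrite !integral0_eq//.
      by move=> r _; rewrite !mul0r.
    by move=> h _; rewrite mul0r mul0e.
  transitivity (\int[ell]_h \int[mu]_r (trunc s e t * heat t h * (tpow (b - 1) r * heat r (y + h)))%:E)%E.
    apply: eq_integral => h _; rewrite nnintZ ?trunc_heat_ge0//.
    by apply: mV => //; exact: measurable_cst.
  rewrite (@tonelli_real _ _ _ _ _ ell mu (fun h r =>
    trunc s e t * heat t h * (tpow (b - 1) r * heat r (y + h)))); last 2 first.
  - apply: measurable_funM; last by apply: mV; [exact: measurable_snd|exact: measurable_fst].
    by apply: measurable_heat_pair; [exact: measurable_cst|exact: measurable_fst].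
  - by move=> h r; rewrite mulr_ge0 ?trunc_heat_ge0.
  pose g r := ((trunc s e t * tpow (b - 1) (r - t) * (@gaussI R N * heat r y))%:E : \bar R).
  transitivity (\int[mu]_r g (1 * r + t)%R)%E.
    apply: eq_integral => r _; rewrite /g mul1r addrK.
    have [r0|r0] := leP r 0.
      rewrite tpow_le0// mulr0 mul0r integral0_eq// => h _.
      by rewrite mul0r mulr0.
    transitivity (\int[ell]_h ((trunc s e t * tpow (b - 1) r) * (heat t h * heat r (y + h)))%:E)%E.
      by apply: eq_integral => h _; congr EFin; ring.
    rewrite nnintZ ?mulr_ge0 ?trunc_ge0 ?tpow_ge0//; last 2 first.
    - by apply: measurable_funM; apply: measurable_heat2 => //; exact: myh.
    - by move=> h; rewrite mulr_ge0 ?heat_ge0.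
    by rewrite heat_convolution// -EFinM (addrC r).
  rewrite (@integral_affine R 1 t g) ?oner_eq0//.
  - by rewrite normr1 invr1 mul1e.
  - apply/measurable_EFinP; apply: measurable_funM.
      by apply: measurable_funM => //; apply: measurable_tpow_comp; mfun.
    by apply: measurable_funM => //; exact: measurable_heat2.
  - by move=> r; rewrite /g lee_fin; apply: mulr_ge0; apply: mulr_ge0; rewrite ?trunc_ge0 ?tpow_ge0 ?heat_ge0.
rewrite (@tonelli_real _ _ _ _ _ mu mu (fun t r =>
   trunc s e t * tpow (b - 1) (r - t) * (@gaussI R N * heat r y))); last 2 first.
- apply: measurable_funM.
    apply: measurable_funM; first exact: (measurableT_comp (measurable_trunc s e) measurable_fst).
    by apply: measurable_tpow_comp; mfun.
  by apply: measurable_funM => //; apply: measurable_heat2 => //; exact: measurable_snd.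
- by move=> t r; apply: mulr_ge0; apply: mulr_ge0; rewrite ?trunc_ge0 ?tpow_ge0 ?heat_ge0.
apply: eq_integral => r _; rewrite /trunc_conv -nnintZ; last 3 first.
- exact: measurable_conv.
- by move=> t; exact: conv_ge0.
- by rewrite mulr_ge0 ?heat_ge0.
by apply: eq_integral => t _; congr EFin; ring.
Qed.

End fractional_kernel.

(** * Powers integrated against the truncated kernel *)

Section power_energy.
Context {R : realType} (n : nat) (s : R) (hs : 1 / 2 < s < 1) (hN : 2 * s < n.+1%:R).
Local Notation N := n.+1.
Local Notation mu := (@lebesgue_measure R).
Local Notation ell := (@lebesgue_rV R N).
Implicit Types (a b c e k r t : R) (h y : 'rV[R]_N).

Let hs01 : 0 < s < 1. Proof. by have := hs; lra. Qed.
Let s0 : 0 < s. Proof. by case/andP: hs01. Qed.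
Let gI := @gaussI R N.
Let gI0 : 0 < gI. Proof. exact: gaussI_gt0. Qed.

Definition tkernel_conv a e y : R := fine (\int[ell]_h (tkernel s e h * pw a (y + h))%:E)%E.

Lemma measurable_tkernel_pw a e y :
  measurable_fun [set: 'rV[R]_N] (fun h => tkernel s e h * pw a (y + h)).
Proof.
apply: measurable_funM; first exact: measurable_tkernel.
rewrite (_ : (fun h => _) = pw a \o (fun h => 1 *: h + y)).
  exact: (measurableT_comp (measurable_pw a) (measurable_affine_rV _ _)).
by apply/funext => h /=; rewrite scale1r addrC.
Qed.

Lemma tkernel_pw_mixture a e y : 0 < a -> 0 < e ->
  ((mix a)%:E * \int[ell]_h (tkernel s e h * pw a (y + h))%:E =
   \int[mu]_r ((gI * heat r y)%:E * trunc_conv s ((N%:R - a) / 2) e r))%E.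
Proof.
move=> a0 e0; rewrite -tkernel_heat_mixture// -nnintZ; last 3 first.
- exact: measurable_tkernel_pw.
- by move=> h; rewrite mulr_ge0 ?tkernel_ge0 ?pw_ge0.
- by rewrite ltW// mix_gt0.
have V0 t h : 0 <= tpow ((N%:R - a) / 2 - 1) t * heat t (y + h) by rewrite mulr_ge0 ?tpow_ge0 ?heat_ge0.
have myh d (T : measurableType d) (g : T -> 'rV[R]_N) :
    measurable_fun setT g -> measurable_fun setT (fun z => y + g z).
  move=> mg; rewrite (_ : (fun z => _) = (fun x => 1 *: x + y) \o g).
    exact: (measurableT_comp (measurable_affine_rV _ _) mg).
  by apply/funext => z /=; rewrite scale1r addrC.
apply: (@ge0_integral_off_point R n (- y)).
- apply/measurable_EFinP; apply: measurable_funM => //; exact: measurable_tkernel_pw.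
- apply: emeasurable_funM; first by apply/measurable_EFinP; exact: measurable_tkernel.
  apply: (@measurable_fun_fubini_tonelli_F _ _ _ _ _ mu
    (fun z => (tpow ((N%:R - a) / 2 - 1) z.2 * heat z.2 (y + z.1))%:E)).
  + apply/measurable_EFinP; apply: measurable_funM.
      by apply: measurable_tpow_comp; exact: measurable_snd.
    by apply: measurable_heat2; [exact: measurable_snd|apply: myh; exact: measurable_fst].
  + by move=> z; rewrite lee_fin.
- by move=> h; rewrite lee_fin !mulr_ge0 ?tkernel_ge0 ?pw_ge0// ltW// mix_gt0.
- by move=> h; rewrite mule_ge0 ?lee_fin ?tkernel_ge0// nnint_ge0.
- move=> h hy; rewrite heat_mixture//; last by rewrite addrC addr_eq0.
  by rewrite -EFinM; congr EFin; ring.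
Qed.

(** A time power [r^d] mixes the heat kernels into [|y|^-a] with [a = N - 2(d+1)]; the bound on [d]
    says [a > 0]. *)
Lemma heat_combination c1 c2 d1 d2 y : 0 <= c1 -> 0 <= c2 ->
  d1 < N%:R / 2 - 1 -> d2 < N%:R / 2 - 1 -> y != 0 ->
  (\int[mu]_r ((gI * heat r y) * (c1 * tpow d1 r + c2 * tpow d2 r))%:E =
   (gI * (c1 * mix (N%:R - 2 * (d1 + 1)) * pw (N%:R - 2 * (d1 + 1)) y +
          c2 * mix (N%:R - 2 * (d2 + 1)) * pw (N%:R - 2 * (d2 + 1)) y))%:E)%E.
Proof.
move=> c10 c20 h1 h2 y0.
pose g d r := tpow d r * heat r y.
have mg d : measurable_fun [set: R] (g d).
  by apply: measurable_funM => //; exact: measurable_heat2.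
have g0 d r : 0 <= g d r by rewrite mulr_ge0 ?tpow_ge0 ?heat_ge0.
have Ig d : d < N%:R / 2 - 1 ->
    (\int[mu]_r (g d r)%:E = (mix (N%:R - 2 * (d + 1)) * pw (N%:R - 2 * (d + 1)) y)%:E)%E.
  move=> hd; rewrite -heat_mixture//; last by lra.
  by apply: eq_integral => r _; rewrite /g; congr ((tpow _ _ * _)%:E); field.
transitivity (\int[mu]_r ((gI * c1) * g d1 r + (gI * c2) * g d2 r)%:E)%E.
  by apply: eq_integral => r _; rewrite /g; congr EFin; ring.
have k1 : 0 <= gI * c1 by rewrite mulr_ge0// ltW.
have k2 : 0 <= gI * c2 by rewrite mulr_ge0// ltW.
rewrite nnintD; last 4 first.
- by apply: measurable_funM => //; exact: mg.
- by apply: measurable_funM => //; exact: mg.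
- by move=> r; rewrite mulr_ge0.
- by move=> r; rewrite mulr_ge0.
have -> := @nnintZ _ _ R mu _ _ (mg d1) (g0 d1) k1.
have -> := @nnintZ _ _ R mu _ _ (mg d2) (g0 d2) k2.
by rewrite !Ig// -!EFinM -EFinD; congr EFin; ring.
Qed.

Lemma measurable_combination c1 c2 d1 d2 y : measurable_fun [set: R]
  (fun r => (gI * heat r y) * (c1 * tpow d1 r + c2 * tpow d2 r)).
Proof.
apply: measurable_funM; first by apply: measurable_funM => //; exact: measurable_heat2.
by apply: measurable_funD; apply: measurable_funM.
Qed.

Lemma combination_ge0 c1 c2 d1 d2 y r : 0 <= c1 -> 0 <= c2 ->
  0 <= (gI * heat r y) * (c1 * tpow d1 r + c2 * tpow d2 r).
Proof.
move=> c10 c20; apply: mulr_ge0.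
  by rewrite mulr_ge0 ?heat_ge0// ltW.
by rewrite addr_ge0// mulr_ge0 ?tpow_ge0.
Qed.

Lemma measurable_trunc_conv b e : measurable_fun [set: R] (trunc_conv s b e).
Proof.
apply: (@measurable_fun_fubini_tonelli_F _ _ _ _ _ mu
    (fun z : measurableTypeR R * measurableTypeR R => (trunc s e z.2 * tpow (b - 1) (z.1 - z.2))%:E)).
- apply/measurable_EFinP; apply: measurable_funM.
    exact: (measurableT_comp (measurable_trunc s e) measurable_snd).
  by apply: measurable_tpow_comp; mfun.
- by move=> z; rewrite lee_fin conv_ge0.
Qed.

Lemma trunc_conv_ge0 b e r : (0 <= trunc_conv s b e r)%E.
Proof. by apply: nnint_ge0 => t; exact: conv_ge0. Qed.

(** [trunc_conv_subcritical_le] integrated against the heat kernels: the time powers [s-k-1] and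
    [-k-1] become [|y|^-(sigma+2k)] and [|y|^-(N+2k)]. *)
Lemma tkernel_conv_le : exists2 C, 0 <= C & forall k e y, 0 <= k <= 1 / 2 -> 0 < e -> y != 0 ->
  ((mix (N%:R - 2 * s + 2 * k))%:E *
     \int[ell]_h (tkernel s e h * pw (N%:R - 2 * s + 2 * k) (y + h))%:E <=
   (gI * (s^-1 * e `^ (- s) * mix (N%:R - 2 * s + 2 * k) * pw (N%:R - 2 * s + 2 * k) y +
          k * C * mix (N%:R + 2 * k) * pw (N%:R + 2 * k) y))%:E)%E.
Proof.
have h12 : 1 / 2 < s by case/andP: hs.
have [C C0 HC] := trunc_conv_subcritical_le hs01 h12; exists C => // k e y hk e0 y0.
have hN' := hN; have /andP[k0 k1] := hk.
have c10 : 0 <= s^-1 * e `^ (- s) by rewrite mulr_ge0 ?powR_ge0// invr_ge0 ltW.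
have c20 : 0 <= k * C by rewrite mulr_ge0.
rewrite tkernel_pw_mixture//; last by lra.
have := @heat_combination (s^-1 * e `^ (- s)) (k * C) (s - k - 1) (- k - 1) y c10 c20.
rewrite (_ : N%:R - 2 * (s - k - 1 + 1) = N%:R - 2 * s + 2 * k); last by ring.
rewrite (_ : N%:R - 2 * (- k - 1 + 1) = N%:R + 2 * k); last by ring.
move=> <-//; [|by lra|by lra].
rewrite (_ : (N%:R - (N%:R - 2 * s + 2 * k)) / 2 = s - k); last by field.
apply: ge0_le_integral => //.
- move=> r _; rewrite mule_ge0 ?trunc_conv_ge0// lee_fin mulr_ge0 ?heat_ge0//; exact: ltW.
- apply: emeasurable_funM; last exact: measurable_trunc_conv.
  by apply/measurable_EFinP; apply: measurable_funM => //; exact: measurable_heat2.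
- by apply/measurable_EFinP; exact: measurable_combination.
move=> r _; rewrite [leRHS]EFinM; apply: lee_wpmul2l.
  by rewrite lee_fin mulr_ge0 ?heat_ge0// ltW.
have [r0|r0] := leP r 0.
  rewrite trunc_conv_le0; last exact: (le_trans r0 (ltW e0)).
  by rewrite lee_fin !tpow_le0// !mulr0 addr0.
by rewrite !tpowE//; exact: HC.
Qed.

(** The negative corrections of [trunc_conv_lower] are moved to the right-hand side, so that all
    integrands are nonnegative and no subtraction of extended reals occurs. *)
Lemma tkernel_conv_ge k e y : 0 <= k <= 1 / 2 -> 0 < e -> y != 0 ->
  ((gI * (s^-1 * e `^ (- s) * mix (N%:R - 2 * s + 2 * k) * pw (N%:R - 2 * s + 2 * k) y +
     (2 `^ k - 1) / s * mix (N%:R + 2 * k) * pw (N%:R + 2 * k) y))%:E <=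
   (mix (N%:R - 2 * s + 2 * k))%:E *
     \int[ell]_h (tkernel s e h * pw (N%:R - 2 * s + 2 * k) (y + h))%:E +
   (gI * (s^-1 * (2 * e `^ (1 - s)) * mix (N%:R - 2 * s + 2 * k + 2) * pw (N%:R - 2 * s + 2 * k + 2) y +
     (2 `^ k - 1) / s * (2 * e) * mix (N%:R + 2 * k + 2) * pw (N%:R + 2 * k + 2) y))%:E)%E.
Proof.
move=> /andP[k0 k1] e0 y0; have hN' := hN; have h0 := s0.
have si0 : 0 <= s^-1 by rewrite invr_ge0 ltW.
have c0 : 0 <= (2 `^ k - 1) / s.
  by rewrite mulr_ge0// subr_ge0 -[leLHS](@powRr0 R 2) ler_powR// ler1n.
have c1 : 0 <= s^-1 * e `^ (- s) by rewrite mulr_ge0 ?powR_ge0.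
have c3 : 0 <= s^-1 * (2 * e `^ (1 - s)) by rewrite !mulr_ge0 ?powR_ge0.
have c4 : 0 <= (2 `^ k - 1) / s * (2 * e) by rewrite mulr_ge0// mulr_ge0// ltW.
rewrite tkernel_pw_mixture//; last by lra.
have := @heat_combination _ _ (s - k - 1) (- k - 1) y c1 c0.
rewrite (_ : N%:R - 2 * (s - k - 1 + 1) = N%:R - 2 * s + 2 * k); last by ring.
rewrite (_ : N%:R - 2 * (- k - 1 + 1) = N%:R + 2 * k); last by ring.
move=> <-//; [|by lra|by lra].
have := @heat_combination _ _ (s - k - 2) (- k - 2) y c3 c4.
rewrite (_ : N%:R - 2 * (s - k - 2 + 1) = N%:R - 2 * s + 2 * k + 2); last by ring.
rewrite (_ : N%:R - 2 * (- k - 2 + 1) = N%:R + 2 * k + 2); last by ring.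
move=> <-//; [|by lra|by lra].
rewrite (_ : (N%:R - (N%:R - 2 * s + 2 * k)) / 2 = s - k); last by field.
rewrite -ge0_integralD//; last 4 first.
- move=> r _; rewrite mule_ge0 ?trunc_conv_ge0// lee_fin mulr_ge0 ?heat_ge0//; exact: ltW.
- apply: emeasurable_funM; last exact: measurable_trunc_conv.
  by apply/measurable_EFinP; apply: measurable_funM => //; exact: measurable_heat2.
- by move=> r _; rewrite lee_fin combination_ge0.
- by apply/measurable_EFinP; exact: measurable_combination.
apply: ge0_le_integral => //.
- by move=> r _; rewrite lee_fin combination_ge0.
- by apply/measurable_EFinP; exact: measurable_combination.
- apply: emeasurable_funD; last by apply/measurable_EFinP; exact: measurable_combination.
  apply: emeasurable_funM; last exact: measurable_trunc_conv.
  by apply/measurable_EFinP; apply: measurable_funM => //; exact: measurable_heat2.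
move=> r _; have H0 : (0 <= (gI * heat r y)%:E)%E by rewrite lee_fin mulr_ge0 ?heat_ge0// ltW.
have [r0|r0] := leP r 0.
  rewrite !tpow_le0// !mulr0 !addr0 mulr0 adde0 mule_ge0// trunc_conv_ge0//.
rewrite !tpowE// [leLHS]EFinM [X in (_ <= _ + X)%E]EFinM -ge0_muleDr ?trunc_conv_ge0//; last first.
  by rewrite lee_fin addr_ge0// mulr_ge0 ?powR_ge0.
apply: lee_wpmul2l => //.
apply: le_trans (leeD (trunc_conv_lower hs01 k0 e0 r0) (lexx _)).
by rewrite -EFinD lee_fin; lra.
Qed.

End power_energy.

(** * The truncated fractional Laplacian of a power *)

Lemma gap_le_algebra {R : realFieldType} (g m0 m1 m2 m3 w si es e' e V V1 V2 V3 T : R) :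
  0 < g -> 0 < m0 -> 0 <= m2 -> 0 <= m3 -> 0 <= w -> 0 <= si -> 0 <= V2 -> 0 <= V3 ->
  0 <= e' -> e <= e' ->
  g * (si * es * m0 * V + w * m1 * V1) <=
    m0 * T + g * (si * (2 * e') * m2 * V2 + w * (2 * e) * m3 * V3) ->
  g * (si * es) * V - T <= - (g * (w * m1) / m0) * V1 +
    (g * (si * 2 * m2) / m0 + g * (w * 2 * m3) / m0) * e' * (V2 + V3).
Proof.
move=> g0 m00 m20 m30 w0 si0 V20 V30 e0 ee H.
rewrite -(ler_pM2l m00) [leRHS](_ : _ = g * (- (w * m1 * V1) +
    (si * 2 * m2 + w * 2 * m3) * e' * (V2 + V3))); last by field; rewrite gt_eqF.
have q1 : w * (2 * e) * m3 * V3 <= w * 2 * m3 * V3 * e'.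
  rewrite (_ : w * (2 * e) * _ * _ = w * 2 * m3 * V3 * e); last by ring.
  by rewrite ler_wpM2l// !mulr_ge0.
have q2 : 0 <= si * 2 * m2 * e' * V3 by rewrite !mulr_ge0.
have q3 : 0 <= w * 2 * m3 * e' * V2 by rewrite !mulr_ge0.
have q : g * (si * (2 * e') * m2 * V2 + w * (2 * e) * m3 * V3) <=
    g * ((si * 2 * m2 + w * 2 * m3) * e' * (V2 + V3)).
  by rewrite ler_pM2l//; lra.
lra.
Qed.

Lemma gap_ge_algebra {R : realFieldType} (g m m0 m1 M C si k V V1 T : R) :
  0 <= g -> 0 < m -> m <= m0 -> m1 <= M -> 0 <= M -> 0 <= C -> 0 <= k -> 0 <= V1 ->
  m0 * T <= g * (si * m0 * V + k * C * m1 * V1) ->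
  - (g * si * V - T) <= k * (g * C * M / m) * V1.
Proof.
move=> g0 m_0 mm0 m1M M0 C0 k0 V10 H; have m00 := lt_le_trans m_0 mm0.
rewrite -(ler_pM2l m00).
have h1 : (g * k * C * V1) * m1 <= (g * k * C * V1) * M by rewrite ler_wpM2l// !mulr_ge0.
have h2 : (g * k * C * V1 * M) * 1 <= (g * k * C * V1 * M) * (m0 / m).
  by rewrite ler_wpM2l ?mulr_ge0// ler_pdivlMr// mul1r.
rewrite [leRHS](_ : _ = (g * k * C * V1 * M) * (m0 / m)); last by field; rewrite gt_eqF.
lra.
Qed.

Section power_gap.
Context {R : realType} (n : nat) (s : R) (hs : 1 / 2 < s < 1) (hN : 2 * s < n.+1%:R).
Local Notation N := n.+1.
Local Notation ell := (@lebesgue_rV R N).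
Local Notation sigma := (N%:R - 2 * s).
Implicit Types (a c e k t : R) (h y : 'rV[R]_N).

Let s0 : 0 < s. Proof. by have := hs; lra. Qed.
Let sigma0 : 0 < sigma. Proof. by have := hN; lra. Qed.
Let gI := @gaussI R N.
Let gI0 : 0 < gI. Proof. exact: gaussI_gt0. Qed.

Lemma tkernel_convE k e y : 0 <= k <= 1 / 2 -> 0 < e -> y != 0 ->
  (\int[ell]_h (tkernel s e h * pw (sigma + 2 * k) (y + h))%:E =
   (tkernel_conv s (sigma + 2 * k) e y)%:E)%E.
Proof.
move=> hk e0 y0; rewrite /tkernel_conv fineK// ge0_fin_numE; last first.
  by apply: nnint_ge0 => h; rewrite mulr_ge0 ?tkernel_ge0 ?pw_ge0.
have a0 : 0 < sigma + 2 * k by have := sigma0; lra.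
have [C _ /(_ k e y hk e0 y0) H] := tkernel_conv_le hs hN.
rewrite ltey; apply/eqP => E; move: H; rewrite E gt0_muley ?lte_fin ?mix_gt0//.
Qed.

(** The first coefficient is the mass of [tkernel s e], so this is the integral of
    [pw y - pw (y + h)] against that kernel: up to a constant, the truncated fractional Laplacian of
    the power. *)
Definition power_gap k e y : R :=
  gI * (s^-1 * e `^ (- s)) * pw (sigma + 2 * k) y - tkernel_conv s (sigma + 2 * k) e y.

Lemma power_gap_le k : 0 <= k <= 1 / 2 -> exists c A, [/\ 0 <= c, 0 < k -> 0 < c, 0 <= A &
  forall e y, 0 < e <= 1 -> y != 0 ->
  power_gap k e y <= - c * pw (N%:R + 2 * k) y +
    A * e `^ (1 - s) * (pw (sigma + 2 * k + 2) y + pw (N%:R + 2 * k + 2) y)].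
Proof.
move=> hk; have /andP[k0 k1] := hk.
have a0 : 0 < sigma + 2 * k by have := sigma0; lra.
have m0 := mix_gt0 a0.
have N0 : 0 < N%:R :> R by rewrite ltr0n.
have Nk : 0 < N%:R + 2 * k by lra.
have m1 := mix_gt0 Nk.
have m2 := mix_gt0 (addr_gt0 a0 (ltr0Sn R 1)).
have m3 := mix_gt0 (addr_gt0 Nk (ltr0Sn R 1)).
have c0 : 0 < k -> 0 < (2 `^ k - 1) / s.
  move=> kp; rewrite divr_gt0// subr_gt0 -[ltLHS](@powRr0 R 2) /powR pnatr_eq0/= ltr_expR.
  by rewrite ltr_pM2r// ln_gt0// ltr1n.
have w0 : 0 <= (2 `^ k - 1) / s.
  by rewrite divr_ge0 ?(ltW s0)// subr_ge0 -[leLHS](@powRr0 R 2) ler_powR// ler1n.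
have si0 : 0 <= s^-1 by rewrite invr_ge0 ltW.
have H e y := @tkernel_conv_ge R n s hs hN k e y hk.
move: c0 w0 H; rewrite -/gI; set w := (2 `^ k - 1) / s => c0 w0 H.
move: m0 m1 m2 m3 (ltW m2) (ltW m3) => m0 m1 m2 m3 m2' m3'.
exists (gI * (w * mix (N%:R + 2 * k)) / mix (sigma + 2 * k)),
  (gI * (s^-1 * 2 * mix (sigma + 2 * k + 2)) / mix (sigma + 2 * k) +
   gI * (w * 2 * mix (N%:R + 2 * k + 2)) / mix (sigma + 2 * k)).
have g' := ltW gI0; have m0' := ltW m0; have m1' := ltW m1.
split.
- exact: (divr_ge0 (mulr_ge0 g' (mulr_ge0 w0 m1')) m0').
- move=> /c0 kp; exact: (divr_gt0 (mulr_gt0 gI0 (mulr_gt0 kp m1)) m0).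
- have two : 0 <= 2 :> R by [].
  exact: (addr_ge0 (divr_ge0 (mulr_ge0 g' (mulr_ge0 (mulr_ge0 si0 two) m2')) m0')
    (divr_ge0 (mulr_ge0 g' (mulr_ge0 (mulr_ge0 w0 two) m3')) m0')).
move=> e y /andP[e0 e1] y0.
have {H} := H e y e0 y0; rewrite tkernel_convE// -EFinM -EFinD lee_fin => H.
(* For [e <= 1] both errors, of orders [e] and [e^(1-s)], fit under the single rate [e^(1-s)]. *)
have ee : e <= e `^ (1 - s).
  rewrite -[leLHS](powRr1 (ltW e0)); apply: ger_powR; first by rewrite e0 e1.
  by rewrite gerBl; exact: (ltW s0).
exact: (gap_le_algebra gI0 m0 m2' m3' w0 si0 (pw_ge0 _ _) (pw_ge0 _ _) (powR_ge0 _ _) ee H).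
Qed.

Lemma power_gap_ge : exists2 C, 0 <= C & forall k e y, 0 <= k <= 1 / 2 -> 0 < e -> y != 0 ->
  - power_gap k e y <= k * C * pw (N%:R + 2 * k) y.
Proof.
have [C C0 HC] := tkernel_conv_le hs hN.
(* A lower bound for [mix (sigma + 2k)] common to all [k <= 1/2]: the bound of [mix_ge] decreases in
   the exponent, which is at most [sigma + 1]. *)
pose m := 2 `^ (- ((sigma + 1) / 2) - 1) * expR (- 1).
have m0 : 0 < m by rewrite mulr_gt0 ?expR_gt0// powR_gt0.
have N0 : 0 < N%:R :> R by rewrite ltr0n.
have mN : 0 < mix (N%:R : R) by exact: mix_gt0.
have mN1 : 0 < mix (N%:R + 1 : R) by rewrite mix_gt0// ltr_wpDl.
have M0 : 0 <= gI * C * (mix N%:R + mix (N%:R + 1)).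
  exact: (mulr_ge0 (mulr_ge0 (ltW gI0) C0) (addr_ge0 (ltW mN) (ltW mN1))).
exists (gI * C * (mix N%:R + mix (N%:R + 1)) / m); first by rewrite divr_ge0// ltW.
move=> k e y hk e0 y0; have /andP[k0 k1] := hk.
have a0 : 0 < sigma + 2 * k.
  by rewrite ltr_pwDl ?sigma0// mulr_ge0.
have ma : m <= mix (sigma + 2 * k).
  apply: le_trans (mix_ge a0); rewrite ler_wpM2r ?expR_ge0// ler_powR ?ler1n//.
  by rewrite lerD2r lerN2 ler_pM2r// lerD2l mulrC -ler_pdivlMr.
have := HC k e y hk e0 y0; rewrite tkernel_convE// -EFinM lee_fin -/gI => H.
have Nle := mix_le N0 hk.
exact: (gap_ge_algebra (ltW gI0) m0 ma Nle (addr_ge0 (ltW mN) (ltW mN1)) C0 k0 (pw_ge0 _ _) H).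
Qed.

End power_gap.

(** * Mean value and second-order Taylor bounds *)

Section mean_value.
Context {R : realType}.
Implicit Types (a b c t : R).

Lemma mean_value_le (f f' : R -> R) c B b :
  (forall t, `|t| <= `|b| -> is_derive t 1 f (f' t) /\ `|f' t - c| <= B) ->
  `|f b - f 0 - c * b| <= B * `|b|.
Proof.
move=> H.
have cf t : `|t| <= `|b| -> f z @[z --> t] --> f t.
  by move=> /H[[d _] _]; exact: (differentiable_continuous ((derivable1_diffP _ _).1 d)).
suff [t tb ->] : exists2 t, `|t| <= `|b| & f b - f 0 = f' t * b.
  by have [_ h] := H t tb; rewrite -mulrBl normrM ler_wpM2r.
have [b0|b0] := leP 0 b.
  have hb t : t \in `[0, b] -> `|t| <= `|b|.
    by rewrite in_itv/= => /andP[t0 tb]; rewrite !ger0_norm.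
  have [||t tb E] := @MVT_segment R f f' 0 b b0.
  - by move=> t tb; have [] := H t (hb t (subset_itv_oo_cc tb)).
  - by apply: continuous_in_subspaceT => t; rewrite inE/= => tb; exact: cf (hb t tb).
  by exists t; [exact: hb|rewrite E subr0].
have hb t : t \in `[b, 0] -> `|t| <= `|b|.
  by rewrite in_itv/= => /andP[tb t0]; rewrite !ler0_norm ?lerN2 ?(ltW b0).
have [||t tb E] := @MVT_segment R f f' b 0 (ltW b0).
- by move=> t tb; have [] := H t (hb t (subset_itv_oo_cc tb)).
- by apply: continuous_in_subspaceT => t; rewrite inE/= => tb; exact: cf (hb t tb).
by exists t; [exact: hb|rewrite -opprB E sub0r mulrN opprK].
Qed.

End mean_value.

Section taylor.
Context {R : realType} {N : nat}.
Implicit Types (u : 'rV[R]_N -> R) (x y h v : 'rV[R]_N) (t : R).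

Lemma is_derive_line u x v t : derivable u (x + t *: v) v ->
  is_derive t 1 (fun t => u (x + t *: v)) ('D_v u (x + t *: v)).
Proof.
move=> du.
have E : (fun h : R => h^-1 *: (u (x + (h *: 1 + t) *: v) - u (x + t *: v))) =
    (fun h : R => h^-1 *: (u (h *: v + (x + t *: v)) - u (x + t *: v))).
  apply/funext => h; congr (_ *: (u _ - _)).
  by rewrite scalerDl /GRing.scale/= mulr1 addrCA.
split; first by rewrite /derivable/= E.
by rewrite /derive/= E.
Qed.

Lemma le_enorm x y : (forall i, `|x ord0 i| <= `|y ord0 i|) -> enorm x <= enorm y.
Proof.
move=> xy; rewrite -ler_sqr ?nnegrE ?enorm_ge0// !enorm_sq.
by apply: ler_sum => i _; rewrite -[leLHS]real_normK ?num_real// -[leRHS]real_normK ?num_real// lerXn2r ?nnegrE.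
Qed.

(** [C2_on] speaks only of coordinate directions. The increment [h] is therefore run through one
    coordinate at a time, within distance [|h|] of [y], and the one-dimensional mean value theorem
    is applied to each leg. *)
Lemma first_order_bound u y h (c : 'I_N -> R) B :
  (forall x, enorm (x - y) <= enorm h -> forall i,
     derivable u x (delta_mx ord0 i) /\ `|partial i u x - c i| <= B) ->
  `|u (y + h) - u y - \sum_i c i * h ord0 i| <= B * \sum_i `|h ord0 i|.
Proof.
move=> H.
pose p (j : nat) : 'rV[R]_N := y + \row_i (if (i < j)%N then h ord0 i else 0).
have p0 : p 0%N = y by rewrite /p (_ : \row_i _ = 0) ?addr0//; apply/rowP => i; rewrite !mxE.
have pN : p N = y + h by congr (_ + _); apply/rowP => i; rewrite mxE ltn_ord.
have pS (j : 'I_N) : p j.+1 = p j + h ord0 j *: delta_mx ord0 j.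
  rewrite /p -addrA; congr (_ + _); apply/rowP => i; rewrite !mxE eqxx/= ltnS leq_eqVlt.
  have [->|ij] := eqVneq i j; first by rewrite eqxx ltnn mulr1 add0r.
  by rewrite (negbTE (_ : (i != j :> nat)))//= mulr0 addr0.
have -> : u (y + h) - u y = \sum_(j < N) (u (p j.+1) - u (p j)).
  by rewrite -pN -p0 -(big_mkord predT (fun j => u (p j.+1) - u (p j))) telescope_sumr.
rewrite -sumrB mulr_sumr; apply: le_trans (ler_norm_sum _ _ _) _.
apply: ler_sum => j _; rewrite pS.
have -> : u (p j) = u (p j + 0 *: delta_mx ord0 j) by rewrite scale0r addr0.
apply: (mean_value_le (f := fun t => u (p j + t *: delta_mx ord0 j))
  (f' := fun t => partial j u (p j + t *: delta_mx ord0 j))) => t tj.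
have /H/(_ j)[d hb] : enorm (p j + t *: delta_mx ord0 j - y) <= enorm h.
  apply: le_enorm => i; rewrite /p !mxE eqxx/=.
  rewrite [X in `|X| <= _](_ : _ = (if (i < j)%N then h ord0 i else 0) + t * (i == j)%:R); last by ring.
  have [->|ij] := eqVneq i j; first by rewrite ltnn add0r mulr1.
  by rewrite mulr0 addr0; case: ifP => //; rewrite normr0.
split; [exact: is_derive_line|exact: hb].
Qed.

Lemma sum_norm_le h : \sum_i `|h ord0 i| <= N%:R * enorm h.
Proof.
rewrite -[X in X%:R]card_ord -sum1_card natr_sum mulr_suml.
by apply: ler_sum => i _; rewrite mul1r ler_enorm.
Qed.

Lemma nbhs_enorm y (P : 'rV[R]_N -> Prop) : (\forall x \near y, P x) ->
  exists2 r, 0 < r & forall x, enorm (x - y) <= r -> P x.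
Proof.
move=> /nbhs_ballP[e /= e0 He]; exists (e / 2); first by rewrite divr_gt0.
move=> x xy; apply: He; split=> // i j; rewrite ord1 /ball/= distrC.
have := ler_enorm j (x - y); rewrite !mxE => h.
by rewrite (le_lt_trans (le_trans h xy))// gtr_pMr// invf_lt1// ltr1n.
Qed.

Lemma common_radius (T : finType) (P : T -> R -> Prop) :
  (forall i r r', P i r -> 0 < r' -> r' <= r -> P i r') ->
  (forall i, exists2 r, 0 < r & P i r) -> exists2 r, 0 < r & forall i, P i r.
Proof.
move=> mono ex.
have /choice[f Hf] : forall i, exists r, 0 < r /\ P i r.
  by move=> i; have [r ? ?] := ex i; exists r.
have m0 : 0 < \big[Num.min/1]_i f i.
  by apply: (big_ind (fun z => 0 < z)) => //[a b a0 b0|i _]; rewrite ?lt_min ?a0//; have [] := Hf i.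
exists (\big[Num.min/1]_i f i) => // i; have [fi Pi] := Hf i.
by apply: mono Pi m0 _; rewrite (bigD1 i)//= ge_min lexx.
Qed.

Lemma ler_term_sum (T : finType) (F : T -> R) i : (forall j, 0 <= F j) -> F i <= \sum_j F j.
Proof. by move=> F0; rewrite (bigD1 i)//= lerDl sumr_ge0. Qed.

(** Linear terms cancel, so this is of order [|h|^2] for C^2 functions and turns the principal value
    into an absolutely convergent integral. It is also monotone under touching: if [W <= u] with
    equality at [y], then [diff2 u y <= diff2 W y]. *)
Definition diff2 u y h : R := u y - (u (y + h) + u (y - h)) / 2.

Lemma diff2_C2 R0 u y : C2_on (exterior R0) u -> exterior R0 y ->
  exists r K, [/\ 0 < r, 0 <= K & forall h, enorm h <= r -> `|diff2 u y h| <= K * enorm h ^+ 2].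
Proof.
move=> C2 ey; have [_ D1 D2] := C2 y ey.
have [r1 r10 H1] : exists2 r, 0 < r & forall ij : 'I_N * 'I_N, forall x, enorm (x - y) <= r ->
    `|partial ij.2 (partial ij.1 u) x - partial ij.2 (partial ij.1 u) y| <= 1.
  apply: (@common_radius _ (fun ij r => forall x, enorm (x - y) <= r -> _)).
    by move=> ij r r' H _ rr x xr; apply: H; exact: le_trans rr.
  move=> [i j] /=; have [_ c] := D2 i j; apply: nbhs_enorm.
  have /cvgrPdist_le/(_ 1 ltr01) H := c.
  have sw z : `|partial j (partial i u) y - z| <= 1 -> `|z - partial j (partial i u) y| <= 1.
    by rewrite distrC.
  exact: (filterS (fun x => sw (partial j (partial i u) x)) H).
pose r := Num.min r1 ((enorm y - R0) / 2).
have r0 : 0 < r by rewrite lt_min r10 divr_gt0// subr_gt0.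
have ext x : enorm (x - y) <= r -> exterior R0 x.
  move=> h; rewrite /exterior/=.
  have : enorm (x - y) <= (enorm y - R0) / 2 by apply: le_trans h _; rewrite ge_min lexx orbT.
  have := enormB_le y (x - y); rewrite [y + _]addrC subrK.
  by move: ey; rewrite /exterior/=; lra.
pose a i j := `|partial j (partial i u) y|.
have a0 i j : 0 <= a i j by exact: normr_ge0.
pose M := 1 + \sum_i \sum_j a i j.
have M0 : 0 <= M.
  by apply: addr_ge0; [exact: ler01|apply: sumr_ge0 => i _; apply: sumr_ge0 => j _; exact: a0].
have HM i j x : enorm (x - y) <= r -> `|partial j (partial i u) x| <= M.
  move=> h; have h1 : enorm (x - y) <= r1 by apply: le_trans h _; rewrite ge_min lexx.
  have h2 := H1 (i, j) x h1.
  have h3 : a i j <= \sum_i \sum_j a i j.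
    apply: (le_trans (ler_term_sum j (a0 i))).
    by apply: (ler_term_sum (F := fun i => \sum_j a i j)) => k; apply: sumr_ge0 => l _; exact: a0.
  rewrite -[X in `|X|](subrK (partial j (partial i u) y)).
  by apply: (le_trans (ler_normD _ _)); apply: (lerD h2 h3).
(* With zero slopes, [first_order_bound] applied to the first partials bounds their variation around
   [y] linearly; [H3] then applies it to [u] with the slopes at [y]. *)
have H2 i x : enorm (x - y) <= r -> `|partial i u x - partial i u y| <= M * (N%:R * enorm (x - y)).
  move=> xr; have := @first_order_bound (partial i u) y (x - y) (fun=> 0) M.
  rewrite big1 ?subr0 => [H|? _]; last by rewrite mul0r.
  rewrite [y + _]addrC subrK in H.
  apply: le_trans (H _) _ => [z zx j|]; last by rewrite ler_wpM2l// sum_norm_le.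
  have zr := le_trans zx xr; split; last by rewrite subr0 HM.
  by have [_ _ D] := C2 z (ext z zr); have [] := D i j.
exists r, (M * N%:R * N%:R); split => //; first by rewrite !mulr_ge0.
have H3 h : enorm h <= r ->
    `|u (y + h) - u y - \sum_i partial i u y * h ord0 i| <= M * (N%:R * enorm h) * (N%:R * enorm h).
  move=> hr; apply: le_trans (@first_order_bound _ y h (fun i => partial i u y) (M * (N%:R * enorm h)) _) _.
    move=> x xh i; have xr := le_trans xh hr; split.
      by have [_ D _] := C2 x (ext x xr); have [] := D i.
    by apply: le_trans (H2 i x xr) _; rewrite !ler_wpM2l.
  by rewrite ler_wpM2l ?sum_norm_le// !mulr_ge0// enorm_ge0.
move=> h hr; have A := H3 h hr; have := H3 (- h); rewrite enormN => /(_ hr) B.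
have S : \sum_i partial i u y * (- h) ord0 i = - \sum_i partial i u y * h ord0 i.
  by rewrite -sumrN; apply: eq_bigr => i _; rewrite mxE mulrN.
rewrite S in B.
set L := \sum_i _ in A B; set Q := M * _ * _ in A B.
have -> : M * N%:R * N%:R * enorm h ^+ 2 = Q by rewrite /Q; ring.
move: A B; rewrite !ler_norml /diff2 => /andP[a1 a2] /andP[b1 b2].
by apply/andP; split; lra.
Qed.

End taylor.

(** * Null sets and Borel versions *)

Section null_sets.
Context d (T : measurableType d) (R : realType) (m : {measure set T -> \bar R}).
Import HBNNSimple.

(** Here [f] may be non-measurable: its integral is a supremum over simple functions below it, and
    each of these can be cut off on [Z] without changing its integral. *)
Lemma ge0_integral_off_null (Z : set T) (f : T -> \bar R) :
  measurable Z -> m Z = 0%E -> (forall x, 0 <= f x)%E ->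
  (\int[m]_x f x = \int[m]_x (f \_ (~` Z)) x)%E.
Proof.
move=> mZ Z0 f0.
have f10 x : (0 <= (f \_ (~` Z)) x)%E by rewrite patchE; case: ifP.
apply/eqP; rewrite eq_le; apply/andP; split; last first.
  rewrite !ge0_integralTE//; apply: ereal_sup_le => _ [h /= hf <-]; exists h => //= x.
  by apply: le_trans (hf x) _; rewrite patchE; case: ifP.
rewrite [leLHS]ge0_integralTE//; apply: ge_ereal_sup => _ [h /= hf <-].
have mh : measurable_fun setT (EFin \o h) by apply/measurable_EFinP.
rewrite -integralT_nnsfun (@ge0_negligible_integral _ _ _ m setT Z (EFin \o h))//; last first.
  by move=> x _; rewrite lee_fin.
rewrite setTD integral_mkcond [leRHS]ge0_integralTE//.
have mCZ := measurableC mZ; apply: ereal_sup_ubound; exists (proj_nnsfun h mCZ) => /=.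
  move=> x; rewrite /proj_nnsfun/= mindicE patchE.
  by case: ifPn => _; rewrite ?mulr1 ?mulr0//; exact: hf.
rewrite -integralT_nnsfun; apply: eq_integral => x _.
rewrite /proj_nnsfun/= mindicE patchE.
by case: ifPn => _; rewrite ?mulr1 ?mulr0.
Qed.

Lemma integral_off_null (Z D : set T) (f g : T -> \bar R) :
  measurable Z -> m Z = 0%E -> (forall x, ~ Z x -> f x = g x) ->
  (\int[m]_(x in D) f x = \int[m]_(x in D) g x)%E.
Proof.
move=> mZ Z0 fg; rewrite [LHS]integral_mkcond [RHS]integral_mkcond.
have E x : ~ Z x -> (f \_ D) x = (g \_ D) x by move=> Zx; rewrite !patchE fg.
rewrite [LHS]integralE [RHS]integralE; congr (_ - _)%E.
  rewrite [LHS](ge0_integral_off_null mZ Z0)// [RHS](ge0_integral_off_null mZ Z0)//.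
  apply: eq_integral => x _; rewrite !patchE; case: ifPn => //.
  by rewrite in_setC notin_setE => /E xE; rewrite !funeposE xE.
rewrite [LHS](ge0_integral_off_null mZ Z0)// [RHS](ge0_integral_off_null mZ Z0)//.
apply: eq_integral => x _; rewrite !patchE; case: ifPn => //.
by rewrite in_setC notin_setE => /E xE; rewrite !funenegE xE.
Qed.

(** [min f g] equals [f] off [Z] and lies below [g] everywhere. *)
Lemma le_integral_off_null (Z : set T) (f g : T -> R) :
  measurable Z -> m Z = 0%E -> m.-integrable setT (EFin \o f) ->
  m.-integrable setT (EFin \o g) -> (forall x, ~ Z x -> f x <= g x) ->
  (\int[m]_x (f x)%:E <= \int[m]_x (g x)%:E)%E.
Proof.
move=> mZ Z0 If Ig fg; pose f' x := Num.min (f x) (g x).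
have mf : measurable_fun setT f by case/integrableP : If => /measurable_EFinP.
have mg : measurable_fun setT g by case/integrableP : Ig => /measurable_EFinP.
rewrite (@integral_off_null Z setT (fun x => (f x)%:E) (fun x => (f' x)%:E))//; last first.
  by move=> x Zx; rewrite /f' min_l// fg.
apply: le_integral => //; last by move=> x _; rewrite lee_fin /f' ge_min lexx orbT.
have mD : measurable [set: T] by [].
apply: (@le_integrable _ _ R m setT mD _ (fun x => `|f x|%:E + `|g x|%:E)%E).
- by apply/measurable_EFinP; exact: measurable_minr.
- move=> x _; rewrite /= lee_fin [leRHS]ger0_norm ?addr_ge0// /f'.
  by case: (leP (f x) (g x)) => _; rewrite ?lerDl ?lerDr normr_ge0.
- apply: (integrableD mD (f := fun x => `|f x|%:E) (g := fun x => `|g x|%:E)).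
    exact: (integrable_abse If).
  exact: (integrable_abse Ig).
Qed.

End null_sets.

Section borel_version.
Context {R : realType} {N : nat}.
Local Notation ell := (@lebesgue_rV R N).

(** [u] is measurable for the completed sigma-algebra, whereas Tonelli and the changes of variables
    are stated for Borel functions. Each [{q < u}] with [q] rational is Borel up to a null set;
    setting [u] to 0 on the union of these countably many null sets makes it Borel. *)
Lemma borel_version (u : 'rV[R]_N -> R) : lebesgue_measurable_fun u ->
  exists (v : 'rV[R]_N -> R) (Z : set 'rV[R]_N),
    [/\ measurable_fun setT v, measurable Z, ell Z = 0%E & forall x, ~ Z x -> v x = u x].
Proof.
move=> mu.
pose q (k : nat) : R := ratr (odflt 0 (unpickle k : option rat)).
have /choice[AZ HAZ] : forall k, exists AZ : set 'rV[R]_N * set 'rV[R]_N,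
    [/\ measurable AZ.1, measurable AZ.2, ell AZ.2 = 0%E &
      forall x, ~ AZ.2 x -> (q k < u x <-> AZ.1 x)].
  move=> k; have [A mA [M [Z [mZ Z0 MZ]]] E] := mu `]q k, +oo[%classic (measurable_itv _).
  exists (A, Z); split => //= x Zx.
  have -> : q k < u x <-> (u @^-1` `]q k, +oo[%classic) x by rewrite /= in_itv/= andbT.
  by rewrite -E; split=> [[//|/MZ//]|]; left.
pose Z := \bigcup_k (AZ k).2.
have mZ : measurable Z by apply: bigcupT_measurable => k; have [] := HAZ k.
have Z0 : ell Z = 0%E.
  apply/negligibleP => //; apply: negligible_bigcup => k.
  by have [_ mk k0 _] := HAZ k; apply/negligibleP.
exists (u \_ (~` Z)), Z; split => //; last by move=> x Zx; rewrite patchE mem_set.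
apply: (measurability _ (RGenOInfty.measurableE R)) => _ [_ [r ->] <-]; rewrite setTI.
(* The version is 0 on [Z], so [Z] lies in the superlevel set exactly when [r < 0]. *)
have -> : (u \_ (~` Z)) @^-1` `]r, +oo[%classic =
    (if r < 0 then Z else set0) `|` \bigcup_(k in [set k | r < q k]) ((AZ k).1 `&` ~` Z).
  apply/seteqP; split=> x /=; rewrite in_itv/= andbT patchE.
    case: ifPn => [|]; rewrite in_setC ?negbK => xZ.
      move=> rx; right.
      have [p /=] := rat_in_itvoo rx; rewrite in_itv/= => /andP[rp px].
      exists (pickle p) => /=; first by rewrite /q pickleK.
      split; last by move: xZ; rewrite notin_setE.
      have [_ _ _ H] := HAZ (pickle p); apply/H; last by rewrite /q pickleK.
      by move=> xk; move: xZ; rewrite notin_setE; apply; exists (pickle p).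
    by move=> ->; left; move: xZ; rewrite inE.
  case=> [|[k /= rk [Ak nZ]]].
    by case: ifPn => // r0 Zx; rewrite in_setC mem_set.
  rewrite in_setC memNset//=.
  have [_ _ _ H] := HAZ k; apply: lt_trans rk _; apply/H => // xk.
  by apply: nZ; exists k.
apply: measurableU; first by case: ifP.
apply: bigcup_measurable => k _; apply: measurableI; last exact: measurableC.
by have [] := HAZ k.
Qed.

End borel_version.

(** * Integrability of the kernel, and its approximation *)

Section kernel_integrability.
Context {R : realType} {N : nat} (s : R) (hs : 0 < s < 1).
Local Notation mu := (@lebesgue_measure R).
Local Notation ell := (@lebesgue_rV R N).
Implicit Types (a e t : R) (h : 'rV[R]_N).

Let s0 : 0 < s. Proof. by case/andP: hs. Qed.
Let s1 : s < 1. Proof. by case/andP: hs. Qed.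
Let gI := @gaussI R N.
Let gI0 : 0 < gI. Proof. exact: gaussI_gt0. Qed.
Let a0 : 0 < N%:R + 2 * s. Proof. by rewrite ltr_wpDl// mulr_gt0. Qed.

Definition sqmin h : R := Num.min 1 (sqnorm h).

Lemma sqmin_ge0 h : 0 <= sqmin h.
Proof. by rewrite le_min ler01 sqnorm_ge0. Qed.

Lemma measurable_sqmin : measurable_fun [set: 'rV[R]_N] sqmin.
Proof. by apply: measurable_minr => //; exact: measurable_sqnorm. Qed.

(** With [z = |h|^2/(2t)], half of the exponential absorbs [|h|^2], since [z e^-z <= 1]. *)
Lemma sqnorm_heat_le t h : 0 < t ->
  sqnorm h * heat t h <= (2 * 2 `^ (N%:R / 2) * t) * heat (2 * t) h.
Proof.
move=> t0; rewrite /heat; set q := sqnorm h; have q0 : 0 <= q := sqnorm_ge0 h.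
rewrite powRM ?(ltW t0)// (powRN 2 (N%:R / 2)).
rewrite (_ : _ * (_ * _ * _) = t `^ (- (N%:R / 2)) * (2 * t * expR (- (q / (2 * t))))); last first.
  by field; rewrite gt_eqF ?powR_gt0.
rewrite mulrCA ler_wpM2l ?powR_ge0//.
have -> : q / t = q / (2 * t) + q / (2 * t) by field; rewrite gt_eqF.
set z := q / (2 * t); have -> : q = 2 * t * z by rewrite /z; field; rewrite gt_eqF.
rewrite opprD expRD (_ : _ * (_ * _) = 2 * t * (z * expR (- z) * expR (- z))); last by ring.
rewrite ler_pM2l ?mulr_gt0// ler_piMl ?expR_ge0// expRN ler_pdivrMr ?expR_gt0// mul1r.
by apply: le_trans (expR_ge1Dx z); rewrite lerDr.
Qed.

Lemma integral_sqmin_heat t : 0 < t ->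
  (\int[ell]_h (sqmin h * heat t h)%:E <= (gI * (1 + 2 * 2 `^ (N%:R / 2)) * Num.min 1 t)%:E)%E.
Proof.
move=> t0; have P : 0 <= 2 * 2 `^ (N%:R / 2) :> R by rewrite mulr_ge0 ?powR_ge0.
have mh : measurable_fun [set: 'rV[R]_N] (fun h => sqmin h * heat t h).
  by apply: measurable_funM; [exact: measurable_sqmin|exact: measurable_heat2].
have h0 h : 0 <= sqmin h * heat t h by rewrite mulr_ge0 ?sqmin_ge0 ?heat_ge0.
case: (leP 1 t) => t1.
  apply: (@le_trans _ _ (\int[ell]_h (heat t h)%:E)%E).
    apply: nnint_le => //; first exact: measurable_heat2.
    by move=> h; rewrite ler_piMl ?heat_ge0// ge_min lexx.
  by rewrite integral_heat// lee_fin mulr1 ler_peMr ?(ltW gI0)// lerDl.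
apply: (@le_trans _ _ (\int[ell]_h ((2 * 2 `^ (N%:R / 2) * t) * heat (2 * t) h)%:E)%E).
  apply: nnint_le => //.
    by apply: measurable_funM => //; exact: measurable_heat2.
  move=> h; apply: le_trans (sqnorm_heat_le h t0).
  by rewrite ler_wpM2r ?heat_ge0// ge_min lexx orbT.
rewrite nnintZ; last 3 first.
- exact: measurable_heat2.
- by move=> h; exact: heat_ge0.
- by rewrite mulr_ge0// ltW.
rewrite integral_heat ?mulr_gt0// -EFinM lee_fin [leLHS]mulrC -[leRHS]mulrA ler_pM2l//.
by rewrite ler_wpM2r ?(ltW t0)// lerDr.
Qed.

(** The Levy condition for [|h|^-(N+2s)], again by mixtures: [sqmin] integrated against the heat
    kernel at time [t] is at most a multiple of [min(1, t)], and [t^(-s-1) min(1, t)] is integrable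
    because [0 < s < 1]. *)
Lemma sqmin_kernel_lty :
  (\int[ell]_h (sqmin h * pw (N%:R + 2 * s) h)%:E < +oo)%E.
Proof.
have m0 := mix_gt0 a0.
have mk : measurable_fun [set: 'rV[R]_N] (fun h => sqmin h * pw (N%:R + 2 * s) h).
  by apply: measurable_funM; [exact: measurable_sqmin|exact: measurable_pw].
have k0 h : 0 <= sqmin h * pw (N%:R + 2 * s) h by rewrite mulr_ge0 ?sqmin_ge0 ?pw_ge0.
suff H : ((mix (N%:R + 2 * s))%:E * \int[ell]_h (sqmin h * pw (N%:R + 2 * s) h)%:E < +oo)%E.
  by rewrite ltey; apply/eqP => E; move: H; rewrite E gt0_muley.
have -> := esym (@nnintZ _ _ R ell _ _ mk k0 (ltW m0)).
apply: (@le_lt_trans _ _ (\int[ell]_h \int[mu]_t (sqmin h * (tpow (- s - 1) t * heat t h))%:E)%E).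
  apply: ge0_le_integral => //.
  - by move=> h _; rewrite lee_fin mulr_ge0 ?(ltW m0).
  - by apply/measurable_EFinP; apply: measurable_funM.
  - apply: (@measurable_fun_fubini_tonelli_F _ _ _ _ _ mu
      (fun z => (sqmin z.1 * (tpow (- s - 1) z.2 * heat z.2 z.1))%:E)).
    + apply/measurable_EFinP; apply: measurable_funM.
        exact: (measurableT_comp measurable_sqmin measurable_fst).
      apply: measurable_funM.
        by apply: measurable_tpow_comp; exact: measurable_snd.
      by apply: measurable_heat2; [exact: measurable_snd|exact: measurable_fst].
    + by move=> z; rewrite lee_fin; exact: (mulr_ge0 (sqmin_ge0 _) (mulr_ge0 (tpow_ge0 _ _) (heat_ge0 _ _))).
  move=> h _; rewrite nnintZ ?sqmin_ge0//; last 2 first.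
  - by apply: measurable_funM => //; exact: measurable_heat2.
  - by move=> t; rewrite mulr_ge0 ?tpow_ge0 ?heat_ge0.
  rewrite mulrCA EFinM; apply: lee_wpmul2l; first by rewrite lee_fin sqmin_ge0.
  have := @heat_mixture0 R N _ h a0.
  by rewrite (_ : (N%:R - (N%:R + 2 * s)) / 2 - 1 = - s - 1)//; field.
rewrite (@tonelli_real _ _ _ _ _ ell mu (fun h t => sqmin h * (tpow (- s - 1) t * heat t h))); last 2 first.
- apply: measurable_funM.
    exact: (measurableT_comp measurable_sqmin measurable_fst).
  apply: measurable_funM.
    by apply: measurable_tpow_comp; exact: measurable_snd.
  by apply: measurable_heat2; [exact: measurable_snd|exact: measurable_fst].
- by move=> h t; exact: (mulr_ge0 (sqmin_ge0 _) (mulr_ge0 (tpow_ge0 _ _) (heat_ge0 _ _))).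
pose A := gI * (1 + 2 * 2 `^ (N%:R / 2)).
have A0 : 0 <= A by rewrite mulr_ge0 ?(ltW gI0)// addr_ge0// mulr_ge0 ?powR_ge0.
pose g t := A * (tpow (- s - 1) t * `|Num.min 1 t|).
have mg : measurable_fun [set: R] g.
  apply: measurable_funM => //; apply: measurable_funM => //.
  by apply: measurableT_comp => //; exact: measurable_minr.
have g0 t : 0 <= g t by exact: (mulr_ge0 A0 (mulr_ge0 (tpow_ge0 _ _) (normr_ge0 _))).
apply: (@le_lt_trans _ _ (\int[mu]_t (g t)%:E)%E).
  apply: ge0_le_integral => //.
  - by move=> t _; apply: nnint_ge0 => h; exact: (mulr_ge0 (sqmin_ge0 _) (mulr_ge0 (tpow_ge0 _ _) (heat_ge0 _ _))).
  - apply: (@measurable_fun_fubini_tonelli_F _ _ _ _ _ ell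
      (fun z : measurableTypeR R * 'rV[R]_N => (sqmin z.2 * (tpow (- s - 1) z.1 * heat z.1 z.2))%:E)).
    + apply/measurable_EFinP; apply: measurable_funM.
        exact: (measurableT_comp measurable_sqmin measurable_snd).
      apply: measurable_funM.
        by apply: measurable_tpow_comp; exact: measurable_fst.
      by apply: measurable_heat2; [exact: measurable_fst|exact: measurable_snd].
    + by move=> z; rewrite lee_fin; exact: (mulr_ge0 (sqmin_ge0 _) (mulr_ge0 (tpow_ge0 _ _) (heat_ge0 _ _))).
  - exact/measurable_EFinP.
  move=> t _; have [t0|t0] := leP t 0.
    rewrite integral0_eq ?lee_fin ?g0// => h _; rewrite tpow_le0// mul0r mulr0//.
  have -> : (\int[ell]_h (sqmin h * (tpow (- s - 1) t * heat t h))%:E =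
     \int[ell]_h (tpow (- s - 1) t * (sqmin h * heat t h))%:E)%E.
    by apply: eq_integral => h _; congr EFin; ring.
  rewrite nnintZ ?tpow_ge0//; last 2 first.
  - by apply: measurable_funM; [exact: measurable_sqmin|exact: measurable_heat2].
  - by move=> h; rewrite mulr_ge0 ?sqmin_ge0 ?heat_ge0.
  rewrite /g mulrCA EFinM; apply: lee_wpmul2l; first by rewrite lee_fin tpow_ge0.
  by rewrite ger0_norm ?le_min ?ler01 ?(ltW t0)//; exact: integral_sqmin_heat.
apply: (@nnint_lty _ g A (1 - s) s); rewrite ?subr_gt0// => t.
rewrite /g; case: ifPn => t1.
  have [t0|t0] := leP t 0; first by rewrite !tpow_le0// mul0r.
  rewrite ler_wpM2l// min_r// gtr0_norm// !tpowE// mulrC -{1}(powRr1 (ltW t0)) -powRD_gt0//.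
  by rewrite le_eqVlt; apply/orP; left; apply/eqP; congr (_ `^ _); ring.
rewrite ler_wpM2l// min_l ?normr1 ?mulr1//; last by rewrite ltW// ltNge.
Qed.

Lemma measurable_sqmin_kernel : measurable_fun [set: 'rV[R]_N]
  (fun h => sqmin h * pw (N%:R + 2 * s) h).
Proof. by apply: measurable_funM; [exact: measurable_sqmin|exact: measurable_pw]. Qed.

Lemma trunc_le e t : 0 < e -> trunc s e t <= tpow (- s - 1) t.
Proof.
move=> e0; rewrite /trunc; case: ifPn => et; last exact: tpow_ge0.
by rewrite tpowE ?(lt_le_trans e0 et)// (_ : - 1 - s = - s - 1)//; ring.
Qed.

Let kernel_mixture h : h != 0 ->
  (\int[mu]_t (tpow (- s - 1) t * heat t h)%:E =
   (mix (N%:R + 2 * s) * pw (N%:R + 2 * s) h)%:E)%E.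
Proof.
move=> h0; rewrite -(heat_mixture a0 h0).
by rewrite (_ : (N%:R - (N%:R + 2 * s)) / 2 - 1 = - s - 1)//; field.
Qed.

Lemma tkernel_le e h : 0 < e -> h != 0 ->
  tkernel s e h <= mix (N%:R + 2 * s) * pw (N%:R + 2 * s) h.
Proof.
move=> e0 h0; rewrite -lee_fin -tkernelE// -kernel_mixture//.
apply: nnint_le.
- exact: measurable_trunc_heat.
- by apply: measurable_funM => //; exact: measurable_heat2.
- by move=> t; exact: trunc_heat_ge0.
- by move=> t; rewrite ler_wpM2r ?heat_ge0// trunc_le.
Qed.

Lemma tkernel_cvg h : h != 0 ->
  tkernel s (m.+1%:R^-1) h @[m --> \oo] --> mix (N%:R + 2 * s) * pw (N%:R + 2 * s) h.
Proof.
move=> h0; pose g (m : nat) t := ((trunc s (m.+1%:R^-1) t * heat t h)%:E : \bar R).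
have e0 m : 0 < m.+1%:R^-1 :> R by rewrite invr_gt0.
have mg m : measurable_fun [set: R] (g m) by apply/measurable_EFinP; exact: measurable_trunc_heat.
have g0 m t : [set: R] t -> (0 <= g m t)%E by rewrite lee_fin trunc_heat_ge0.
have ndg t : [set: R] t -> {homo g^~ t : a b / (a <= b)%N >-> (a <= b)%E}.
  move=> _ a b ab; rewrite lee_fin ler_wpM2r ?heat_ge0// /trunc.
  case: ifPn => [at_|_]; last by case: ifP => // _; exact: powR_ge0.
  by rewrite (le_trans _ at_)// lef_pV2 ?posrE// ler_nat.
have := @cvg_monotone_convergence _ _ R mu setT measurableT g mg g0 ndg.
have -> : (\int[mu]_t limn (g^~ t) = \int[mu]_t (tpow (- s - 1) t * heat t h)%:E)%E.
  apply: eq_integral => t _; apply: cvg_lim => //.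
  have [t0|t0] := leP t 0.
    rewrite tpow_le0// mul0r (_ : g^~ t = fun=> 0%E); first exact: cvg_cst.
    apply/funext => m; rewrite /g /trunc leNgt (le_lt_trans t0 (e0 m))//= mul0r//.
  apply: cvg_near_cst; near=> m.
  rewrite /g /trunc tpowE// ifT; first by congr ((_ `^ _ * _)%:E); ring.
  rewrite ltW//; near: m; exact: (near_infty_natSinv_lt (PosNum t0)).
rewrite kernel_mixture//.
have -> : (fun m => (\int[mu]_t g m t)%E) = EFin \o (fun m => tkernel s (m.+1%:R^-1) h).
  by apply/funext => m; rewrite /= -tkernelE.
by move/fine_cvgP => [].
Unshelve. all: by end_near. Qed.

End kernel_integrability.

(** * Integrals of real-valued functions *)

Section real_integrals.
Context d (T : measurableType d) (R : realType) (m : {measure set T -> \bar R}).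
Implicit Types (f g : T -> R) (k : R).
Local Notation L1 f := (m.-integrable setT (EFin \o f)).
Local Notation I f := (Rintegral m setT f).

Lemma L1_measurable f : L1 f -> measurable_fun setT f.
Proof. by case/integrableP => /measurable_EFinP. Qed.

Lemma L1_ge0 f : measurable_fun setT f -> (forall x, 0 <= f x) ->
  (\int[m]_x (f x)%:E < +oo)%E -> L1 f.
Proof.
move=> mf f0 fi; apply/integrableP; split; first exact/measurable_EFinP.
rewrite (_ : (\int[m]_x _ = \int[m]_x (f x)%:E)%E)//.
by apply: eq_integral => x _; rewrite /= ger0_norm.
Qed.

Lemma L1_le f g : measurable_fun setT f -> L1 g -> (forall x, `|f x| <= g x) -> L1 f.
Proof.
move=> mf Ig fg; apply: (@le_integrable _ _ R m setT measurableT _ (EFin \o g)) => //.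
- exact/measurable_EFinP.
- by move=> x _; rewrite /= lee_fin (le_trans (fg x))// ler_norm.
Qed.

Lemma L1D f g : L1 f -> L1 g -> L1 (fun x => f x + g x).
Proof. exact: (integrableD measurableT). Qed.

Lemma L1Z k f : L1 f -> L1 (fun x => k * f x).
Proof. exact: (integrableZl measurableT). Qed.

Lemma L1_lty f : L1 f -> (\int[m]_x `|(f x)%:E| < +oo)%E.
Proof. by case/integrableP. Qed.

Lemma RintE f : L1 f -> (\int[m]_x (f x)%:E = (I f)%:E)%E.
Proof. by move=> If; rewrite /Rintegral fineK//; exact: (integrable_fin_num). Qed.

Lemma RintD f g : L1 f -> L1 g -> I (fun x => f x + g x) = I f + I g.
Proof. exact: (RintegralD measurableT). Qed.

Lemma RintZ k f : L1 f -> I (fun x => k * f x) = k * I f.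
Proof. by move=> If; rewrite RintegralZl. Qed.

Lemma Rint_ge0E f M : measurable_fun setT f -> (forall x, 0 <= f x) ->
  (\int[m]_x (f x)%:E = M%:E)%E -> L1 f /\ I f = M.
Proof.
move=> mf f0 E; split; last by rewrite /Rintegral E.
by apply: L1_ge0 => //; rewrite E ltry.
Qed.

Lemma Rint_le_off_null (Z : set T) f g : measurable Z -> m Z = 0%E -> L1 f -> L1 g ->
  (forall x, ~ Z x -> f x <= g x) -> I f <= I g.
Proof.
move=> mZ Z0 If Ig fg; rewrite -lee_fin -!RintE//.
exact: (le_integral_off_null mZ Z0).
Qed.

Lemma Rint_le f g : L1 f -> L1 g -> (forall x, f x <= g x) -> I f <= I g.
Proof. by move=> If Ig fg; apply: (Rint_le_off_null (Z := set0)). Qed.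

Lemma Rint_off_null (Z : set T) f g : measurable Z -> m Z = 0%E ->
  (forall x, ~ Z x -> f x = g x) -> I f = I g.
Proof.
move=> mZ Z0 fg; rewrite /Rintegral; congr fine.
by apply: (@integral_off_null _ _ _ m Z setT (fun x => (f x)%:E) (fun x => (g x)%:E) mZ Z0) => x /fg ->.
Qed.

Lemma Rint_dominated (f_ : nat -> T -> R) f g : (forall j, measurable_fun setT (f_ j)) ->
  measurable_fun setT f -> L1 g -> (forall j x, `|f_ j x| <= g x) ->
  (forall x, f_ j x @[j --> \oo] --> f x) -> I (f_ j) @[j --> \oo] --> I f.
Proof.
move=> mf_ mf Ig fg cv.
have Ig' := L1_measurable Ig.
have cv' : {ae m, forall x, [set: T] x -> (f_ j x)%:E @[j --> \oo] --> (f x)%:E}.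
  by apply: aeW => x _; apply: cvg_EFin; [exact: nearW|exact: cv].
have le' : {ae m, forall x, forall j, [set: T] x -> (`|(f_ j x)%:E| <= (g x)%:E)%E}.
  by apply: aeW => x j _; rewrite lee_fin.
have [If _] := @dominated_convergence _ _ R m setT measurableT (fun j x => (f_ j x)%:E)
  (EFin \o f) (EFin \o g) (fun j => (measurable_EFinP _ _).2 (mf_ j)) ((measurable_EFinP _ _).2 mf)
  cv' Ig le'.
have -> : (fun j => (\int[m]_x (f_ j x)%:E)%E) = EFin \o (fun j => I (f_ j)).
  apply/funext => j; rewrite /= RintE//.
  exact: (L1_le (mf_ j) Ig (fg j)).
rewrite RintE// => /fine_cvgP[_].
exact.
Qed.

End real_integrals.

Section affine_real_integrals.
Context {R : realType} {N : nat}.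
Local Notation ell := (@lebesgue_rV R N).
Local Notation L1 f := (ell.-integrable setT (EFin \o f)).
Local Notation I f := (Rintegral ell setT f).
Implicit Types (f : 'rV[R]_N -> R) (c : R) (d : 'rV[R]_N).

Lemma measurable_affine_comp f c d : measurable_fun setT f ->
  measurable_fun setT (fun h : 'rV[R]_N => f (c *: h + d)).
Proof. by move=> mf; exact: (measurableT_comp mf (measurable_affine_rV c d)). Qed.

Lemma affine_null c d (Z : set 'rV[R]_N) : c != 0 -> measurable Z -> ell Z = 0%E ->
  measurable ((fun h : 'rV[R]_N => c *: h + d) @^-1` Z) /\ ell ((fun h : 'rV[R]_N => c *: h + d) @^-1` Z) = 0%E.
Proof.
move=> c0 mZ Z0.
have mZ' : measurable ((fun h : 'rV[R]_N => c *: h + d) @^-1` Z).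
  by rewrite -[X in measurable X]setTI; exact: measurable_affine_rV.
split => //.
have m1 : measurable_fun setT (fun x : 'rV[R]_N => (\1_Z x : R)%:E).
  by apply/measurable_EFinP; exact: measurable_indic.
have p1 (x : 'rV[R]_N) : (0 <= (\1_Z x : R)%:E)%E by rewrite lee_fin.
have := integral_affine_rV d c0 m1 p1.
have -> : (\int[ell]_x (\1_Z x)%:E = 0)%E by rewrite integral_indic// setIT.
rewrite mule0 => <-.
transitivity (ell (((fun h : 'rV[R]_N => c *: h + d) @^-1` Z) `&` setT)); first by rewrite setIT.
by rewrite -integral_indic.
Qed.

Lemma Rint_affine f c d : `|c| = 1 -> measurable_fun setT f -> I (fun h => f (c *: h + d)) = I f.
Proof.
move=> c1 mf; have c0 : c != 0 by rewrite -normr_eq0 c1 oner_eq0.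
rewrite /Rintegral; congr fine; rewrite [LHS]integralE [RHS]integralE.
have mE : measurable_fun [set: 'rV[R]_N] (EFin \o f) by apply/measurable_EFinP.
have E (g : 'rV[R]_N -> \bar R) : measurable_fun setT g -> (forall x, 0 <= g x)%E ->
    (\int[ell]_h g (c *: h + d)%R = \int[ell]_h g h)%E.
  by move=> mg g0; rewrite integral_affine_rV// c1 expr1n invr1 mul1e.
congr (_ - _)%E.
  transitivity (\int[ell]_h (EFin \o f)^\+ (c *: h + d)%R)%E.
    by apply: eq_integral => h _; rewrite !funeposE.
  by apply: E; [exact: measurable_funepos|exact: funepos_ge0].
transitivity (\int[ell]_h (EFin \o f)^\- (c *: h + d)%R)%E.
  by apply: eq_integral => h _; rewrite !funenegE.
by apply: E; [exact: measurable_funeneg|exact: funeneg_ge0].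
Qed.

Lemma L1_affine f c d : `|c| = 1 -> L1 f -> L1 (fun h => f (c *: h + d)).
Proof.
move=> c1 If; have mf := L1_measurable If.
have c0 : c != 0 by rewrite -normr_eq0 c1 oner_eq0.
apply/integrableP; split; first by apply/measurable_EFinP; exact: measurable_affine_comp.
have := L1_lty If.
rewrite (_ : (\int[ell]_x `|(f x)%:E| = \int[ell]_x `|(f (c *: x + d)%R)%:E|)%E)//.
rewrite (@integral_affine_rV R N c d (fun x => `|(f x)%:E|)%E)//; last first.
  by apply: measurableT_comp => //; exact/measurable_EFinP.
by rewrite c1 expr1n invr1 mul1e.
Qed.

End affine_real_integrals.

(** * The principal value as an absolutely convergent integral *)

Lemma ler_scaled_div {R : numFieldType} (k a c b : R) : 0 <= a -> k <= c / b -> k * a <= c * (a / b).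
Proof. by move=> a0 kc; rewrite mulrCA mulrC ler_wpM2l. Qed.

Lemma ler_half_sum {R : realFieldType} (k c a b a' b' : R) :
  k * a <= c * a' -> k * b <= c * b' -> (a + b) / 2 * k <= c / 2 * (a' + b').
Proof. lra. Qed.

Section principal_value.
Context {R : realType} {N : nat} (s : R) (hs : 0 < s < 1).
Local Notation ell := (@lebesgue_rV R N).
Local Notation L1 f := (ell.-integrable setT (EFin \o f)).
Local Notation I f := (Rintegral ell setT f).
Local Notation p := (N%:R + 2 * s).
Implicit Types (u v : 'rV[R]_N -> R) (x y h : 'rV[R]_N) (r e : R).

Let s0 : 0 < s. Proof. by case/andP: hs. Qed.
Let p0 : 0 < p. Proof. by rewrite ltr_wpDl// mulr_gt0. Qed.

Lemma pwN a h : pw a (- h) = pw a h.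
Proof. by rewrite /pw enormN. Qed.

(** Away from the origin the kernel is at most a multiple of the weight of [weighted_L1], because
    [|y+h| <= (|y|/r + 1) |h|] when [|h| >= r]. *)
Lemma pw_far a r y h : 0 < a -> 0 < r -> r <= enorm h ->
  pw a h <= (r `^ (- a) + (enorm y / r + 1) `^ a) / (1 + enorm (y + h) `^ a).
Proof.
move=> a0 r0 rh; have h0 : 0 < enorm h by exact: lt_le_trans rh.
have q0 : 0 <= enorm (y + h) `^ a by exact: powR_ge0.
rewrite ler_pdivlMr ?ltr_wpDr// /pw powRN mulrC ler_pdivrMr ?powR_gt0// mulrDl.
apply: lerD.
  rewrite powRN -[leLHS](@mulVf _ (r `^ a)) ?gt_eqF ?powR_gt0// ler_wpM2l ?invr_ge0 ?powR_ge0//.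
  by rewrite ge0_ler_powR ?nnegrE ?(ltW a0) ?(ltW r0) ?(ltW h0).
rewrite -powRM ?addr_ge0 ?divr_ge0 ?enorm_ge0 ?(ltW r0)//.
rewrite ge0_ler_powR ?nnegrE ?(ltW a0) ?enorm_ge0 ?mulr_ge0 ?addr_ge0 ?divr_ge0 ?enorm_ge0 ?(ltW r0)//.
apply: le_trans (enormD _ _) _; rewrite mulrDl mul1r lerD2r.
by rewrite -mulrA ler_peMr ?enorm_ge0// mulrC ler_pdivlMr// mul1r.
Qed.

Lemma sqmin_far r h : 0 < r -> r <= 1 -> r <= enorm h -> 1 <= r ^- 2 * sqmin h.
Proof.
move=> r0 r1 rh; rewrite mulrC ler_pdivlMr ?exprn_gt0// mul1r le_min.
by rewrite expr_le1 ?(ltW r0)// r1/= -enorm_sq lerXn2r ?nnegrE ?enorm_ge0// ltW.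
Qed.

Lemma sqmin_kernel_L1 : L1 (fun h => sqmin h * pw p h).
Proof.
apply: L1_ge0; [exact: measurable_sqmin_kernel| |exact: sqmin_kernel_lty].
by move=> h; rewrite mulr_ge0 ?sqmin_ge0 ?pw_ge0.
Qed.

Lemma measurable_far_part (g : 'rV[R]_N -> R) e : measurable_fun setT g ->
  measurable_fun setT (fun h => if e <= enorm h then g h else 0).
Proof.
move=> mg; apply: measurable_fun_ifT; [|exact: mg|exact: measurable_cst].
by apply: measurable_fun_ler; [exact: measurable_cst|exact: measurable_enorm].
Qed.

Let half_dominated (c a b k g : R) : 0 <= k -> (`|c| + (`|a| + `|b|) / 2) * k <= g ->
  `|(c - a) * k| <= 2 * g /\ `|(c - b) * k| <= 2 * g.
Proof.
move=> k0 H; rewrite !normrM [`|k|]ger0_norm//.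
have Ha := ler_wpM2r k0 (ler_normB c a); have Hb := ler_wpM2r k0 (ler_normB c b).
have c1 := mulr_ge0 (normr_ge0 c) k0; have c2 := mulr_ge0 (normr_ge0 a) k0.
have c3 := mulr_ge0 (normr_ge0 b) k0.
by split; lra.
Qed.

(** The substitutions [x = y + h] and [x = y - h] both preserve the truncated integral, and their
    average is the symmetric form. *)
Lemma Rint_symmetrize (k v G : 'rV[R]_N -> R) c y e :
  measurable_fun setT k -> (forall h, 0 <= k h) -> (forall h, k (- h) = k h) ->
  measurable_fun setT v -> L1 G ->
  (forall h, e <= enorm h ->
    (`|c| + (`|v (1 *: h + y)| + `|v (- 1 *: h + y)|) / 2) * k h <= G h) ->
  I (fun x => if e <= enorm (y - x) then (c - v x) * k (y - x) else 0) =
  I (fun h => if e <= enorm h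
              then (c - (v (1 *: h + y) + v (- 1 *: h + y)) / 2) * k h else 0).
Proof.
move=> mk k0 kN mv IG HG.
set vp := fun h => v (1 *: h + y); set vm := fun h => v (- 1 *: h + y).
have mvp : measurable_fun setT vp by exact: measurable_affine_comp.
have mvm : measurable_fun setT vm by exact: measurable_affine_comp.
set Phi := fun x => _.
pose Ap h := if e <= enorm h then (c - vp h) * k h else 0.
pose Am h := if e <= enorm h then (c - vm h) * k h else 0.
have ApE : Ap = fun h => Phi (1 *: h + y).
  apply/funext => h; rewrite /Ap /Phi /vp scale1r (_ : y - (h + y) = - h) ?enormN ?kN//.
  by rewrite opprD addrCA subrr addr0.
have AmE : Am = fun h => Phi (- 1 *: h + y).
  apply/funext => h; rewrite /Am /Phi /vm scaleN1r (_ : y - (- h + y) = h)//.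
  by rewrite opprD opprK addrCA subrr addr0.
have mAp : measurable_fun setT Ap.
  by apply: measurable_far_part; apply: measurable_funM => //; exact: measurable_funB.
have mAm : measurable_fun setT Am.
  by apply: measurable_far_part; apply: measurable_funM => //; exact: measurable_funB.
have mPhi : measurable_fun setT Phi.
  rewrite (_ : Phi = fun x => Am (- 1 *: x + y)); first exact: measurable_affine_comp.
  by apply/funext => x; rewrite AmE /= scalerDr !scaleN1r opprK addrNK.
have I2 : L1 (fun h => 2 * `|G h|) by apply: L1Z; exact: (integrable_abse IG).
have dom h : e <= enorm h -> `|(c - vp h) * k h| <= 2 * `|G h| /\ `|(c - vm h) * k h| <= 2 * `|G h|.
  by move=> eh; apply: half_dominated => //; apply: le_trans (HG h eh) (ler_norm _).
have IAp : L1 Ap.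
  apply: (L1_le mAp I2) => h; rewrite /Ap; case: ifPn => eh; first by have [] := dom h eh.
  by rewrite normr0 mulr_ge0.
have IAm : L1 Am.
  apply: (L1_le mAm I2) => h; rewrite /Am; case: ifPn => eh; first by have [] := dom h eh.
  by rewrite normr0 mulr_ge0.
rewrite [RHS](_ : _ = I (fun h => 2^-1 * (Ap h + Am h))); last first.
  congr (Rintegral _ _ _); apply/funext => h; rewrite /Ap /Am /vp /vm; case: ifPn => _; first by field.
  by rewrite addr0 mulr0.
rewrite (RintZ _ (L1D IAp IAm)) (RintD IAp IAm) ApE AmE !Rint_affine ?normrN ?normr1//.
by field.
Qed.

(** The Borel version [E] of the second difference is of order [|h|^2] near 0 and controlled by the
    weight far away, so the truncated integrals converge by dominated convergence. The value
    [E 0 = 0] matters later: [pw p] is 0 at the origin by convention while [tkernel] is not, so the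
    domination by [tkernel_le] fails there. *)
Lemma fracLaplacianE (C R0 : R) u y : C2_on (exterior R0) u -> weighted_L1 s u -> exterior R0 y ->
  exists (E : 'rV[R]_N -> R) (Z : set 'rV[R]_N),
  [/\ measurable Z, ell Z = 0%E, measurable_fun setT E /\ E 0 = 0, forall h, ~ Z h -> E h = diff2 u y h &
    L1 (fun h => E h * pw p h) /\ fracLaplacian C s u y = C * I (fun h => E h * pw p h)].
Proof.
move=> C2 [/borel_version[v [Z [mv mZ Z0 vu]]] wL1] ey.
have [r' [K [r'0 K0 HK]]] := diff2_C2 C2 ey.
pose r := Num.min r' 1.
have r0 : 0 < r by rewrite lt_min r'0 ltr01.
have r1 : r <= 1 by rewrite ge_min lexx orbT.
have rr : r <= r' by rewrite ge_min lexx.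
have [mZ1 Z10] := affine_null y (oner_neq0 R) mZ Z0.
have n10 : - 1 != 0 :> R by rewrite oppr_eq0 oner_neq0.
have [mZ2 Z20] := affine_null y n10 mZ Z0.
set Z1 := _ @^-1` Z in mZ1 Z10; set Z2 := _ @^-1` Z in mZ2 Z20.
have mZ' : measurable (Z1 `|` Z2) by exact: measurableU.
have Z'0 : ell (Z1 `|` Z2) = 0%E.
  by apply/(negligibleP _ mZ'); apply: negligibleU; apply/negligibleP.
pose vp h := v (1 *: h + y); pose vm h := v (- 1 *: h + y).
have mvp : measurable_fun setT vp by exact: measurable_affine_comp.
have mvm : measurable_fun setT vm by exact: measurable_affine_comp.
have vpE h : ~ (Z1 `|` Z2) h -> vp h = u (y + h).
  by move=> nZ; rewrite /vp vu ?scale1r ?[h + y]addrC// => zz; apply: nZ; left; rewrite /Z1/= scale1r addrC.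
have vmE h : ~ (Z1 `|` Z2) h -> vm h = u (y - h).
  by move=> nZ; rewrite /vm vu ?scaleN1r ?[- h + y]addrC// => zz; apply: nZ; right; rewrite /Z2/= scaleN1r addrC.
pose E := (fun h => u y - (vp h + vm h) / 2) \_ (~` (Z1 `|` Z2)).
have EE h : ~ (Z1 `|` Z2) h -> E h = diff2 u y h.
  by move=> nZ; rewrite /E patchE mem_set// /diff2 vpE// vmE.
have mE : measurable_fun setT E.
  apply/(measurable_restrictT _ (measurableC mZ')); apply: measurable_funTS.
  apply: measurable_funB => //; apply: measurable_funM => //.
  exact: measurable_funD.
have E00 : E 0 = 0.
  have [/EE->|/contrapT z0] := pselect (~ (Z1 `|` Z2) 0).
    by rewrite /diff2 subr0 addr0; field.
  by rewrite /E patchE ifF//; apply/negbTE; rewrite in_setC negbK inE.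
exists E, (Z1 `|` Z2); split => //.
have mk : measurable_fun setT (pw p : 'rV[R]_N -> R) by exact: measurable_pw.
pose w x := `|v x| / (1 + enorm x `^ p).
have mw : measurable_fun setT w.
  apply: measurable_funM; first exact: measurableT_comp.
  apply: measurable_invr_comp; apply: measurable_funD => //.
  exact: (measurableT_comp (measurable_powR _) measurable_enorm).
have d0 x : 0 < 1 + enorm x `^ p by rewrite ltr_wpDr// powR_ge0.
have w0 x : 0 <= w x by rewrite divr_ge0// ltW.
have Iw : L1 w.
  apply: L1_ge0 => //.
  rewrite (@integral_off_null _ _ _ ell Z setT _ (fun x => (`|u x| / (1 + enorm x `^ p))%:E))//.
  by move=> x /vu; rewrite /w => ->.
pose G e h := (`|u y| * e ^- 2) * (sqmin h * pw p h) +
   ((e `^ (- p) + (enorm y / e + 1) `^ p) / 2) * (w (1 *: h + y) + w (- 1 *: h + y)).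
have IG e : L1 (G e).
  apply: L1D; apply: L1Z; first exact: sqmin_kernel_L1.
  by apply: L1D; apply: L1_affine => //; rewrite ?normrN normr1.
have far e h : 0 < e -> e <= 1 -> e <= enorm h ->
    (`|u y| + (`|vp h| + `|vm h|) / 2) * pw p h <= G e h.
  move=> e0 e1 eh; rewrite mulrDl; apply: lerD.
    by rewrite -mulrA ler_wpM2l// mulrA ler_peMl ?pw_ge0// sqmin_far.
  apply: ler_half_sum.
    apply: ler_scaled_div; first exact: normr_ge0.
    by rewrite scale1r (addrC h); exact: pw_far.
  apply: ler_scaled_div; first exact: normr_ge0.
  by rewrite scaleN1r (addrC (- h)) -pwN; apply: pw_far; rewrite ?enormN.
have G0 e h : 0 < e -> 0 <= G e h.
  move=> e0; apply: addr_ge0; apply: mulr_ge0.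
  - by rewrite mulr_ge0// invr_ge0 exprn_ge0// ltW.
  - by rewrite mulr_ge0 ?sqmin_ge0 ?pw_ge0.
  - by rewrite divr_ge0// addr_ge0 ?powR_ge0.
  - exact: addr_ge0.
have E_le h : `|E h| <= `|u y| + (`|vp h| + `|vm h|) / 2.
  rewrite /E patchE; case: ifPn => _.
    rewrite (le_trans (ler_normB _ _))// lerD2l normrM [`|2^-1|]ger0_norm// ler_pM2r ?invr_gt0//.
    exact: ler_normD.
  by rewrite normr0 addr_ge0// divr_ge0// addr_ge0.
have E_near h : enorm h <= r -> `|E h| <= K * sqmin h.
  move=> hr; have -> : sqmin h = enorm h ^+ 2.
    by rewrite /sqmin -enorm_sq min_r// expr_le1 ?enorm_ge0// (le_trans hr r1).
  have [/EE->|] := pselect (~ (Z1 `|` Z2) h); first by apply: HK; exact: le_trans rr.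
  move=> /contrapT zh; rewrite /E patchE ifF; last by apply/negbTE; rewrite in_setC negbK inE.
  by rewrite normr0 mulr_ge0// exprn_ge0// enorm_ge0.
have mEk : measurable_fun setT (fun h => E h * pw p h) by exact: measurable_funM.
have IE : L1 (fun h => E h * pw p h).
  apply: (@L1_le _ _ R ell _ (fun h => K * (sqmin h * pw p h) + G r h)) => //.
    by apply: L1D; [apply: L1Z; exact: sqmin_kernel_L1|exact: IG].
  move=> h; rewrite normrM [`|pw p h|]ger0_norm ?pw_ge0//.
  have [hr|rh] := leP (enorm h) r.
    have H : `|E h| * pw p h <= K * (sqmin h * pw p h).
      by rewrite mulrA ler_wpM2r ?pw_ge0// E_near.
    by apply: (le_trans H); rewrite lerDl G0.
  have H : `|E h| * pw p h <= G r h.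
    apply: le_trans (far r h r0 r1 (ltW rh)).
    by rewrite ler_wpM2r ?pw_ge0.
  by apply: (le_trans H); rewrite lerDr mulr_ge0// mulr_ge0 ?sqmin_ge0 ?pw_ge0.
split => //.
pose J e h := if e <= enorm h then E h * pw p h else 0.
have mJ e : measurable_fun setT (J e).
  exact: measurable_far_part.
have truncated e : 0 < e ->
    Rintegral ell [set x | e <= enorm (y - x)]
      (fun x => (u y - u x) / enorm (y - x) `^ p) = I (J e).
  (* [sqmin_far] wants a radius at most 1; passing to a smaller radius only enlarges the region
     where the domination holds. *)
  move=> e0; pose e' := Num.min e 1.
  have e'0 : 0 < e' by rewrite lt_min e0 ltr01.
  have e'1 : e' <= 1 by rewrite ge_min lexx orbT.
  have ee' : e' <= e by rewrite ge_min lexx.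
  transitivity (I (fun x => if e <= enorm (y - x) then (u y - v x) * pw p (y - x) else 0)).
    rewrite /Rintegral; congr fine; rewrite integral_mkcond.
    apply: (@integral_off_null _ _ _ ell Z setT _ _ mZ Z0) => x /vu vx; rewrite patchE vx.
    case: ifPn => [|]; rewrite ?notin_setE ?inE/= => h; first by rewrite h /pw powRN.
    by rewrite ifF; [exact: erefl|apply/negP].
  rewrite (Rint_symmetrize mk (pw_ge0 p) (pwN p) mv (IG e') (fun h eh => far e' h e'0 e'1 (le_trans ee' eh))).
  apply: (@Rint_off_null _ _ R ell (Z1 `|` Z2) _ (J e) mZ' Z'0) => h nZ; rewrite /J; case: ifPn => _; last exact: erefl.
  by congr (_ * _); rewrite /E patchE mem_set.
rewrite /fracLaplacian; congr (_ * _); apply: cvg_lim => //.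
apply/cvg_at_rightP => e_ [e_gt0 e_cvg].
rewrite (_ : (fun k => _) = (fun k => I (J (e_ k)))); last first.
  by apply/funext => k; rewrite truncated.
apply: (@Rint_dominated _ _ R ell _ _ (fun h => `|E h * pw p h|)) => //.
- exact: (integrable_abse IE).
- by move=> k h; rewrite /J; case: ifP => // _; rewrite normr0.
(* For [h != 0] the truncated integrand is eventually constant; at [h = 0] both sides are 0, as
   [pw p] vanishes there by convention. *)
move=> h; have [->|h0] := eqVneq h 0.
  apply: cvg_near_cst; apply: nearW => k.
  rewrite /J enorm0 leNgt e_gt0/= /pw enorm0 powR0 ?mulr0//.
  by rewrite oppr_eq0 (gt_eqF p0).
apply: cvg_near_cst; rewrite -enorm_gt0 in h0.
have H := cvgr_lt _ e_cvg _ h0.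
near=> k; rewrite /J ltW//; near: k; exact: H.
Unshelve. all: by end_near. Qed.

End principal_value.

(** * Upper bounds for the fractional Laplacian of a touched function *)

Section fracLaplacian_bounds.
Context {R : realType} (n : nat) (s : R) (hs : 1 / 2 < s < 1) (hN : 2 * s < n.+1%:R).
Local Notation N := n.+1.
Local Notation ell := (@lebesgue_rV R N).
Local Notation L1 f := (ell.-integrable setT (EFin \o f)).
Local Notation I f := (Rintegral ell setT f).
Local Notation p := (N%:R + 2 * s).
Local Notation sigma := (N%:R - 2 * s).
Implicit Types (u g W : 'rV[R]_N -> R) (y h : 'rV[R]_N) (c e k A B C : R).

Let hs01 : 0 < s < 1. Proof. by have := hs; lra. Qed.
Let p0 : 0 < p. Proof. by case/andP: hs01 => s0 _; rewrite ltr_wpDl// mulr_gt0. Qed.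
Let mixp0 : 0 < mix p. Proof. exact: mix_gt0. Qed.

Lemma fracLaplacian_le C (R0 : R) u y g : 0 <= C -> C2_on (exterior R0) u -> weighted_L1 s u ->
  exterior R0 y -> L1 (fun h => g h * pw p h) -> (forall h, diff2 u y h <= g h) ->
  fracLaplacian C s u y <= C * I (fun h => g h * pw p h).
Proof.
move=> C0 C2 wL ey Ig ug.
have [E [Z [mZ Z0 _ EE [IE ->]]]] := fracLaplacianE hs01 C C2 wL ey.
apply: (ler_wpM2l C0); apply: (Rint_le_off_null mZ Z0 IE Ig) => h nZ.
by rewrite (EE h nZ); exact: (ler_wpM2r (pw_ge0 _ _) (ug h)).
Qed.

Lemma tkernelN e h : tkernel s e (- h) = tkernel s e h.
Proof.
rewrite /tkernel; congr fine; apply: eq_integral => t _.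
by rewrite /heat -(enorm_sq (- h)) enormN enorm_sq.
Qed.

Let diff2_algebra (V P Q T : R) : (V - (P + Q) / 2) * T = V * T + (- 2^-1) * (T * P + T * Q).
Proof. by field. Qed.

Let gap_algebra (V K T : R) : V * K + (- 2^-1) * (T + T) = K * V - T.
Proof. by field. Qed.

Lemma Rint_diff2_tkernel k e y : 0 <= k <= 1 / 2 -> 0 < e -> y != 0 ->
  L1 (fun h => diff2 (pw (sigma + 2 * k)) y h * tkernel s e h) /\
  I (fun h => diff2 (pw (sigma + 2 * k)) y h * tkernel s e h) = power_gap s k e y.
Proof.
move=> hk e0 y0; set a := sigma + 2 * k.
pose F h := tkernel s e h * pw a (y + h).
have mF : measurable_fun setT F by exact: measurable_tkernel_pw.
have F0 h : 0 <= F h by exact: mulr_ge0 (tkernel_ge0 _ _ _) (pw_ge0 _ _).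
have [IF EF] := Rint_ge0E mF F0 (tkernel_convE hs hN hk e0 y0).
have n1 : `|- 1| = 1 :> R by rewrite normrN1.
have IF' := @L1_affine R N F (- 1) 0 n1 IF; have EF' := @Rint_affine R N F (- 1) 0 n1 mF.
have [Ik Ek] := @Rint_ge0E _ _ R ell _ _ (measurable_tkernel s e) (tkernel_ge0 s e) (integral_tkernel hs01 e0).
have E : (fun h => diff2 (pw a) y h * tkernel s e h) =
    (fun h => pw a y * tkernel s e h + (- 2^-1) * (F h + F (- 1 *: h + 0))).
  by apply/funext => h; rewrite /diff2 /F addr0 scaleN1r tkernelN; exact: diff2_algebra.
have I1 := L1Z (pw a y) Ik; have I2 := L1D IF IF'; have I3 := L1Z (- 2^-1) I2.
rewrite E; split; first exact: (L1D I1 I3).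
rewrite (RintD I1 I3) (RintZ _ Ik) (RintZ _ I2) (RintD IF IF') EF' EF Ek /power_gap.
exact: gap_algebra.
Qed.

(** Along [e = 1/(m+1)], [tkernel s e] tends to [mix p |h|^-p] and is dominated by it, whence the
    factor [C / mix p]. Only the left-hand side needs this limit: the powers enter through their
    gaps, whose error [A e^(1-s)] tends to 0. *)
Lemma fracLaplacian_le_pow C (R0 : R) u y k1 k2 k3 c1 c2 c3 A B :
  0 <= C -> C2_on (exterior R0) u -> weighted_L1 s u -> exterior R0 y -> y != 0 ->
  0 <= k1 <= 1 / 2 -> 0 <= k2 <= 1 / 2 -> 0 <= k3 <= 1 / 2 ->
  (forall h, diff2 u y h <= c1 * diff2 (pw (sigma + 2 * k1)) y h +
     c2 * diff2 (pw (sigma + 2 * k2)) y h + c3 * diff2 (pw (sigma + 2 * k3)) y h) ->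
  (forall e, 0 < e <= 1 -> c1 * power_gap s k1 e y + c2 * power_gap s k2 e y +
     c3 * power_gap s k3 e y <= B + A * e `^ (1 - s)) ->
  fracLaplacian C s u y <= C / mix p * B.
Proof.
move=> C0 C2 wL ey y0 hk1 hk2 hk3 uW gapB.
have [E [Z [mZ Z0 [mE E0] EE [IE ->]]]] := fracLaplacianE hs01 C C2 wL ey.
rewrite -mulrA; apply: (ler_wpM2l C0); rewrite [leRHS]mulrC ler_pdivlMr//.
pose em m : R := m.+1%:R^-1.
have em0 m : 0 < em m by rewrite invr_gt0.
have em1 m : em m <= 1 by rewrite invf_le1// ler1n.
have cv1 : I (fun h => E h * tkernel s (em m) h) @[m --> \oo] --> I (fun h => mix p * (E h * pw p h)).
  apply: (@Rint_dominated _ _ R ell _ _ (fun h => mix p * `|E h * pw p h|)).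
  - by move=> m; apply: measurable_funM => //; exact: measurable_tkernel.
  - by apply: measurable_funM => //; exact: (L1_measurable IE).
  - by apply: L1Z; exact: (integrable_abse IE).
  - move=> m h; have [->|h0] := eqVneq h 0.
      by rewrite E0 !mul0r normr0 mulr0.
    rewrite !normrM mulrCA ler_wpM2l// ger0_norm ?tkernel_ge0// ger0_norm ?pw_ge0//.
    exact: tkernel_le.
  - move=> h; have [->|h0] := eqVneq h 0.
      rewrite E0 mul0r mulr0; apply: cvg_near_cst; apply: nearW => m; by rewrite mul0r.
    rewrite mulrCA; apply: cvgM; [exact: cvg_cst|exact: tkernel_cvg].
have cv2 : B + A * (em m) `^ (1 - s) @[m --> \oo] --> B + A * 0.
  apply: cvgD; first exact: cvg_cst.
  apply: cvgM; first exact: cvg_cst.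
  have s1 : 0 < 1 - s by case/andP: hs01; rewrite subr_gt0.
  apply: ((cvg_at_rightP _ _ _).1 (powR_cvg0 s1) em); split; [exact: em0|exact: cvg_harmonic].
rewrite [leLHS]mulrC -(RintZ _ IE).
rewrite -[B]addr0 -(mulr0 A).
apply: (ler_cvg_to cv1 cv2); apply: nearW => m.
have [J1 E1] := Rint_diff2_tkernel hk1 (em0 m) y0.
have [J2 E2] := Rint_diff2_tkernel hk2 (em0 m) y0.
have [J3 E3] := Rint_diff2_tkernel hk3 (em0 m) y0.
have H : 0 < em m <= 1 by rewrite em0 em1.
apply: le_trans (gapB (em m) H); rewrite -E1 -E2 -E3.
have K1 := L1Z c1 J1; have K2 := L1Z c2 J2; have K3 := L1Z c3 J3.
have K12 := L1D K1 K2.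
rewrite -(RintZ _ J1) -(RintZ _ J2) -(RintZ _ J3) -(RintD K1 K2) -(RintD K12 K3).
have IEt : L1 (fun h => E h * tkernel s (em m) h).
  apply: (@L1_le _ _ R ell _ (fun h => mix p * `|E h * pw p h|)).
  - by apply: measurable_funM => //; exact: measurable_tkernel.
  - by apply: L1Z; exact: (integrable_abse IE).
  - move=> h; have [->|h0] := eqVneq h 0.
      by rewrite E0 !mul0r normr0 mulr0.
    rewrite !normrM mulrCA ler_wpM2l// ger0_norm ?tkernel_ge0// ger0_norm ?pw_ge0//.
    exact: tkernel_le.
apply: (Rint_le_off_null mZ Z0 IEt (L1D K12 K3)) => h nZ.
rewrite (EE h nZ) !mulrA -!mulrDl; exact: (ler_wpM2r (tkernel_ge0 _ _ _) (uW h)).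
Qed.

End fracLaplacian_bounds.

(** * Touching from below *)

Section contact.
Context {R : realType} {N : nat}.
Implicit Types (u W : 'rV[R]_N -> R) (x y h v : 'rV[R]_N) (a t r L : R).

Lemma enorm_continuous : continuous (@enorm R N).
Proof.
move=> x; have Fx : Filter (nbhs x) by exact: nbhs_filter.
apply/(@cvgrPdist_le _ _ _ (nbhs x) Fx) => e e0; apply/nbhs_ballP.
exists (e / N.+1%:R) => /=; first by rewrite divr_gt0.
move=> y [_ xy].
have H : enorm (x - y) <= e.
  apply: le_trans (enorm_le_sum _) _.
  apply: (@le_trans _ _ (\sum_(i < N) e / N.+1%:R)).
    by apply: ler_sum => i _; rewrite !mxE; exact: ltW (xy ord0 i).
  rewrite sumr_const card_ord -[leLHS]mulr_natr mulrAC ler_pdivrMr//.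
  by rewrite ler_pM2l// ler_nat.
rewrite ler_norml; apply/andP; split.
  have := enormD x (y - x); rewrite -[enorm (y - x)]enormN opprB addrC subrK; lra.
by have := enormD (x - y) y; rewrite subrK; lra.
Qed.

Lemma pw_continuous a x : x != 0 -> {for x, continuous (pw a)}.
Proof.
move=> x0; apply: (@continuous_comp _ _ _ (@enorm R N) (fun z => z `^ (- a))).
  exact: enorm_continuous.
by apply: powR_continuous; rewrite enorm_gt0.
Qed.

Lemma annulus_compact (a b : R) : compact [set x : 'rV[R]_N | a <= enorm x <= b].
Proof.
have cl : closed [set x : 'rV[R]_N | a <= enorm x <= b].
  rewrite (_ : [set _ | _] = @enorm R N @^-1` `[a, b]%classic).
    by apply: (continuous_closedP _).1; [exact: enorm_continuous|exact: itv_closed].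
  by apply/seteqP; split=> x /=; rewrite in_itv.
have co : compact [set x : 'rV[R]_N | forall i, x ord0 i \in `[- b, b]].
  by apply: (@rV_compact _ _ (fun=> `[(- b), b]%classic)) => _; exact: segment_compact.
apply: subclosed_compact cl co _ => x /= /andP[_ xb] i.
by rewrite in_itv/= -ler_norml (le_trans (ler_enorm i x)).
Qed.

(** The contact point maximises [W / u] on [K] and [t] is the inverse of the maximum, at most 1
    because [u x0 <= W x0]. Since [t <= 1], the scaled function also stays below [u] off [K]. *)
Lemma touch (K : set 'rV[R]_N) u W x0 : compact K -> (forall x, 0 < u x) ->
  (forall x, K x -> {for x, continuous u} /\ {for x, continuous W}) ->
  (forall x, ~ K x -> W x < u x) -> u x0 <= W x0 ->
  exists t y, [/\ 0 < t <= 1, K y, t * W y = u y & forall x, t * W x <= u x].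
Proof.
move=> cK u0 cuW offK h0.
have Kx0 : K x0 by apply: contrapT => /offK; rewrite ltNge h0.
have [] := @compact_EVT_max _ R (fun x => W x / u x) K _ cK _.
- by exists x0.
- apply: continuous_in_subspaceT => x /set_mem /cuW[cu cW].
  exact: (cvgM cW (cvgV (lt0r_neq0 (u0 x)) cu)).
move=> y /set_mem Ky ymax; have uy := u0 y.
have M1 : 1 <= W y / u y.
  apply: le_trans (ymax x0 (mem_set Kx0)).
  by rewrite ler_pdivlMr ?u0// mul1r.
have M0 : 0 < W y / u y by exact: lt_le_trans M1.
have Wy : 0 < W y by move: M0; rewrite pmulr_lgt0// invr_gt0.
have t1 : (W y / u y)^-1 <= 1 by rewrite invf_le1.
exists (W y / u y)^-1, y; split => //.
- by rewrite invr_gt0 M0 t1.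
- by rewrite invf_div mulrAC -mulrA divff ?mulr1// gt_eqF.
- move=> x; have [Kx|Kx] := pselect (K x).
    rewrite mulrC ler_pdivrMr// mulrC.
    by have := ymax x (mem_set Kx); rewrite ler_pdivrMr ?u0// mulrC.
  have [W0|W0] := leP (W x) 0.
    by rewrite (@le_trans _ _ 0)// ?(ltW (u0 x))// mulr_ge0_le0// invr_ge0 ltW.
  rewrite (@le_trans _ _ (W x))// ?(ltW (offK x Kx))// ler_piMl//; exact: ltW.
Qed.

(** Difference quotients with positive increments bound the derivative from below, those with
    negative increments from above. *)
Lemma derive_le u y v L r : derivable u y v -> 0 < r ->
  (forall e, `|e| < r -> u y - L * `|e| <= u (e *: v + y)) -> `|'D_v u y| <= L.
Proof.
move=> du r0 H; apply/ler_addgt0Pr => e e0.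
have /cvgrPdist_lt/(_ e e0) := du.
rewrite near_withinE => /nbhs_ballP[d /= d0 Hd].
pose c := Num.min d r / 2.
have m0 : 0 < Num.min d r by rewrite lt_min d0.
have c0 : 0 < c by rewrite divr_gt0.
have cm : c < Num.min d r by rewrite /c; lra.
have cd : c < d by apply: lt_le_trans cm _; rewrite ge_min lexx.
have cr : c < r by apply: lt_le_trans cm _; rewrite ge_min lexx orbT.
have P := Hd c; have M := Hd (- c).
rewrite /ball/= !sub0r !normrN gtr0_norm// in P M.
have {}P := P cd (lt0r_neq0 c0); have {}M := M cd _.
have {}M := M (_ : - c != 0); rewrite oppr_eq0 gt_eqF// in M; have {}M := M isT.
have HP := H c; have HM := H (- c); rewrite normrN gtr0_norm// in HP HM.
have {}HP := HP cr; have {}HM := HM cr.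
have qP : - L <= c^-1 *: (u (c *: v + y) - u y).
  by rewrite /GRing.scale/= mulrC ler_pdivlMr//; lra.
have qM : (- c)^-1 *: (u (- c *: v + y) - u y) <= L.
  by rewrite /GRing.scale/= invrN mulNr mulrC lerNl ler_pdivlMr//; lra.
rewrite /derive; move: P M qP qM.
set D := lim _; set q1 := c^-1 *: _; set q2 := (- c)^-1 *: _.
rewrite !ltr_norml ler_norml => /andP[a1 a2] /andP[a3 a4] qP qM.
by apply/andP; split; lra.
Qed.

Lemma grad_le u y L r : (forall i, derivable u y (delta_mx ord0 i)) -> 0 < r ->
  (forall h, enorm h < r -> u y - L * enorm h <= u (y + h)) -> enorm (grad u y) <= N%:R * L.
Proof.
move=> du r0 H; apply: le_trans (enorm_le_sum _) _.
apply: (@le_trans _ _ (\sum_(i < N) L)); last by rewrite sumr_const card_ord mulr_natl.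
apply: ler_sum => i _; rewrite mxE; apply: (derive_le (du i) r0) => e er.
have E : enorm (e *: (delta_mx ord0 i : 'rV[R]_N)) = `|e|.
  rewrite enormZ -[RHS]mulr1; congr (_ * _); apply/eqP.
  rewrite -(@eqrXn2 _ 2)// ?enorm_ge0// enorm_sq /sqnorm (bigD1 i)//= big1.
    by rewrite mxE !eqxx/= expr1n addr0.
  by move=> j /negbTE ji; rewrite mxE ji/= expr0n.
by have := H (e *: delta_mx ord0 i); rewrite E [y + _]addrC => /(_ er).
Qed.

Let powRN_tangent a (z : R) : 0 <= a -> 0 < z -> 1 - a * (z - 1) <= z `^ (- a).
Proof.
move=> a0 z0; rewrite /powR gt_eqF//.
apply: le_trans (expR_ge1Dx _).
have : ln z <= z - 1.
  have := @le_ln1Dx R (z - 1); rewrite addrCA subrr addr0; apply.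
  by rewrite ltrBrDr addNr.
move/(ler_wpM2l a0); lra.
Qed.

Let pw_scale a y h : y != 0 -> pw a (y + h) = pw a y * (enorm (y + h) / enorm y) `^ (- a).
Proof.
move=> y0; rewrite /pw -powRM ?enorm_ge0 ?divr_ge0 ?enorm_ge0//.
by rewrite mulrCA divff ?mulr1// gt_eqF// enorm_gt0.
Qed.

Lemma pw_lower a y h : 0 <= a -> y != 0 -> y + h != 0 ->
  pw a y - a * pw (a + 1) y * enorm h <= pw a (y + h).
Proof.
move=> a0 y0 yh0; rewrite (pw_scale a h y0).
have ny : 0 < enorm y by rewrite enorm_gt0.
have z0 : 0 < enorm (y + h) / enorm y by rewrite divr_gt0// enorm_gt0.
have E1 : pw (a + 1) y = pw a y / enorm y.
  by rewrite /pw opprD powRD_gt0// powR_inv1// ltW.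
rewrite E1 -(mulrA a) (_ : _ - _ = pw a y * (1 - a * (enorm h / enorm y))); last by ring.
rewrite ler_wpM2l ?pw_ge0//; apply: le_trans (powRN_tangent a0 z0).
rewrite lerD2l lerN2 ler_wpM2l// lerBlDr ler_pdivrMr// mulrDl mul1r divfK ?gt_eqF//.
by rewrite addrC enormD.
Qed.

(** The tangent inequality at [1/z] gives [z^-a <= 1 + a z^(-a-1) (1-z)], and [z >= 1/2] bounds
    [z^(-a-1)] by [2^(a+1)]. *)
Lemma pw_upper a y h : 0 <= a -> y != 0 -> enorm h <= enorm y / 2 ->
  pw a (y + h) <= pw a y + a * 2 `^ (a + 1) * pw (a + 1) y * enorm h.
Proof.
move=> a0 y0 hy; rewrite (pw_scale a h y0).
have ny : 0 < enorm y by rewrite enorm_gt0.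
set z := enorm (y + h) / enorm y.
have zh : 1 - enorm h / enorm y <= z.
  by rewrite ler_pdivlMr// mulrBl mul1r divfK ?gt_eqF// enormB_le.
have w0 : 0 <= enorm h / enorm y by rewrite divr_ge0 ?enorm_ge0.
have w2 : enorm h / enorm y <= 1 / 2 by rewrite ler_pdivrMr// mulrC; lra.
have z2 : 2^-1 <= z by lra.
have z0 : 0 < z by lra.
have E1 : pw (a + 1) y = pw a y / enorm y.
  by rewrite /pw opprD powRD_gt0// powR_inv1// ltW.
rewrite E1 (_ : _ + _ = pw a y * (1 + a * 2 `^ (a + 1) * (enorm h / enorm y))); last by ring.
rewrite ler_wpM2l ?pw_ge0//.
have P := powR_ge0 2 (a + 1).
have [z1|z1] := leP 1 z.
  apply: (@le_trans _ _ 1).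
    by rewrite -[leRHS](@powRr0 R z) ler_powR// oppr_le0.
  by rewrite lerDl; exact: (mulr_ge0 (mulr_ge0 a0 P) w0).
have zi : 0 < z^-1 by rewrite invr_gt0.
have := ler_wpM2l (powR_ge0 z (- a)) (powRN_tangent a0 zi).
rewrite -powRM ?invr_ge0 ?(ltW z0)// divff ?gt_eqF// powR1 => T.
have Q : z `^ (- a) * (z^-1 - 1) <= 2 `^ (a + 1) * (enorm h / enorm y).
  rewrite (_ : z^-1 - 1 = z^-1 * (1 - z)); last by rewrite mulrBr mulr1 mulVf// gt_eqF.
  have E : z `^ (- a) * z^-1 = z^-1 `^ (a + 1).
    by rewrite -(powR_inv1 (ltW z0)) -powRrM -powRD_gt0//; congr (_ `^ _); ring.
  rewrite [leLHS]mulrA E; apply: ler_pM; rewrite ?powR_ge0//.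
  - by rewrite subr_ge0 ltW.
  - by rewrite ge0_ler_powR ?nnegrE ?(ltW zi) ?addr_ge0// invf_ple ?posrE.
  - by lra.
have := ler_wpM2l a0 Q; lra.
Qed.

End contact.

(** * Combinations of three powers, and the comparison principle *)

Section power_comparison.
Context {R : realType} {N : nat}.
Implicit Types (u W : 'rV[R]_N -> R) (x y h : 'rV[R]_N) (a b e r t : R).

Lemma pwD a b x : x != 0 -> pw (a + b) x = pw a x * pw b x.
Proof. by move=> x0; rewrite /pw opprD powRD_gt0// enorm_gt0. Qed.

Lemma pw_powR a b x : pw a x `^ b = pw (a * b) x.
Proof. by rewrite /pw -powRrM mulNr. Qed.

Lemma pw_le_radius a r x : 0 <= a -> 0 < r -> r <= enorm x -> pw a x <= r `^ (- a).
Proof.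
move=> a0 r0 rx; have x0 := lt_le_trans r0 rx.
by rewrite /pw !powRN lef_pV2 ?posrE ?powR_gt0// ge0_ler_powR ?nnegrE// ltW.
Qed.

Lemma pw_small a e : 0 < a -> 0 < e -> exists2 r, 1 <= r & forall x, r <= enorm x -> pw a x <= e.
Proof.
move=> a0 e0; exists (Num.max 1 (e `^ (- a^-1))); first by rewrite le_max lexx.
move=> x rx.
have h : e `^ (- a^-1) <= enorm x by apply: le_trans rx; rewrite le_max lexx orbT.
apply: le_trans (pw_le_radius (ltW a0) (powR_gt0 _ e0) h) _.
by rewrite -powRrM mulrNN mulVf ?gt_eqF// powRr1// ltW.
Qed.

Lemma pw_le a b x : 1 <= enorm x -> a <= b -> pw b x <= pw a x.
Proof. by move=> x1 ab; rewrite /pw ler_powR// lerN2. Qed.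

(** The second power supplies the strictly negative fractional Laplacian; the third is subtracted so
    that the barrier is nonpositive on a ball, where it lies below [u] for free. *)
Definition power_profile (a b c a1 a2 a3 : R) x : R :=
  a * pw a1 x + b * pw a2 x - c * pw a3 x.

Lemma power_profile_continuous a b c a1 a2 a3 x : x != 0 ->
  {for x, continuous (power_profile a b c a1 a2 a3)}.
Proof.
move=> x0; have P d := @pw_continuous R N d x x0.
have Q (k d : R) : {for x, continuous (fun z => k * pw d z)}.
  exact: (cvgM (cvg_cst k) (P d)).
exact: (cvgB (cvgD (Q a a1) (Q b a2)) (Q c a3)).
Qed.

Definition profile_slope (a b c a1 a2 a3 : R) x : R :=
  a * (a1 * pw (a1 + 1) x) + b * (a2 * pw (a2 + 1) x) +
  c * (a3 * 2 `^ (a3 + 1) * pw (a3 + 1) x).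

Let slope_algebra (a b c V1 V2 V3 U1 U2 U3 S1 S2 S3 T1 T2 T3 e : R) :
  a * (V1 - S1 * T1 * e) <= a * U1 -> b * (V2 - S2 * T2 * e) <= b * U2 ->
  c * U3 <= c * (V3 + S3 * T3 * e) ->
  a * V1 + b * V2 - c * V3 - (a * (S1 * T1) + b * (S2 * T2) + c * (S3 * T3)) * e <=
  a * U1 + b * U2 - c * U3.
Proof. lra. Qed.

Lemma power_profile_lower a b c a1 a2 a3 y h :
  0 <= a -> 0 <= b -> 0 <= c -> 0 <= a1 -> 0 <= a2 -> 0 <= a3 -> y != 0 ->
  enorm h < enorm y / 2 ->
  power_profile a b c a1 a2 a3 y - profile_slope a b c a1 a2 a3 y * enorm h <=
  power_profile a b c a1 a2 a3 (y + h).
Proof.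
move=> a0 b0 c0 a10 a20 a30 y0 hy.
have ny : 0 < enorm y by rewrite enorm_gt0.
have yh : y + h != 0.
  rewrite -enorm_gt0; apply: lt_le_trans (enormB_le y h).
  by rewrite subr_gt0 (lt_le_trans hy)// ler_pdivrMr// mulr_natr mulr2n lerDl ltW.
have h1 := ler_wpM2l a0 (pw_lower a10 y0 yh).
have h2 := ler_wpM2l b0 (pw_lower a20 y0 yh).
have h3 := ler_wpM2l c0 (pw_upper a30 y0 (ltW hy)).
exact: (slope_algebra h1 h2 h3).
Qed.

(* If [u] does not lie above the profile, lower the profile by [e]: it then
   exceeds [u] only on a compact annulus, and scaling it down makes it touch [u]. *)
Lemma comparison (R0 r : R) u W : (forall x, 0 < u x) -> 0 < R0 -> R0 < r ->
  (forall x, R0 < enorm x -> {for x, continuous u}) ->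
  (forall x, x != 0 -> {for x, continuous W}) ->
  (forall x, enorm x <= r -> W x < u x) ->
  (forall e, 0 < e -> exists r', forall x, r' < enorm x -> W x <= e) ->
  (forall e t y, 0 < e -> 0 < t <= 1 -> r < enorm y -> t * (W y - e) = u y ->
     (forall x, t * (W x - e) <= u x) -> False) ->
  forall x, W x <= u x.
Proof.
move=> u0 R00 Rr cu cW inner decay nocontact.
suff H e : 0 < e -> forall x, W x - e <= u x.
  move=> x; apply/ler_addgt0Pr => e e0; rewrite -lerBlDr; exact: H.
move=> e0; have [r' Hr'] := decay e e0.
move=> x0; rewrite leNgt; apply/negP => h0.
pose K := [set x : 'rV[R]_N | r <= enorm x <= r'].
have r0 : 0 < r by exact: lt_trans Rr.
have [] := @touch R N K u (fun x => W x - e) x0 (@annulus_compact R N r r') u0 _ _ (ltW h0).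
- move=> x /andP[rx _]; split; first exact: cu (lt_le_trans Rr rx).
  have x00 : x != 0 by rewrite -enorm_gt0 (lt_le_trans r0 rx).
  exact: (cvgB (cW x x00) (cvg_cst e)).
- move=> x nK; have [xr|rx] := leP (enorm x) r; first by have := inner x xr; lra.
  have [xr'|r'x] := leP (enorm x) r'; first by case: nK; rewrite /K/= (ltW rx).
  by have := Hr' x r'x; have := u0 x; lra.
move=> t [y [t01 /andP[ry _] Ey Hy]]; apply: (nocontact e t y e0 t01 _ Ey Hy).
(* Contact on the inner sphere is impossible: there [t (W y - e) <= W y - e < u y]. *)
rewrite lt_neqAle ry andbT; apply/eqP => E.
have yr : enorm y <= r by rewrite E.
have yi := inner y yr; have uy := u0 y; have /andP[t0 t1] := t01.
have Wy : 0 < W y - e by move: uy; rewrite -Ey pmulr_rgt0.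
have : t * (W y - e) <= W y - e by rewrite ler_piMl// ltW.
by rewrite Ey; lra.
Qed.

End power_comparison.

(** * Fractional Laplacian below a barrier *)

Section profile_energy.
Context {R : realType} (n : nat) (s : R) (hs : 1 / 2 < s < 1) (hN : 2 * s < n.+1%:R).
Local Notation N := n.+1.
Local Notation p := (N%:R + 2 * s).
Local Notation sigma := (N%:R - 2 * s).

Let gap_algebra (t a b c g1 g2 g3 A1 A2 E P1 P2 P3 P4 c1 c2 k C V1 V2 V3 : R) :
  0 <= t -> 0 <= a -> 0 <= b -> 0 <= c -> 0 <= c1 -> 0 <= V1 ->
  g1 <= - c1 * V1 + A1 * E * (P1 + P2) -> g2 <= - c2 * V2 + A2 * E * (P3 + P4) ->
  - g3 <= k * C * V3 ->
  t * a * g1 + t * b * g2 + - (t * c) * g3 <=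
  t * (- b * c2 * V2 + c * k * C * V3) + (t * a * A1 * (P1 + P2) + t * b * A2 * (P3 + P4)) * E.
Proof.
move=> t0 a0 b0 c0 c10 V10 h1 h2 h3.
have H1 := ler_wpM2l (mulr_ge0 t0 a0) h1; have H2 := ler_wpM2l (mulr_ge0 t0 b0) h2.
have H3 := ler_wpM2l (mulr_ge0 t0 c0) h3.
have H4 := mulr_ge0 (mulr_ge0 t0 a0) (mulr_ge0 c10 V10).
lra.
Qed.

Let diff2_algebra (t a b c V1 V2 V3 U1 U2 U3 W1 W2 W3 : R) :
  t * (a * V1 + b * V2 - c * V3 - (a * U1 + b * U2 - c * U3 + (a * W1 + b * W2 - c * W3)) / 2) =
  t * a * (V1 - (U1 + W1) / 2) + t * b * (V2 - (U2 + W2) / 2) + - (t * c) * (V3 - (U3 + W3) / 2).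
Proof. by field. Qed.

(** The order of quantifiers matters: [D] precedes both exponents, so [improved_lower_bound] may
    choose [k'] after [D], whereas the gain [d] depends on [k]. The contribution of the first power
    is nonpositive in the limit and is dropped. *)
Lemma fracLaplacian_profile : exists2 D, 0 <= D & forall k, 0 <= k <= 1 / 2 ->
  exists2 d, (0 <= d /\ (0 < k -> 0 < d)) &
  forall k' (C R0 a b c t : R) (u : 'rV[R]_N -> R) y,
  0 <= k' <= 1 / 2 -> 0 <= C -> 0 <= a -> 0 <= b -> 0 <= c -> 0 <= t ->
  C2_on (exterior R0) u -> weighted_L1 s u -> exterior R0 y -> y != 0 ->
  (forall h, diff2 u y h <=
     t * diff2 (power_profile a b c sigma (sigma + 2 * k) (sigma + 2 * k')) y h) ->
  fracLaplacian C s u y <=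
    C / mix p * (t * (- b * d * pw (N%:R + 2 * k) y + c * k' * D * pw (N%:R + 2 * k') y)).
Proof.
have [D D0 HD] := power_gap_ge hs hN; exists D => // k hk.
have k00 : 0 <= (0 : R) <= 1 / 2 by rewrite lexx/= divr_ge0.
have [c1 [A1 [c10 _ _ H1]]] := power_gap_le hs hN k00.
have [d [A2 [d0 dp _ H2]]] := power_gap_le hs hN hk.
exists d => // k' C R0 a b c t u y hk' C0 a0 b0 c0 t0 C2 wL ey y0 uW.
apply: (@fracLaplacian_le_pow R n s hs hN C R0 u y 0 k k' (t * a) (t * b) (- (t * c))
  (t * a * A1 * (pw (sigma + 2 * 0 + 2) y + pw (N%:R + 2 * 0 + 2) y) +
   t * b * A2 * (pw (sigma + 2 * k + 2) y + pw (N%:R + 2 * k + 2) y))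
  _ C0 C2 wL ey y0 k00 hk hk').
- move=> h; apply: (le_trans (uW h)); rewrite mulr0 addr0.
  rewrite le_eqVlt; apply/orP; left; apply/eqP; exact: diff2_algebra.
- move=> e e01; have /andP[e0 _] := e01.
  exact: (gap_algebra t0 a0 b0 c0 c10 (pw_ge0 _ _) (H1 e y e01 y0) (H2 e y e01 y0) (HD k' e y hk' e0 y0)).
Qed.

End profile_energy.

Lemma positive_lower_bound {R : realType} {N : nat} (u : 'rV[R]_N -> R) (K : set 'rV[R]_N) :
  compact K -> (forall x, 0 < u x) -> (forall x, K x -> {for x, continuous u}) ->
  exists2 m, 0 < m & forall x, K x -> m <= u x.
Proof.
move=> cK u0 cu; have [[x0 Kx0]|K0] := pselect (K !=set0); last first.
  by exists 1 => // x Kx; exfalso; apply: K0; exists x.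
have [] := @compact_EVT_min _ R u K _ cK _.
- by exists x0.
- by apply: continuous_in_subspaceT => x /set_mem; exact: cu.
by move=> y _ ymin; exists (u y) => // x Kx; apply: ymin; exact: mem_set.
Qed.

(** * The supersolution inequality at a contact point *)

Section supersolution.
Context {R : realType} (n : nat) (s : R) (hs : 1 / 2 < s < 1) (hN : 2 * s < n.+1%:R).
Local Notation N := n.+1.
Local Notation p := (N%:R + 2 * s).
Local Notation sigma := (N%:R - 2 * s).
Context (C q lambda R0 : R) (f : R -> R) (u : 'rV[R]_N -> R).
Context (C0 : 0 < C) (R00 : 0 < R0) (hu : classical_supersolution C s q lambda R0 f u) (q0 : 0 <= q).

Let sigma0 : 0 < sigma. Proof. by rewrite subr_gt0. Qed.

Lemma supersolution_continuous x : R0 < enorm x -> {for x, continuous u}.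
Proof. by case: hu => C2 _ _ /(C2 x)[]. Qed.

Let sub_algebra (t a b c e : R) :
  t * (a - e) - (t * (b - e) + t * (c - e)) / 2 = t * (a - (b + c) / 2).
Proof. by field. Qed.

Let grad_algebra (t a b h c e : R) : 0 <= t -> a - b * h <= c ->
  t * (a - e) - t * b * h <= t * (c - e).
Proof. by move=> t0 /(ler_wpM2l t0); lra. Qed.

(** At the contact point the second differences of [u] are at most those of the barrier, and the
    slope of the barrier bounds the gradient of [u]. The vertical shift [e] cancels from both. *)
Lemma contact_inequality : exists2 D, 0 <= D & forall k, 0 <= k <= 1 / 2 ->
  exists2 d, 0 <= d /\ (0 < k -> 0 < d) &
  forall k' (a b c e t : R) y, 0 <= k' <= 1 / 2 -> 0 <= a -> 0 <= b -> 0 <= c ->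
  0 < t -> R0 < enorm y ->
  let W := power_profile a b c sigma (sigma + 2 * k) (sigma + 2 * k') in
  t * (W y - e) = u y -> (forall x, t * (W x - e) <= u x) ->
  lambda * f (u y) <=
    C / mix p * (t * (- b * d * pw (N%:R + 2 * k) y + c * k' * D * pw (N%:R + 2 * k') y)) +
    (N%:R * (t * profile_slope a b c sigma (sigma + 2 * k) (sigma + 2 * k') y)) `^ q.
Proof.
have [D D0 HD] := fracLaplacian_profile hs hN; exists D => // k hk.
have [d hd Hd] := HD k hk; exists d => // k' a b c e t y hk' a0 b0 c0 t0 ey W Ey Hy.
have [C2 wL sup] := hu.
have ny : 0 < enorm y := lt_trans R00 ey.
have y0 : y != 0 by rewrite -enorm_gt0.
apply: (le_trans (sup y ey)); apply: lerD.
  apply: (Hd k' C R0 a b c t u y hk' (ltW C0) a0 b0 c0 (ltW t0) C2 wL ey y0) => h.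
  rewrite /diff2 -Ey -[leRHS](sub_algebra t (W y) (W (y + h)) (W (y - h)) e) lerD2l lerN2 ler_pM2r ?invr_gt0//.
  exact: lerD (Hy _) (Hy _).
have hk2 : 0 <= 2 * k by case/andP: hk => k0 _; exact: mulr_ge0.
have hk2' : 0 <= 2 * k' by case/andP: hk' => k0 _; exact: mulr_ge0.
have s1 := ltW sigma0; have s2 := addr_ge0 s1 hk2; have s3 := addr_ge0 s1 hk2'.
have G : enorm (grad u y) <= N%:R * (t * profile_slope a b c sigma (sigma + 2 * k) (sigma + 2 * k') y).
  apply: (@grad_le R N u y _ (enorm y / 2)).
  - by move=> i; have [_ D1 _] := C2 y ey; have [] := D1 i.
  - exact: divr_gt0.
  - move=> h hh; apply: le_trans (Hy (y + h)).
    rewrite -Ey; apply: (grad_algebra e (ltW t0)).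
    exact: (power_profile_lower a0 b0 c0 s1 s2 s3 y0 hh).
by apply: ge0_ler_powR => //; rewrite nnegrE ?(le_trans (enorm_ge0 _) G)// enorm_ge0.
Qed.

End supersolution.

(** * Decay and slope of the barriers *)

Section profile_bounds.
Context {R : realType} {N : nat} (sigma : R) (sigma0 : 0 < sigma).
Implicit Types (x y : 'rV[R]_N) (a b c k e r : R).

Lemma pw0 a : a != 0 -> pw a (0 : 'rV[R]_N) = 0.
Proof. by move=> a0; rewrite /pw enorm0 powR0// oppr_eq0. Qed.

Lemma pw_shift a b x : 1 <= enorm x -> 0 <= b -> pw (a + b) x <= pw a x.
Proof. by move=> x1 b0; apply: pw_le; rewrite ?lerDl. Qed.

Lemma powR_pw r a x : 0 <= r -> x != 0 -> r `^ a * pw a x = (r / enorm x) `^ a.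
Proof.
move=> r0 x0; rewrite /pw powRM ?invr_ge0 ?enorm_ge0//; congr (_ * _).
by rewrite -[(enorm x)^-1]powR_inv1 ?enorm_ge0// -powRrM mulN1r.
Qed.

Lemma scaled_pw_le r a b x : 0 < r -> 0 <= a -> r <= enorm x -> r `^ a * pw (b + a) x <= pw b x.
Proof.
move=> r0 a0 rx; have x0 : x != 0 by rewrite -enorm_gt0 (lt_le_trans r0).
rewrite pwD// mulrCA ler_piMr ?pw_ge0// powR_pw ?(ltW r0)//.
have -> : 1 = 1 `^ a :> R by rewrite powR1.
rewrite ge0_ler_powR ?nnegrE ?divr_ge0 ?enorm_ge0 ?(ltW r0)//.
by rewrite ler_pdivrMr ?enorm_gt0// mul1r.
Qed.

Lemma power_profile_le (a b c k k' : R) x : 0 <= b -> 0 <= c -> 0 <= k -> 1 <= enorm x ->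
  power_profile a b c sigma (sigma + 2 * k) (sigma + 2 * k') x <= (a + b) * pw sigma x.
Proof.
move=> b0 c0 k0 x1; rewrite /power_profile.
have h1 := ler_wpM2l b0 (pw_shift sigma x1 (mulr_ge0 (ler0n R 2) k0)).
have h2 := mulr_ge0 c0 (pw_ge0 (sigma + 2 * k') x).
lra.
Qed.

Lemma power_profile_decay (a b c k k' e : R) : 0 <= a -> 0 <= b -> 0 <= c -> 0 <= k -> 0 < e ->
  exists r, forall x, r < enorm x ->
    power_profile a b c sigma (sigma + 2 * k) (sigma + 2 * k') x <= e.
Proof.
move=> a0 b0 c0 k0 e0.
have D0 : 0 < a + b + 1 by rewrite ltr_wpDl// addr_ge0.
have [r r1 Hr] := @pw_small R N sigma _ sigma0 (divr_gt0 e0 D0).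
exists r => x rx; have x1 : 1 <= enorm x := le_trans r1 (ltW rx).
apply: (le_trans (power_profile_le a k' b0 c0 k0 x1)).
apply: (@le_trans _ _ ((a + b + 1) * (e / (a + b + 1)))).
  by apply: ler_pM; rewrite ?pw_ge0 ?addr_ge0 ?lerDl ?Hr// ltW.
by rewrite mulrCA divff ?mulr1// gt_eqF.
Qed.

(** Dominates [sigma], [sigma + 2k] and [(sigma + 2k') 2^(sigma + 2k' + 1)] for all [k] and [k'] in
    [[0, 1/2]]: the factors occurring in [profile_slope]. *)
Definition slope_constant : R := (sigma + 1) * 2 `^ (sigma + 2).

Lemma slope_constant_ge0 : 0 <= slope_constant.
Proof. by rewrite mulr_ge0 ?powR_ge0// addr_ge0 ?ltW. Qed.

Lemma profile_slope_le (a b c k k' : R) x : 0 <= a -> 0 <= b -> 0 <= c ->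
  0 <= k <= 1 / 2 -> 0 <= k' <= 1 / 2 ->
  profile_slope a b c sigma (sigma + 2 * k) (sigma + 2 * k') x <=
  slope_constant * (a * pw (sigma + 1) x + b * pw (sigma + 1 + 2 * k) x +
                    c * pw (sigma + 1 + 2 * k') x).
Proof.
move=> a0 b0 c0 /andP[k0 k1] /andP[k'0 k'1].
have s0 := ltW sigma0.
have P1 : 1 <= 2 `^ (sigma + 2) :> R.
  rewrite -[leLHS](@powRr0 R 2) ler_powR ?ler1n//.
  exact: addr_ge0.
have Q l : 0 <= l -> l <= 1 / 2 -> sigma + 2 * l <= slope_constant.
  move=> l0 l1; apply: (@le_trans _ _ (sigma + 1)); first by lra.
  by rewrite ler_peMr// addr_ge0.
have S1 : sigma <= slope_constant by have := Q 0 (lexx _); lra.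
have S3 : (sigma + 2 * k') * 2 `^ (sigma + 2 * k' + 1) <= slope_constant.
  apply: ler_pM; rewrite ?powR_ge0//; [lra|lra|].
  by rewrite ler_powR ?ler1n//; lra.
have E l : sigma + l + 1 = sigma + 1 + l by rewrite addrAC.
rewrite E in S3; rewrite /profile_slope !E mulrDr mulrDr.
apply: lerD; first apply: lerD.
- by rewrite [leRHS]mulrCA; exact: (ler_wpM2l a0 (ler_wpM2r (pw_ge0 _ _) S1)).
- by rewrite [leRHS]mulrCA; exact: (ler_wpM2l b0 (ler_wpM2r (pw_ge0 _ _) (Q _ k0 k1))).
- by rewrite [leRHS]mulrCA; exact: (ler_wpM2l c0 (ler_wpM2r (pw_ge0 _ _) S3)).
Qed.

End profile_bounds.

Lemma profile_slope_ge0 {R : realType} {N : nat} (a b c a1 a2 a3 : R) (x : 'rV[R]_N) :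
  0 <= a -> 0 <= b -> 0 <= c -> 0 <= a1 -> 0 <= a2 -> 0 <= a3 ->
  0 <= profile_slope a b c a1 a2 a3 x.
Proof.
by move=> *; rewrite /profile_slope !addr_ge0// !mulr_ge0 ?pw_ge0 ?powR_ge0.
Qed.

(** * Lower bound by some multiple of [|x|^-sigma] *)

Section fundamental_lower_bound.
Context {R : realType} (n : nat) (s : R) (hs : 1 / 2 < s < 1) (hN : 2 * s < n.+1%:R).
Local Notation N := n.+1.
Local Notation sigma := (N%:R - 2 * s).
Context (C q lambda R0 : R) (f : R -> R) (u : 'rV[R]_N -> R).
Context (C0 : 0 < C) (l0 : 0 < lambda) (R00 : 0 < R0)
  (f0 : forall t, 0 < t -> 0 < f t) (hu : classical_supersolution C s q lambda R0 f u)
  (u0 : forall x, 0 < u x) (hq : N%:R / (sigma + 1) < q).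

Let sigma0 : 0 < sigma. Proof. by rewrite subr_gt0. Qed.
Let p0 : 0 < N%:R + 2 * s :> R. Proof. by have := hs; have := ltr0Sn R n; lra. Qed.
Let s10 : 0 < sigma + 1. Proof. exact: addr_gt0. Qed.
Let qN : N%:R < (sigma + 1) * q. Proof. by rewrite mulrC -ltr_pdivrMr. Qed.
Let q1 : 1 < q.
Proof. by apply: le_lt_trans hq; rewrite ler_pdivlMr// mul1r; have := hs; lra. Qed.
Let q0 : 0 <= q. Proof. exact: ltW (lt_trans ltr01 q1). Qed.

Let profile_factor (A R1 k : R) (x : 'rV[R]_N) : 0 <= R1 -> 0 <= k -> x != 0 ->
  power_profile A (A * R1 `^ (2 * k)) (A * (2 * R1)) sigma (sigma + 2 * k) (sigma + 2 * (1 / 2)) x =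
  A * pw sigma x * (1 + (R1 / enorm x) `^ (2 * k) - 2 * (R1 / enorm x)).
Proof.
move=> R10 k0 x0; rewrite /power_profile !pwD// -(powR_pw _ R10 x0).
have -> : pw (2 * (1 / 2)) x = (enorm x)^-1.
  by rewrite /pw mul1r divff ?pnatr_eq0// powR_inv1 ?enorm_ge0.
by ring.
Qed.

Let absorb (K d D E V V1 G t A r1 r2 g e : R) : 0 <= t * A ->
  0 <= V -> V1 <= V * e -> G <= t * A * (g * (V * e)) -> 0 <= K -> 0 <= D -> 0 <= r1 ->
  (K * r1 * D + g) * e <= K * r2 * d ->
  E <= K * (t * (- (A * r2) * d * V + A * (2 * r1) * (1 / 2) * D * V1)) + G -> E <= 0.
Proof.
move=> T0 V0 h1 hG K0 D0 r10 he hE; apply: (le_trans hE).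
have H1 := ler_wpM2l (mulr_ge0 (mulr_ge0 T0 K0) (mulr_ge0 r10 D0)) h1.
have H2 := ler_wpM2l (mulr_ge0 T0 V0) he.
lra.
Qed.

(* The barrier is [A (|x|^-sigma + R1^2k |x|^-(sigma+2k) - 2 R1 |x|^-(sigma+1))].
   With [z = R1 / |x|] it is [<= 0] for [z >= 1], as [1 + z^2k <= 2 z]; at
   infinity the middle term dominates, since [2k < 1] and [N + 2k < (sigma+1) q]. *)
Lemma fundamental_lower_bound : exists A r, [/\ 0 < A, 1 <= r, R0 < r &
  forall x, r <= enorm x -> A * pw sigma x <= u x].
Proof.
have [D D0 HD] := contact_inequality hs hN C0 R00 hu q0.
(* The gain decays like [|x|^-(N+2k)]. It must outlast the subtracted term, which needs [2k < 1],
   and the gradient term, which needs [N + 2k < (sigma+1) q]. *)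
pose k := Num.min (1 / 4) (((sigma + 1) * q - N%:R) / 4).
have k0 : 0 < k by rewrite lt_min !divr_gt0// subr_gt0.
have k4 : k <= 1 / 4 by rewrite ge_min lexx.
have kq : 4 * k <= (sigma + 1) * q - N%:R.
  by rewrite mulrC -ler_pdivlMr// ge_min lexx orbT.
have hk : 0 <= k <= 1 / 2 by lra.
have [d [d0 dp] Hd] := HD k hk; have {}dp := dp k0.
pose R1 := R0 + 1; pose S := slope_constant sigma.
have R11 : 1 <= R1 by rewrite lerDr ltW.
have R10 : 0 < R1 := lt_le_trans ltr01 R11.
pose K := C / mix (N%:R + 2 * s).
have K0 : 0 < K by rewrite divr_gt0// mix_gt0.
pose b := R1 `^ (2 * k).
have b0 : 0 < b by exact: powR_gt0.
pose S3 := S * (1 + b + 2 * R1).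
have S30 : 0 <= S3.
  by rewrite mulr_ge0 ?slope_constant_ge0// !addr_ge0// ?mulr_ge0 ?(ltW b0) ?(ltW R10).
have S3E : S3 = S * (1 + b + 2 * R1) by [].
clearbody S3.
pose g := (N%:R * S3) `^ q.
have g0 : 0 <= g by exact: powR_ge0.
have den0 : 0 < K * R1 * D + g + 1.
  by apply: ltr_wpDl => //; apply: addr_ge0 => //; exact: (mulr_ge0 (mulr_ge0 (ltW K0) (ltW R10)) D0).
(* [e] will bound the extra decay of the two unfavourable terms relative to the gain; at this size
   the gain [K b d] absorbs them both. *)
pose e := K * b * d / (K * R1 * D + g + 1).
have e0 : 0 < e by exact: (divr_gt0 (mulr_gt0 (mulr_gt0 K0 b0) dp) den0).
have he : (K * R1 * D + g) * e <= K * b * d.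
  rewrite /e mulrCA ler_piMr//; first exact: (mulr_ge0 (mulr_ge0 (ltW K0) (ltW b0)) d0).
  by rewrite ler_pdivrMr// mul1r lerDl.
clearbody e.
have k12 : 0 < 1 - 2 * k by lra.
have kq0 : 0 < (sigma + 1) * q - N%:R - 2 * k by lra.
have [r1 r11 Hr1] := @pw_small R N _ _ k12 e0.
have [r2 r21 Hr2] := @pw_small R N _ _ kq0 e0.
pose r := Num.max R1 (Num.max r1 r2).
have rR1 : R1 <= r by rewrite le_max lexx.
have rr1 : r1 <= r by rewrite !le_max lexx orbT.
have rr2 : r2 <= r by rewrite !le_max lexx !orbT.
have r1_ : 1 <= r := le_trans R11 rR1.
have R0R1 : R0 < R1 by rewrite ltrDl.
have R0r : R0 < r := lt_le_trans R0R1 rR1.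
have [m m0 Hm] : exists2 m, 0 < m & forall x, R1 <= enorm x <= r -> m <= u x.
  apply: (positive_lower_bound (@annulus_compact R N R1 r) u0) => x /andP[R1x _].
  exact: (supersolution_continuous hu (lt_le_trans R0R1 R1x)).
have b10 : 0 < 1 + b by rewrite addr_gt0.
(* [A <= 1] gives [(t A)^q <= t A], as [q > 1]; the second bound puts the barrier below the minimum
   [m] of [u] over the annulus. *)
pose A := Num.min 1 (m / (2 * (1 + b))).
have A0 : 0 < A by rewrite lt_min ltr01 divr_gt0// mulr_gt0.
have A1 : A <= 1 by rewrite ge_min lexx.
have Am : A * (1 + b) < m.
  have h : A * (2 * (1 + b)) <= m by rewrite -ler_pdivlMr ?mulr_gt0// ge_min lexx orbT.
  have := mulr_gt0 A0 b10; lra.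
have Ab0 : 0 <= A * b by rewrite mulr_ge0 ?ltW.
have Ac0 : 0 <= A * (2 * R1) by rewrite !mulr_ge0 ?ltW.
pose W : 'rV[R]_N -> R :=
  power_profile A (A * b) (A * (2 * R1)) sigma (sigma + 2 * k) (sigma + 2 * (1 / 2)).
have hh : 0 <= (1 / 2 : R) <= 1 / 2 by rewrite lexx divr_ge0.
have WE x : x != 0 -> W x = A * pw sigma x * (1 + (R1 / enorm x) `^ (2 * k) - 2 * (R1 / enorm x)).
  by move=> x0; rewrite /W profile_factor// ltW.
have Wu : forall x, W x <= u x.
  apply: (comparison u0 R00 R0r).
  - by move=> x; exact: supersolution_continuous hu _.
  - by move=> x x0; exact: power_profile_continuous.
  - move=> x xr; have [xR1|R1x] := leP (enorm x) R1.
      apply: le_lt_trans (u0 x).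
      have [->|x0] := eqVneq x 0.
        have P a : 0 < a -> pw a (0 : 'rV[R]_N) = 0 by move=> /lt0r_neq0/pw0.
        rewrite /W /power_profile (P _ sigma0) !P ?mulr0 ?addr0 ?subr0//.
          by rewrite addr_gt0// mulr_gt0// divr_gt0.
        by rewrite addr_gt0// mulr_gt0.
      rewrite WE// mulr_ge0_le0 ?mulr_ge0 ?pw_ge0 ?(ltW A0)//.
      have z1 : 1 <= R1 / enorm x by rewrite ler_pdivlMr ?enorm_gt0// mul1r.
      (* For [z >= 1], [z^(2k) <= z], hence [1 + z^(2k) - 2z <= 1 - z <= 0]. *)
      have := @ler1_powR R _ (2 * k) z1; have : 2 * k <= 1 by lra.
      by move=> h /(_ h); lra.
    apply: lt_le_trans (Hm x _); last by rewrite (ltW R1x).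
    have x1 : 1 <= enorm x := le_trans R11 (ltW R1x).
    apply: le_lt_trans Am.
    apply: (le_trans (power_profile_le _ _ _ Ab0 Ac0 (ltW k0) x1)).
    rewrite mulrDr mulr1 ler_piMr ?(addr_ge0 (ltW A0) Ab0)//.
    by rewrite -[leRHS](@powRr0 R (enorm x)) /pw ler_powR// oppr_le0 ltW.
  - by move=> e' e'0; apply: power_profile_decay => //; exact: ltW.
  - move=> e' t y e'0 /andP[t0 t1] ry Ey Hy.
    have y1 : 1 <= enorm y := le_trans r1_ (ltW ry).
    have y0 : y != 0 by rewrite -enorm_gt0 (lt_le_trans ltr01).
    have tA0 : 0 < t * A by exact: mulr_gt0.
    have tA1 : t * A <= 1 by rewrite mulr_ile1// ltW.
    have := Hd (1 / 2) A (A * b) (A * (2 * R1)) e' t y hh (ltW A0) Ab0 Ac0 t0 (lt_trans R0r ry) Ey Hy.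
    move/(absorb (e := e) (g := g) (ltW tA0) (pw_ge0 _ _)) => /(_ _ _ (ltW K0) D0 (ltW R10) he).
    suff [h1 h2] : pw (N%:R + 2 * (1 / 2)) y <= pw (N%:R + 2 * k) y * e /\
      (N%:R * (t * profile_slope A (A * b) (A * (2 * R1)) sigma (sigma + 2 * k) (sigma + 2 * (1 / 2)) y)) `^ q
      <= t * A * (g * (pw (N%:R + 2 * k) y * e)).
      (* The contact inequality would force [lambda * f (u y) <= 0]. *)
      move=> /(_ h1 h2); rewrite leNgt mulr_gt0 ?f0//.
    split.
      rewrite (_ : N%:R + 2 * (1 / 2) = N%:R + 2 * k + (1 - 2 * k)); last by field.
      rewrite pwD// ler_wpM2l ?pw_ge0//; apply: Hr1; exact: le_trans rr1 (ltW ry).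
    have sl : N%:R * (t * profile_slope A (A * b) (A * (2 * R1)) sigma (sigma + 2 * k) (sigma + 2 * (1 / 2)) y)
       <= t * A * (N%:R * S3 * pw (sigma + 1) y).
      rewrite (_ : t * A * _ = N%:R * (t * (S * (A * (1 + b + 2 * R1) * pw (sigma + 1) y)))); last first.
        by rewrite S3E; ring.
      rewrite ler_wpM2l// ler_wpM2l ?(ltW t0)//.
      apply: (le_trans (profile_slope_le sigma0 y (ltW A0) Ab0 Ac0 hk hh)).
      rewrite ler_wpM2l ?slope_constant_ge0//.
      have P1 := ler_wpM2l Ab0 (pw_shift (sigma + 1) y1 (mulr_ge0 (ler0n R 2) (ltW k0))).
      have P2 := ler_wpM2l Ac0 (pw_shift (sigma + 1) y1 (mulr_ge0 (ler0n R 2) (andP hh).1)).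
      lra.
    have s0' : 0 <= profile_slope A (A * b) (A * (2 * R1)) sigma (sigma + 2 * k) (sigma + 2 * (1 / 2)) y.
      apply: profile_slope_ge0 Ab0 Ac0 _ _ _; rewrite ?(ltW A0) ?(ltW sigma0)//.
        by apply: addr_ge0 => //; [exact: ltW|exact: mulr_ge0 (ltW k0)].
      by apply: addr_ge0; [exact: ltW|exact: mulr_ge0 (andP hh).1].
    have n1 := mulr_ge0 (ler0n R N) (mulr_ge0 (ltW t0) s0').
    have n2 : 0 <= N%:R * S3 * pw (sigma + 1) y by rewrite !mulr_ge0 ?pw_ge0.
    apply: (le_trans (ge0_ler_powR q0 _ _ sl)); rewrite ?nnegrE ?(mulr_ge0 (ltW tA0) n2)//.
    rewrite (powRM _ (ltW tA0) n2) (powRM _ (mulr_ge0 (ler0n R N) S30) (pw_ge0 _ _)) pw_powR.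
    apply: ler_pM; rewrite ?mulr_ge0 ?powR_ge0 ?pw_ge0//.
      by apply: ge1r_powR; rewrite ?tA0 ?tA1// ltW.
    rewrite ler_wpM2l//.
    rewrite (_ : (sigma + 1) * q = N%:R + 2 * k + ((sigma + 1) * q - N%:R - 2 * k)); last by ring.
    rewrite pwD// ler_wpM2l ?pw_ge0//; apply: Hr2; exact: le_trans rr2 (ltW ry).
(* Beyond [4 R1] the factor [1 + z^(2k) - 2z] is at least [1/2]. *)
exists (A / 2), (Num.max r (4 * R1)); split => //.
- exact: divr_gt0.
- by rewrite le_max r1_.
- by rewrite lt_max R0r.
move=> x; rewrite ge_max => /andP[rx Rx]; apply: le_trans (Wu x).
have x0 : x != 0 by rewrite -enorm_gt0 (lt_le_trans ltr01)// (le_trans r1_).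
rewrite WE//.
rewrite (_ : A / 2 * pw sigma x = A * pw sigma x * (1 / 2)); last by ring.
rewrite ler_wpM2l ?mulr_ge0 ?pw_ge0 ?(ltW A0)//.
have z : R1 / enorm x <= 1 / 4.
  by rewrite ler_pdivrMr ?enorm_gt0//; lra.
have := powR_ge0 (R1 / enorm x) (2 * k); lra.
Qed.

End fundamental_lower_bound.

(** * Arbitrarily large multiples of [|x|^-sigma] *)

Section improved_lower_bound.
Context {R : realType} (n : nat) (s : R) (hs : 1 / 2 < s < 1) (hN : 2 * s < n.+1%:R).
Local Notation N := n.+1.
Local Notation sigma := (N%:R - 2 * s).
Context (C q lambda R0 c delta : R) (f : R -> R) (u : 'rV[R]_N -> R).
Context (C0 : 0 < C) (l0 : 0 < lambda) (R00 : 0 < R0)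
  (f0 : forall t, 0 < t -> 0 < f t) (hu : classical_supersolution C s q lambda R0 f u)
  (u0 : forall x, 0 < u x) (hq : N%:R / (sigma + 1) < q)
  (c0 : 0 < c) (delta0 : 0 < delta)
  (fc : forall t, 0 < t <= delta -> c * t `^ (N%:R / sigma) <= f t)
  (f_mono : forall t t', 0 < t -> t <= t' -> f t <= f t').

Let sigma0 : 0 < sigma. Proof. by rewrite subr_gt0. Qed.
Let p0 : 0 < N%:R + 2 * s :> R. Proof. by have := hs; have := ltr0Sn R n; lra. Qed.
Let s10 : 0 < sigma + 1. Proof. exact: addr_gt0. Qed.
Let qN : N%:R < (sigma + 1) * q. Proof. by rewrite mulrC -ltr_pdivrMr. Qed.
Let q0 : 0 <= q.
Proof. by apply: ltW; apply: le_lt_trans hq; rewrite divr_ge0// ltW. Qed.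

Let profile_factor (A r k : R) (x : 'rV[R]_N) : 0 <= r -> 0 <= k -> x != 0 ->
  power_profile A 0 (A * r `^ (2 * k)) sigma (sigma + 2 * 0) (sigma + 2 * k) x =
  A * pw sigma x * (1 - (r / enorm x) `^ (2 * k)).
Proof.
move=> r0 k0 x0; rewrite /power_profile mul0r addr0 !pwD// -(powR_pw _ r0 x0).
by ring.
Qed.

Let absorb (L K M k D g b d V V0 V2 F G t e Q : R) : 0 < L -> 0 < t <= 1 -> 0 <= K -> 0 <= M ->
  0 <= k -> 0 <= D -> 0 < V ->
  K * (2 * M * k * D) <= L / 4 -> g * e <= L / 4 -> L * V <= F ->
  b * V2 <= V -> G <= g * (V * e) -> Q = 2 * M * b ->
  F <= K * (t * (- 0 * d * V0 + Q * k * D * V2)) + G -> False.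
Proof.
move=> L0 /andP[t0 t1] K0 M0 k0 D0 V0' h1 h2 h3 h4 h5 -> h6.
have H1 := ler_wpM2l (mulr_ge0 K0 (mulr_ge0 (ltW t0) (mulr_ge0 M0 (mulr_ge0 k0 D0)))) h4.
have H2 := ler_wpM2r (mulr_ge0 K0 (mulr_ge0 M0 (mulr_ge0 k0 (mulr_ge0 D0 (ltW V0'))))) t1.
have H3 := ler_wpM2r (ltW V0') h1; have H4 := ler_wpM2r (ltW V0') h2.
have H5 := mulr_gt0 L0 V0'.
lra.
Qed.

(* By [fundamental_lower_bound], [f(u)] dominates a fixed multiple of [|x|^-N],
   whereas the fractional Laplacian of the barrier
   [2M (|x|^-sigma - r^2k |x|^-(sigma+2k))] is at most a multiple of [M k |x|^-N]:
   so [k] is chosen small in terms of [M], and only then [r] large. *)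
Lemma improved_lower_bound M : 0 < M -> exists r, forall x, r <= enorm x -> M * pw sigma x <= u x.
Proof.
move=> M0.
have [A [r0 [A0 r01 R0r0 HA]]] := fundamental_lower_bound hs hN C0 l0 R00 f0 hu u0 hq.
have [D D0 HD] := contact_inequality hs hN C0 R00 hu q0.
have h0 : 0 <= (0 : R) <= 1 / 2 by rewrite lexx/= divr_ge0.
have [d _ Hd] := HD 0 h0.
pose S := slope_constant sigma.
have S0 : 0 <= S := slope_constant_ge0 sigma0.
have [K K0 KE] : exists2 K, 0 < K & K = C / mix (N%:R + 2 * s).
  by exists (C / mix (N%:R + 2 * s)) => //; rewrite divr_gt0// mix_gt0.
rewrite -KE in Hd.
(* The source is at least [L |x|^-N] far out, with [L] independent of [M]; each of the two
   unfavourable terms is allowed [L/4]. *)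
pose L := lambda * (c * A `^ (N%:R / sigma)).
have L0 : 0 < L by exact: (mulr_gt0 l0 (mulr_gt0 c0 (powR_gt0 _ A0))).
pose g := (N%:R * (S * (4 * M))) `^ q.
have g0 : 0 <= g by exact: powR_ge0.
have [e e0 he] : exists2 e, 0 < e & g * e <= L / 4.
  have G1 : 0 < g + 1 by rewrite ltr_wpDl.
  exists (L / 4 / (g + 1)); first by rewrite !divr_gt0.
  rewrite mulrCA ler_piMr//; first by rewrite ltW// divr_gt0.
  by rewrite ler_pdivrMr// mul1r lerDl.
have [k k0 [k1 hkL]] : exists2 k, 0 < k & k <= 1 / 2 /\ K * (2 * M * k * D) <= L / 4.
  have B0 : 0 <= K * (2 * M * D).
    exact: (mulr_ge0 (ltW K0) (mulr_ge0 (mulr_ge0 (ler0n _ 2) (ltW M0)) D0)).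
  have B1 : 0 < K * (2 * M * D) + 1 by rewrite ltr_wpDl.
  exists (Num.min (1 / 2) (L / 4 / (K * (2 * M * D) + 1))).
    by rewrite lt_min !divr_gt0.
  split; first by rewrite ge_min lexx.
  set k := Num.min _ _.
  have hk : k * (K * (2 * M * D) + 1) <= L / 4.
    by rewrite -ler_pdivlMr// ge_min lexx orbT.
  have k0 : 0 < k by rewrite lt_min !divr_gt0.
  by move: hk; clearbody k; lra.
have hk : 0 <= k <= 1 / 2 by rewrite k1 ltW.
have kq0 : 0 < (sigma + 1) * q - N%:R by rewrite subr_gt0.
have [r1 r11 Hr1] := @pw_small R N _ _ kq0 e0.
have [r2 r21 Hr2] := @pw_small R N _ _ sigma0 (divr_gt0 delta0 A0).
pose r := Num.max r0 (Num.max r1 r2).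
have rr0 : r0 <= r by rewrite le_max lexx.
have rr1 : r1 <= r by rewrite !le_max lexx orbT.
have rr2 : r2 <= r by rewrite !le_max lexx !orbT.
have r1_ : 1 <= r := le_trans r01 rr0.
have r00 : 0 < r := lt_le_trans ltr01 r1_.
have R0r : R0 < r := lt_le_trans R0r0 rr0.
have M20 : 0 < 2 * M by exact: mulr_gt0.
have b0 : 0 <= r `^ (2 * k) by exact: powR_ge0.
have Mb0 : 0 <= 2 * M * r `^ (2 * k) := mulr_ge0 (ltW M20) b0.
pose W : 'rV[R]_N -> R :=
  power_profile (2 * M) 0 (2 * M * r `^ (2 * k)) sigma (sigma + 2 * 0) (sigma + 2 * k).
have WE x : x != 0 -> W x = 2 * M * pw sigma x * (1 - (r / enorm x) `^ (2 * k)).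
  by move=> x0; rewrite /W profile_factor// ltW.
have k20 : 0 < 2 * k by exact: mulr_gt0.
have Wu : forall x, W x <= u x.
  apply: (comparison u0 R00 R0r).
  - by move=> x; exact: supersolution_continuous hu _.
  - by move=> x x0; exact: power_profile_continuous.
  - move=> x xr; apply: le_lt_trans (u0 x).
    have [->|x0] := eqVneq x 0.
      have P a : 0 < a -> pw a (0 : 'rV[R]_N) = 0 by move=> /lt0r_neq0/pw0.
      rewrite /W /power_profile (P _ sigma0) !P ?mulr0 ?mul0r ?addr0 ?subr0//.
      exact: addr_gt0.
    rewrite WE// mulr_ge0_le0 ?mulr_ge0 ?pw_ge0 ?(ltW M0)//.
    have z1 : 1 <= r / enorm x by rewrite ler_pdivlMr ?enorm_gt0// mul1r.
    by rewrite subr_le0 -[leLHS](@powRr0 R (r / enorm x)) ler_powR// ltW.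
  - by move=> e' e'0; apply: power_profile_decay => //; exact: ltW.
  - move=> e' t y e'0 t01 ry Ey Hy; have /andP[t0 t1] := t01.
    have y1 : 1 <= enorm y := le_trans r1_ (ltW ry).
    have y0 : y != 0 by rewrite -enorm_gt0 (lt_le_trans ltr01).
    have Q := Hd k (2 * M) 0 (2 * M * r `^ (2 * k)) e' t y hk (ltW M20) (lexx 0) Mb0 t0
      (lt_trans R0r ry) Ey Hy.
    (* Far out [A |y|^-sigma <= delta], so the growth of [f] near 0 applies at that value;
       monotonicity carries it to the larger value [u y]. *)
    have F1 : L * pw N%:R y <= lambda * f (u y).
      have V0 : 0 < A * pw sigma y by rewrite mulr_gt0// pw_gt0.
      have : A * pw sigma y <= delta.
        by rewrite mulrC -ler_pdivlMr// Hr2// (le_trans rr2 (ltW ry)).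
      move=> h; have := fc (t := A * pw sigma y); rewrite V0 h => /(_ isT) h1.
      rewrite /L -mulrA ler_wpM2l ?(ltW l0)//.
      apply: (@le_trans _ _ (f (A * pw sigma y))); last first.
        by apply: f_mono => //; apply: HA; exact: le_trans rr0 (ltW ry).
      apply: le_trans h1.
      rewrite (powRM _ (ltW A0) (pw_ge0 _ _)) pw_powR (mulrC sigma) divfK ?mulrA//.
      by rewrite gt_eqF.
    have F2 : r `^ (2 * k) * pw (N%:R + 2 * k) y <= pw N%:R y.
      by rewrite scaled_pw_le// ltW.
    apply: (absorb L0 t01 (ltW K0) (ltW M0) (ltW k0) D0 (pw_gt0 _ y0) hkL he F1 F2 _ (erefl _) Q).
    have sl : N%:R * (t * profile_slope (2 * M) 0 (2 * M * r `^ (2 * k)) sigma (sigma + 2 * 0) (sigma + 2 * k) y)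
       <= N%:R * (S * (4 * M)) * pw (sigma + 1) y.
      rewrite -[leRHS]mulrA ler_wpM2l//.
      set v := profile_slope _ _ _ _ _ _ _.
      have v0 : 0 <= v.
        apply: (profile_slope_ge0 _ (ltW M20) (lexx 0) Mb0); rewrite ?(ltW sigma0) ?mulr0 ?addr0//.
          exact: ltW.
        by rewrite addr_ge0// ltW.
      apply: (@le_trans _ _ v); first by rewrite ler_piMl.
      apply: (le_trans (profile_slope_le sigma0 y (ltW M20) (lexx 0) Mb0 h0 hk)).
      rewrite -[leRHS]mulrA; apply: (ler_wpM2l S0).
      have := scaled_pw_le (sigma + 1) r00 (ltW k20) (ltW ry).
      move/(ler_wpM2l (ltW M20)); lra.
    have n1 : 0 <= N%:R * (S * (4 * M)) := (mulr_ge0 (ler0n R N) (mulr_ge0 S0 (mulr_ge0 (ler0n R 4) (ltW M0)))).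
    have n2 : 0 <= N%:R * (t * profile_slope (2 * M) 0 (2 * M * r `^ (2 * k)) sigma (sigma + 2 * 0) (sigma + 2 * k) y).
      apply: (mulr_ge0 (ler0n R N) (mulr_ge0 (ltW t0) _)).
      apply: (profile_slope_ge0 _ (ltW M20) (lexx 0) Mb0); rewrite ?(ltW sigma0) ?mulr0 ?addr0//.
        exact: ltW.
      by rewrite addr_ge0// ltW.
    apply: (le_trans (ge0_ler_powR q0 _ _ sl)); rewrite ?nnegrE ?(mulr_ge0 n1 (pw_ge0 _ _))//.
    rewrite (powRM _ n1 (pw_ge0 _ _)) pw_powR ler_wpM2l//.
    rewrite (_ : (sigma + 1) * q = N%:R + ((sigma + 1) * q - N%:R)); last by ring.
    by rewrite pwD// ler_wpM2l ?pw_ge0//; apply: Hr1; exact: le_trans rr1 (ltW ry).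
have z0 : 0 < 2 `^ (2 * k)^-1 :> R by exact: powR_gt0.
(* From [2^(1/(2k)) r] on, the factor [1 - (r/|x|)^(2k)] is at least [1/2]; this is why the barrier
   has coefficient [2M]. *)
exists (Num.max r (2 `^ (2 * k)^-1 * r)) => x; rewrite ge_max => /andP[rx Rx].
apply: le_trans (Wu x).
have x0 : x != 0 by rewrite -enorm_gt0 (lt_le_trans r00).
have nx : 0 < enorm x by rewrite enorm_gt0.
rewrite WE//.
have h : (r / enorm x) `^ (2 * k) <= 2^-1.
  have z : r / enorm x <= (2 `^ (2 * k)^-1)^-1.
    by rewrite ler_pdivrMr// [leRHS]mulrC ler_pdivlMr// mulrC.
  have z1 : 0 <= (2 `^ (2 * k)^-1)^-1 :> R by rewrite invr_ge0 ltW.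
  apply: (le_trans (ge0_ler_powR (ltW k20) _ _ z)); rewrite ?nnegrE ?(divr_ge0 (ltW r00) (ltW nx))//.
  by rewrite -powRN -powRrM mulNr mulVf ?gt_eqF// powR_inv1.
have P := pw_ge0 sigma x.
have := ler_wpM2l (mulr_ge0 (ltW M20) P) h; lra.
Qed.

End improved_lower_bound.

(** * The bump and its second differences *)

Section bump.
Context {R : realType} {N : nat}.
Implicit Types (b h x : 'rV[R]_N).

(** With [a = 1 - |x|^2], the square gives value [a^2] and slope of order [a], so the gradient at a
    contact point also vanishes at the edge. *)
Definition bumpf x : R := Num.max 0 (1 - sqnorm x) ^+ 2.

Lemma bump_ge0 x : 0 <= bumpf x.
Proof. exact: sqr_ge0. Qed.

Lemma bumpE x : 0 <= 1 - sqnorm x -> bumpf x = (1 - sqnorm x) ^+ 2.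
Proof. by rewrite /bumpf => /max_idPr ->. Qed.

Lemma bump_outside x : 1 <= enorm x -> bumpf x = 0.
Proof.
move=> x1; rewrite /bumpf; have -> : Num.max 0 (1 - sqnorm x) = 0; last by rewrite expr0n.
by apply/max_idPl; rewrite subr_le0 -enorm_sq -[leLHS](expr1n _ 2) ler_sqr ?nnegrE ?enorm_ge0.
Qed.

Lemma bump0 : bumpf 0 = 1.
Proof. by rewrite bumpE /sqnorm big1 ?subr0 ?expr1n// => i _; rewrite mxE expr0n. Qed.

Lemma bump_continuous : continuous bumpf.
Proof.
move=> x; have cs : {for x, continuous (@sqnorm R N)}.
  rewrite (_ : @sqnorm R N = fun z => enorm z * enorm z); last first.
    by apply/funext => z; rewrite -expr2 enorm_sq.
  exact: (cvgM (@enorm_continuous R N x) (@enorm_continuous R N x)).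
rewrite (_ : bumpf = fun z => Num.max 0 (1 - sqnorm z) * Num.max 0 (1 - sqnorm z)); last first.
  by apply/funext => z; rewrite /bumpf expr2.
have cm : Num.max 0 (1 - sqnorm z) @[z --> x] --> Num.max 0 (1 - sqnorm x).
  have c0 : {for x, continuous (fun _ : 'rV[R]_N => 0 : R^o)} by exact: (@cst_continuous _ _ _ x).
  have c1 : {for x, continuous (fun z : 'rV[R]_N => 1 - sqnorm z : R^o)} by exact: (cvgB (@cst_continuous _ _ (1 : R^o) x) cs).
  exact: (continuous_max c0 c1).
exact: (cvgM cm cm).
Qed.

(** The convex function [max(0, .)^2] lies above its tangent at [a]. *)
Lemma bump_tangent (a : R) x : 0 <= a -> 2 * a * (1 - sqnorm x) - a ^+ 2 <= bumpf x.
Proof.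
move=> a0; rewrite /bumpf; have [h|h] := leP 0 (1 - sqnorm x).
  by have := sqr_ge0 (1 - sqnorm x - a); lra.
by have := sqr_ge0 a; have := mulr_ge0_le0 a0 (ltW h); rewrite expr0n/=; lra.
Qed.

Lemma parallelogram b h : sqnorm (b + h) + sqnorm (b - h) = 2 * sqnorm b + 2 * sqnorm h.
Proof.
have E : sqnorm (- h) = sqnorm h by rewrite -!enorm_sq enormN.
by rewrite !sqnormD dotpN E; ring.
Qed.

(** The tangent bound at [a = 1 - |b|^2] for both [b + h] and [b - h], then the parallelogram
    identity; for [|h| >= 1], positivity of the bump and [a^2 <= 2a]. *)
Lemma diff2_bump_le b h : 0 <= 1 - sqnorm b ->
  diff2 bumpf b h <= 2 * (1 - sqnorm b) * sqmin h.
Proof.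
move=> a0; have a1 : 1 - sqnorm b <= 1 by rewrite gerBl sqnorm_ge0.
rewrite /diff2 bumpE//; set a := 1 - sqnorm b in a0 a1 *.
rewrite /sqmin; have [_|_] := leP 1 (sqnorm h).
  have := bump_ge0 (b + h); have := bump_ge0 (b - h); have := ler_wpM2l a0 a1; lra.
have h1 := bump_tangent (b + h) a0; have h2 := bump_tangent (b - h) a0.
have := parallelogram b h; rewrite (_ : sqnorm b = 1 - a) => [P|]; last by rewrite /a; ring.
have : 2 * a * (1 - sqnorm (b + h)) + 2 * a * (1 - sqnorm (b - h)) =
  2 * a * (2 - (sqnorm (b + h) + sqnorm (b - h))) by ring.
rewrite P; lra.
Qed.

Lemma bump_lower b h : 0 <= 1 - sqnorm b -> enorm h <= 1 ->
  bumpf b - 6 * (1 - sqnorm b) * enorm h <= bumpf (b + h).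
Proof.
move=> a0 h1; apply: le_trans (bump_tangent (b + h) a0); rewrite bumpE//.
have b1 : enorm b <= 1.
  by rewrite -ler_sqr ?nnegrE ?enorm_ge0// enorm_sq expr1n -subr_ge0.
have D : dotp b h <= enorm h.
  apply: (le_trans (ler_norm _)); apply: (le_trans (dotp_le b h)).
  by rewrite ler_piMl ?enorm_ge0.
have S : sqnorm h <= enorm h.
  by rewrite -enorm_sq expr2 ler_piMl ?enorm_ge0.
rewrite sqnormD; set a := 1 - sqnorm b in a0 *.
rewrite (_ : sqnorm b = 1 - a); last by rewrite /a; ring.
have := ler_wpM2l a0 D; have := ler_wpM2l a0 S; lra.
Qed.

(** The bump is at most [(1/16)^2] at [b] and at least [(3/4)^2] at [b + h], and
    [1/256 - 9/32 <= -1/4]. *)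
Lemma diff2_bump_edge b h : 0 <= 1 - sqnorm b <= 1 / 16 -> enorm (b + h) <= 1 / 2 ->
  diff2 bumpf b h <= - (1 / 4).
Proof.
move=> /andP[a0 a1] bh; rewrite /diff2 bumpE//.
have q : sqnorm (b + h) <= 1 / 4.
  rewrite -enorm_sq (_ : 1 / 4 = (1 / 2) ^+ 2); last by field.
  by rewrite ler_sqr ?nnegrE ?enorm_ge0// divr_ge0.
have h1 : 9 / 16 <= bumpf (b + h).
  have := @bump_tangent (3 / 4) (b + h); rewrite divr_ge0// => /(_ isT).
  lra.
have := bump_ge0 (b - h); have : (1 - sqnorm b) ^+ 2 <= 1 / 256.
  rewrite (_ : 1 / 256 = (1 / 16) ^+ 2); last by field.
  by rewrite ler_sqr ?nnegrE// divr_ge0.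
lra.
Qed.

End bump.

(** * Scaling of the kernel, and the nonlocal gain *)

Section bump_energy.
Context {R : realType} (n : nat) (s : R) (hs : 1 / 2 < s < 1).
Local Notation N := n.+1.
Local Notation ell := (@lebesgue_rV R N).
Local Notation L1 f := (ell.-integrable setT (EFin \o f)).
Local Notation I f := (Rintegral ell setT f).
Local Notation p := (N%:R + 2 * s).
Implicit Types (u F : 'rV[R]_N -> R) (b h x y : 'rV[R]_N) (r : R).

Let hs01 : 0 < s < 1. Proof. by have := hs; lra. Qed.
Let p0 : 0 < p. Proof. by case/andP: hs01 => s0 _; rewrite ltr_wpDl// mulr_gt0. Qed.

(** The kernel is homogeneous of degree [-(N+2s)] and the volume contributes [r^N]. *)
Lemma Rint_kernel_scale r F : 0 < r -> (forall h, 0 <= F h) ->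
  L1 (fun h => F h * pw p h) -> L1 (fun h => F (r^-1 *: h) * pw p h) /\
  I (fun h => F (r^-1 *: h) * pw p h) = r `^ (- (2 * s)) * I (fun h => F h * pw p h).
Proof.
move=> r0 F0 IF; have ri0 : r^-1 != 0 by rewrite invr_eq0 gt_eqF.
have mG := L1_measurable IF.
pose G h := F h * pw p h.
have G0 h : 0 <= G h by rewrite mulr_ge0 ?pw_ge0.
have GE h : F (r^-1 *: h) * pw p h = r `^ (- p) * G (r^-1 *: h + 0).
  rewrite /G addr0 mulrCA; congr (_ * _).
  rewrite /pw enormZ ger0_norm ?invr_ge0 ?(ltW r0)// powRM ?invr_ge0 ?enorm_ge0 ?(ltW r0)//.
  rewrite mulrA -powRM ?invr_ge0 ?(ltW r0)// divff ?gt_eqF//.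
  by rewrite powR1 mul1r.
rewrite (_ : (fun h => F (r^-1 *: h) * pw p h) = (fun h => r `^ (- p) * G (r^-1 *: h + 0))); last first.
  exact/funext.
have mGa : measurable_fun setT (fun h => G (r^-1 *: h + 0)) by exact: measurable_affine_comp.
have P0 : 0 <= r `^ (- p) by exact: powR_ge0.
apply: Rint_ge0E.
- by apply: measurable_funM.
- by move=> h; rewrite mulr_ge0.
rewrite nnintZ// (@integral_affine_rV R N r^-1 0 (fun h => (G h)%:E))//; last exact/measurable_EFinP.
rewrite RintE// -!EFinM mulrA; congr EFin; congr (_ * _).
rewrite ger0_norm ?invr_ge0 ?(ltW r0)// exprVn invrK -powR_mulrn ?(ltW r0)//.
by rewrite -powRD_gt0//; congr (_ `^ _); ring.
Qed.

(** A cube of side [1/N], hence inside the ball of radius [1/2]; half-open and bounded by row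
    vectors in the form of [lebesgue_rV_box]. *)
Definition box : set 'rV[R]_N :=
  [set x | forall i, (\row_(j < N) (- (2 * N%:R)^-1 : R)) ord0 i < x ord0 i <=
                     (\row_(j < N) ((2 * N%:R)^-1 : R)) ord0 i].

Let half0 : 0 < (2 * N%:R)^-1 :> R. Proof. by rewrite invr_gt0 mulr_gt0. Qed.

Lemma measurable_box : measurable box.
Proof.
rewrite (_ : box = \bigcap_(i in [set: 'I_N])
    (coor_rV i @^-1` `](- (2 * N%:R)^-1 : R), ((2 * N%:R)^-1 : R)]%classic)); last first.
  apply/seteqP; split=> [x h i _|x h i]; first by have := h i; rewrite !mxE/= in_itv.
  by have := h i Logic.I; rewrite !mxE/= in_itv.
apply: fin_bigcap_measurable => [|i _]; first exact: finite_finset.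
by rewrite -[X in measurable X]setTI; exact: measurable_coor_rV.
Qed.

Lemma lebesgue_box : exists2 v : R, 0 < v & ell box = v%:E.
Proof.
exists (\prod_(i < N) ((2 * N%:R)^-1 - - (2 * N%:R)^-1)).
  by apply: prodr_gt0 => i _; rewrite opprK addr_gt0.
rewrite lebesgue_rV_box; last by move=> i; rewrite !mxE (le_trans _ (ltW half0))// oppr_le0 ltW.
by congr EFin; apply: eq_bigr => i _; rewrite !mxE.
Qed.

Lemma box_enorm x : box x -> enorm x <= 1 / 2.
Proof.
move=> bx; apply: (le_trans (enorm_le_sum x)).
apply: (@le_trans _ _ (\sum_(i < N) (2 * N%:R)^-1)).
  apply: ler_sum => i _; have := bx i; rewrite !mxE => /andP[h1 h2].
  by rewrite ler_norml h2 ltW.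
rewrite sumr_const card_ord -(mulr_natr (2 * N%:R)^-1 N) invfM -mulrA mulVf ?pnatr_eq0//.
by rewrite mulr1 mul1r.
Qed.

Definition boxker b h : R := \1_box (h + b).

Lemma boxker_ge0 b h : 0 <= boxker b h. Proof. by []. Qed.

Lemma measurable_boxker b : measurable_fun setT (boxker b).
Proof.
rewrite (_ : boxker b = fun h => \1_box (1 *: h + b)); last first.
  by apply/funext => h; rewrite scale1r.
apply: (@measurable_affine_comp R N (\1_box : 'rV[R]_N -> R) 1 b).
exact: measurable_indic measurable_box.
Qed.

Lemma boxker_support b h : 15 / 16 <= sqnorm b -> boxker b h != 0 ->
  enorm (h + b) <= 1 / 2 /\ 2 / 5 <= enorm h.
Proof.
move=> b1; rewrite /boxker indicE; case: (boolP (h + b \in box)); last by rewrite eqxx.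
rewrite inE => /box_enorm hb _; split => //.
have b2 : 9 / 10 <= enorm b.
  rewrite -ler_sqr ?nnegrE ?enorm_ge0 ?divr_ge0// enorm_sq; apply: le_trans b1.
  rewrite expr2; lra.
have := enormB_le b (- (h + b)); rewrite enormN opprD addrCA subrr addr0.
by rewrite enormN; lra.
Qed.

(** On the support [2/5 <= |h| <= 3/2]. The lower bound gives integrability through
    [1 <= 25 sqmin h]; by the upper one the kernel is at least [(3/2)^-p], which makes [v]
    independent of [b]. *)
Lemma boxker_kernel : exists2 v : R, 0 < v & forall b, 15 / 16 <= sqnorm b <= 1 ->
  L1 (fun h => boxker b h * pw p h) /\ v <= I (fun h => boxker b h * pw p h).
Proof.
have [v v0 vE] := lebesgue_box.
have w0 : 0 < (3 / 2) `^ (- p) :> R by rewrite powR_gt0// divr_gt0.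
exists ((3 / 2) `^ (- p) * v) => [|b /andP[b1 b2]]; first exact: mulr_gt0.
have b2' : enorm b <= 1 by rewrite -ler_sqr ?nnegrE ?enorm_ge0// enorm_sq expr1n.
have mk := measurable_boxker b.
have Ik : L1 (fun h => boxker b h * pw p h).
  apply: (@L1_le _ _ _ _ _ (fun h => 25 * (sqmin h * pw p h))).
  - by apply: measurable_funM => //; exact: measurable_pw.
  - by apply: L1Z; exact: sqmin_kernel_L1.
  move=> h; rewrite ger0_norm ?mulr_ge0 ?pw_ge0 ?boxker_ge0// mulrA ler_wpM2r ?pw_ge0//.
  have [->|k0] := eqVneq (boxker b h) 0; first by rewrite mulr_ge0 ?sqmin_ge0.
  have [_ h2] := boxker_support b1 k0.
  have k1 : boxker b h <= 1 by rewrite /boxker indicE lern1 leq_b1.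
  apply: (le_trans k1); rewrite /sqmin -enorm_sq; have [_|_] := leP 1 (enorm h ^+ 2); first by lra.
  have := ler_pM _ _ h2 h2; rewrite !divr_ge0// => /(_ isT isT); rewrite -expr2; lra.
split => //.
have [Ib Eb] : L1 (boxker b) /\ I (boxker b) = v.
  apply: Rint_ge0E => //.
  have mb : measurable_fun setT (fun x : 'rV[R]_N => (\1_box x : R)%:E).
    by apply/measurable_EFinP; exact: measurable_indic measurable_box.
  have b0 (x : 'rV[R]_N) : (0 <= (\1_box x : R)%:E)%E by rewrite lee_fin.
  have := @integral_affine_rV R N 1 b _ (oner_neq0 R) mb b0.
  have E1 : (\int[ell]_x (\1_box x : R)%:E = v%:E)%E.
    by rewrite (integral_indic _ measurableT measurable_box) setIT; exact: vE.
  rewrite normr1 expr1n invr1 mul1e E1.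
  by move=> <-; apply: eq_integral => h _; rewrite scale1r.
rewrite -Eb -RintZ//; apply: Rint_le => //; first exact: L1Z.
move=> h; have [->|k0] := eqVneq (boxker b h) 0; first by rewrite mulr0 mul0r.
have [h1 h2] := boxker_support b1 k0.
rewrite mulrC ler_wpM2l ?boxker_ge0// /pw.
have hh : 0 < enorm h by apply: lt_le_trans h2; rewrite divr_gt0.
have h3 : enorm h <= 3 / 2.
  by have := enormD (h + b) (- b); rewrite addrK enormN; lra.
rewrite !powRN lef_pV2 ?posrE ?powR_gt0 ?divr_gt0// ge0_ler_powR ?nnegrE ?divr_ge0 ?(ltW p0)//.
exact: ltW.
Qed.

End bump_energy.

(** * Fractional Laplacian at a contact with the bump *)

Section bump_laplacian.
Context {R : realType} (n : nat) (s : R) (hs : 1 / 2 < s < 1).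
Local Notation N := n.+1.
Local Notation ell := (@lebesgue_rV R N).
Local Notation L1 f := (ell.-integrable setT (EFin \o f)).
Local Notation I f := (Rintegral ell setT f).
Local Notation p := (N%:R + 2 * s).

Let hs01 : 0 < s < 1. Proof. by have := hs; lra. Qed.

Let diff2_algebra (U U1 U2 T B B1 B2 : R) : 0 <= T -> U = T * B -> T * B1 <= U1 -> T * B2 <= U2 ->
  U - (U1 + U2) / 2 <= T * (B - (B1 + B2) / 2).
Proof. by move=> T0 ->; lra. Qed.

Let g_algebra (T a S K P : R) :
  T * (2 * a * S - 1 / 4 * K) * P = T * 2 * a * (S * P) + - (T * (1 / 4)) * (K * P).
Proof. by ring. Qed.

Let near_algebra (T a J v v' e : R) : 0 <= T -> 0 <= a -> 0 <= e -> 0 <= v' -> v' <= v ->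
  T * 2 * a * (e * J) + - (T * (1 / 4)) * (e * v) <= T * e * ((2 * J + 4 * v') * a - v' / 4).
Proof.
move=> T0 a0 e0 v0 hv; have Te := mulr_ge0 T0 e0.
have := ler_wpM2l Te hv; have := mulr_ge0 Te (mulr_ge0 v0 a0); lra.
Qed.

Let far_algebra (T a J v e : R) : 0 <= T -> 1 / 16 <= a -> 0 <= e -> 0 <= v ->
  T * 2 * a * (e * J) <= T * e * ((2 * J + 4 * v) * a - v / 4).
Proof.
move=> T0 a0 e0 v0; have := ler_wpM2l (mulr_ge0 (mulr_ge0 T0 e0) v0) a0; lra.
Qed.

(* The term [- v] is the nonlocal gain: near the edge of the bump, its central
   part contributes a negative amount to the fractional Laplacian. *)
Lemma fracLaplacian_bump : exists J v : R, [/\ 0 <= J, 0 < v &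
  forall (C R0 r T : R) (u : 'rV[R]_N -> R) (x0 y : 'rV[R]_N),
  0 <= C -> C2_on (exterior R0) u -> weighted_L1 s u -> exterior R0 y -> 0 < r -> 0 <= T ->
  0 <= 1 - sqnorm (r^-1 *: (y - x0)) -> u y = T * bumpf (r^-1 *: (y - x0)) ->
  (forall x, T * bumpf (r^-1 *: (x - x0)) <= u x) ->
  fracLaplacian C s u y <=
    C * (T * r `^ (- (2 * s)) * (J * (1 - sqnorm (r^-1 *: (y - x0))) - v))].
Proof.
have [v v0 Hv] := @boxker_kernel R n s hs.
pose J := I (fun h : 'rV[R]_N => sqmin h * pw p h).
have ISq := @sqmin_kernel_L1 R N s hs01.
have J0 : 0 <= J.
  by apply: Rintegral_ge0 => x _; rewrite mulr_ge0 ?sqmin_ge0 ?pw_ge0.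
(* The summand [4 v] lets one formula serve both cases: for [a > 1/16] it contributes
   [4 v a >= v/4], offsetting a gain that exists only near the edge. *)
exists (2 * J + 4 * v), (v / 4); split; first by rewrite addr_ge0// mulr_ge0// ltW.
  exact: divr_gt0.
move=> C R0 r T u x0 y C0 C2 wL ey r0 T0.
set b := r^-1 *: (y - x0); set a := 1 - sqnorm b => a0 Ey Hy.
have D h : diff2 u y h <= T * diff2 bumpf b (r^-1 *: h).
  apply: (diff2_algebra T0 Ey).
    by apply: le_trans (Hy (y + h)); rewrite addrAC scalerDr.
  by apply: le_trans (Hy (y - h)); rewrite addrAC scalerBr.
have e0 : 0 <= r `^ (- (2 * s)) by exact: powR_ge0.
have [IS ES] := Rint_kernel_scale r0 (@sqmin_ge0 R N) ISq.
have I1 := L1Z (T * 2 * a) IS.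
have [a1|a1] := leP a (1 / 16).
  have b1 : 15 / 16 <= sqnorm b <= 1 by move: a0 a1; rewrite /a; lra.
  have [Ib Eb] := Hv b b1.
  have [IB EB] := Rint_kernel_scale r0 (@boxker_ge0 R n b) Ib.
  have I2 := L1Z (- (T * (1 / 4))) IB.
  (* When [b + h'], with [h' = r^-1 *: h], is off the cube this is the quadratic bound; on the cube
     it lies above the edge bound [-1/4]. *)
  pose g (h : 'rV[R]_N) := T * (2 * a * sqmin (r^-1 *: h) - 1 / 4 * boxker b (r^-1 *: h)).
  have gE : (fun h => g h * pw p h) = (fun h => T * 2 * a * (sqmin (r^-1 *: h) * pw p h) +
      - (T * (1 / 4)) * (boxker b (r^-1 *: h) * pw p h)).
    by apply/funext => h; exact: g_algebra.
  have Ig : L1 (fun h => g h * pw p h) by rewrite gE; exact: L1D.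
  apply: (le_trans (fracLaplacian_le hs C0 C2 wL ey Ig _)).
    move=> h; apply: (le_trans (D h)); rewrite ler_wpM2l//.
    set h' := r^-1 *: h; have [->|k0] := eqVneq (boxker b h') 0.
      by rewrite mulr0 subr0; exact: diff2_bump_le.
    have /andP[b15 _] := b1; have [hb _] := boxker_support b15 k0.
    have a01 : 0 <= 1 - sqnorm b <= 1 / 16 by rewrite a0.
    rewrite addrC in hb; apply: (le_trans (diff2_bump_edge a01 hb)).
    have k1 : boxker b h' <= 1 by rewrite /boxker indicE lern1 leq_b1.
    have := mulr_ge0 a0 (sqmin_ge0 h'); lra.
  rewrite ler_wpM2l// gE RintD// RintZ// RintZ// ES EB.
  exact: (near_algebra J T0 a0 e0 (ltW v0) Eb).
pose g (h : 'rV[R]_N) := T * (2 * a * sqmin (r^-1 *: h)).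
have gE : (fun h => g h * pw p h) = (fun h => T * 2 * a * (sqmin (r^-1 *: h) * pw p h)).
  by apply/funext => h; rewrite /g !mulrA.
have Ig : L1 (fun h => g h * pw p h) by rewrite gE.
apply: (le_trans (fracLaplacian_le hs C0 C2 wL ey Ig _)).
  by move=> h; apply: (le_trans (D h)); rewrite ler_wpM2l//; exact: diff2_bump_le.
rewrite ler_wpM2l// gE RintZ// ES; exact: (far_algebra J T0 (ltW a1) e0 (ltW v0)).
Qed.

End bump_laplacian.

(** * The scaled contact inequality bounds the height *)

Section scaled_contact.
Context {R : realType}.
Implicit Types (a al be c K T X : R).

Lemma powR_self_bound al be c K : 0 < c -> al < be ->
  exists2 B, 0 <= B & forall T, 0 < T -> c * T `^ be <= K * T `^ al -> T <= B.
Proof.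
move=> c0 ab; have d0 : 0 < be - al by rewrite subr_gt0.
exists ((K / c) `^ (be - al)^-1) => [|T T0]; first exact: powR_ge0.
rewrite -[be](subrK al) powRD_gt0// mulrA ler_pM2r ?powR_gt0// addrK => h.
have h1 : T `^ (be - al) <= K / c by rewrite ler_pdivlMr// mulrC.
have h2 : 0 <= K / c := le_trans (powR_ge0 _ _) h1.
have := ge0_ler_powR (r := (be - al)^-1) _ _ _ h1.
rewrite invr_ge0 (ltW d0) !nnegrE powR_ge0 h2 => /(_ isT isT isT).
by rewrite -powRrM divff ?gt_eqF// powRr1// ltW.
Qed.

(* Put [X = T a^2]. If [a] is not small, [X] is comparable to [T] and [q < P]
   suffices. Otherwise the linear term is absorbed, and [(T a)^q = (T X)^(q/2)]
   is at most the power [(1 + 1/P) q / 2 < 1] of [max(T, X^P)]. *)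
Lemma scaled_contact_bound (c1 c0 C1 C3 P q : R) : 0 < c1 -> 0 < c0 -> 0 <= C1 -> 0 <= C3 ->
  1 < q -> q < P -> (P + 1) * q < 2 * P ->
  exists B, forall T a, 0 < T -> 0 < a <= 1 ->
    c1 * (T * a ^+ 2) `^ P + c0 * T <= C1 * (T * a) + C3 * (T * a) `^ q -> T <= B.
Proof.
move=> c10 c00 C10 C30 q1 qP tq.
have q0 : 0 < q := lt_trans ltr01 q1.
have P0 : 0 < P := lt_trans q0 qP.
have C11 : 0 < 2 * (C1 + 1) by rewrite mulr_gt0// ltr_wpDl.
(* Below this threshold [C1 T a] is at most half of [c0 T]. *)
pose a1 := c0 / (2 * (C1 + 1)).
have a10 : 0 < a1 by exact: divr_gt0.
have a1E : a1 * (2 * (C1 + 1)) = c0 by rewrite /a1 divfK// gt_eqF.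
clearbody a1.
have d1 : 0 < c1 * (a1 ^+ 2) `^ P by rewrite mulr_gt0// powR_gt0// exprn_gt0.
have [B1 B10 H1] := powR_self_bound (C1 + C3) d1 qP.
have c02 : 0 < c0 / 2 by exact: divr_gt0.
(* [e1] serves the case [X^P <= T] and [e2] the case [T < X^P]: both restate [(P+1) q < 2P], as
   sublinearity in [T] and as growth below [X^P] respectively. *)
have e1 : (1 + P^-1) * (q / 2) < 1.
  rewrite (_ : (1 + P^-1) * (q / 2) = (P + 1) * q / (2 * P)); last by field; rewrite gt_eqF.
  by rewrite ltr_pdivrMr ?mul1r// mulr_gt0.
have [B2 B20 H2] := powR_self_bound C3 c02 e1.
have e2 : (P + 1) * (q / 2) < P by lra.
have [B3 B30 H3] := powR_self_bound C3 c10 e2.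
have B3P := powR_ge0 B3 P.
exists (1 + B1 + B2 + B3 `^ P) => T a T0 /andP[a0 ale1] h.
have Ta0 : 0 < T * a by exact: mulr_gt0.
have Ta : T * a <= T by rewrite ler_piMr// ltW.
have X0 : 0 < T * a ^+ 2 by rewrite mulr_gt0// exprn_gt0.
have [aa1|aa1] := leP a1 a.
  have [T1|T1] := leP T 1; first by lra.
  suff : T <= B1 by lra.
  apply: H1 => //.
  have E1 : c1 * (a1 ^+ 2) `^ P * T `^ P <= c1 * (T * a ^+ 2) `^ P.
    rewrite -mulrA ler_wpM2l ?(ltW c10)// -powRM ?exprn_ge0 ?(ltW a10) ?(ltW T0)//.
    rewrite ge0_ler_powR ?nnegrE ?mulr_ge0 ?exprn_ge0 ?(ltW T0) ?(ltW a10) ?(ltW a0) ?(ltW P0)//.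
    by rewrite mulrC ler_wpM2l ?(ltW T0)// lerXn2r ?nnegrE ?(ltW a10) ?(ltW a0).
  have E2 : C1 * (T * a) <= C1 * T `^ q.
    rewrite ler_wpM2l//; apply: (le_trans Ta).
    by rewrite -[leLHS](powRr1 (ltW T0)) ler_powR// ltW.
  have E3 : C3 * (T * a) `^ q <= C3 * T `^ q.
    by rewrite ler_wpM2l// ge0_ler_powR ?nnegrE ?(ltW q0) ?(ltW Ta0) ?(ltW T0).
  have := mulr_gt0 c00 T0; lra.
have E1 : C1 * (T * a) <= c0 / 2 * T.
  have := ler_wpM2l (mulr_ge0 C10 (ltW T0)) (ltW aa1).
  have := mulr_gt0 a10 T0; have : a1 * (2 * (C1 + 1)) * T = c0 * T by rewrite a1E.
  lra.
have E2 : (T * a) `^ q = (T * (T * a ^+ 2)) `^ (q / 2).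
  rewrite (_ : T * (T * a ^+ 2) = (T * a) ^+ 2); last by ring.
  by rewrite -powR_mulrn ?(ltW Ta0)// -powRrM; congr (_ `^ _); field.
have F : c1 * (T * a ^+ 2) `^ P + c0 / 2 * T <= C3 * (T * (T * a ^+ 2)) `^ (q / 2).
  by rewrite -E2; lra.
have q2 : 0 <= q / 2 by rewrite divr_ge0// ltW.
have [XT|TX] := leP ((T * a ^+ 2) `^ P) T.
  suff : T <= B2 by lra.
  apply: H2 => //; rewrite powRr1 ?(ltW T0)//.
  have Xi : T * a ^+ 2 <= T `^ P^-1.
    have := ge0_ler_powR (r := P^-1) _ _ _ XT.
    rewrite invr_ge0 (ltW P0) !nnegrE powR_ge0 (ltW T0) => /(_ isT isT isT).
    by rewrite -powRrM divff ?gt_eqF// powRr1// ltW.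
  have : C3 * (T * (T * a ^+ 2)) `^ (q / 2) <= C3 * T `^ ((1 + P^-1) * (q / 2)).
    rewrite ler_wpM2l// (powRrM T (1 + P^-1)) ge0_ler_powR ?nnegrE ?powR_ge0 ?(ltW (mulr_gt0 T0 X0))//.
    by rewrite powRD_gt0// powRr1 ?(ltW T0)// ler_wpM2l// ltW.
  have := mulr_ge0 (ltW c10) (powR_ge0 (T * a ^+ 2) P); lra.
have XB : T * a ^+ 2 <= B3.
  apply: H3 => //.
  have : C3 * (T * (T * a ^+ 2)) `^ (q / 2) <= C3 * (T * a ^+ 2) `^ ((P + 1) * (q / 2)).
    rewrite ler_wpM2l// (powRrM _ (P + 1)) ge0_ler_powR ?nnegrE ?powR_ge0 ?(ltW (mulr_gt0 T0 X0))//.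
    by rewrite powRD_gt0// powRr1 ?(ltW X0)// ler_wpM2r// ltW.
  have := mulr_gt0 c02 T0; lra.
have : (T * a ^+ 2) `^ P <= B3 `^ P.
  by rewrite ge0_ler_powR ?nnegrE ?(ltW P0) ?(ltW X0).
lra.
Qed.

End scaled_contact.

(** * Bounded values far from the origin *)

Section far_contact.
Context {R : realType} (n : nat) (s : R) (hs : 1 / 2 < s < 1) (hN : 2 * s < n.+1%:R).
Local Notation N := n.+1.
Local Notation sigma := (N%:R - 2 * s).
Context (C q lambda R0 c delta : R) (f : R -> R) (u : 'rV[R]_N -> R).
Context (C0 : 0 < C) (l0 : 0 < lambda) (R00 : 0 < R0)
  (f0 : forall t, 0 < t -> 0 < f t) (hu : classical_supersolution C s q lambda R0 f u)
  (u0 : forall x, 0 < u x) (hq : N%:R / (sigma + 1) < q)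
  (c0 : 0 < c) (delta0 : 0 < delta)
  (fc : forall t, 0 < t <= delta -> c * t `^ (N%:R / sigma) <= f t)
  (f_mono : forall t t', 0 < t -> t <= t' -> f t <= f t').

Let sigma0 : 0 < sigma. Proof. by rewrite subr_gt0. Qed.
Let s10 : 0 < sigma + 1. Proof. exact: addr_gt0. Qed.
Let P := N%:R / sigma.
Let q0 := N%:R / (sigma + 1).
Let N0 : 0 < N%:R :> R. Proof. by []. Qed.
Let q01 : 1 < q0. Proof. by rewrite ltr_pdivlMr// mul1r; have := hs; lra. Qed.
Let q0P : q0 < P.
Proof. by rewrite /q0 /P ltr_pM2l// ltf_pV2 ?posrE// ltrDl. Qed.
Let P0 : 0 < P. Proof. exact: divr_gt0. Qed.
(** After clearing denominators this is [2 - 2s > 0]. *)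
Let subcritical : (P + 1) * q0 < 2 * P.
Proof.
rewrite /q0 /P mulrA ltr_pdivrMr// -subr_gt0.
rewrite (_ : _ - _ = N%:R * (2 * (sigma + 1) - N%:R - sigma) / sigma); last first.
  by field; rewrite nat1r; exact: lt0r_neq0.
by rewrite divr_gt0// mulr_gt0//; have := hs; lra.
Qed.

(** Monotonicity extends the growth from []0, delta]] to []0, M]]: [f t >= f (m t)], where
    [m = delta / (delta + M)] brings [m t] below [delta]. *)
Lemma nonlinearity_lower M : 0 < M -> exists2 c', 0 < c' & forall t, 0 < t <= M -> c' * t `^ P <= f t.
Proof.
move=> M0; have d0 : 0 < delta + M by exact: addr_gt0.
have m0 : 0 < delta / (delta + M) by exact: divr_gt0.
have m1 : delta / (delta + M) <= 1 by rewrite ler_pdivrMr// mul1r lerDl ltW.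
have mM : delta / (delta + M) * M <= delta.
  by rewrite mulrAC ler_pdivrMr// ler_wpM2l ?(ltW delta0)// lerDr ltW.
set m := delta / (delta + M) in m0 m1 mM.
exists (c * m `^ P) => [|t /andP[t0 tM]]; first by rewrite mulr_gt0// powR_gt0.
rewrite -mulrA -powRM ?(ltW m0) ?(ltW t0)//.
apply: le_trans (fc (t := m * t) _) _.
  by rewrite mulr_gt0//=; apply: le_trans mM; rewrite ler_wpM2l// ltW.
by apply: f_mono; [exact: mulr_gt0|rewrite ler_piMl// ltW].
Qed.

(** Multiplication by [r^N = (r^sigma)^P = (r^(sigma+1))^q0], with [r^N r^(-2s) = r^sigma]: height
    and radius survive only in the product [T0 r^sigma]. *)
Let scaled_inequality (l c' C' J v T0 a r g : R) : 0 < r -> 0 <= T0 -> 0 <= a -> 0 <= g ->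
  l * (c' * (T0 * a ^+ 2) `^ P) <= C' * (T0 * r `^ (- (2 * s)) * (J * a - v)) + (g * (T0 * a / r)) `^ q0 ->
  l * c' * (T0 * r `^ sigma * a ^+ 2) `^ P + C' * v * (T0 * r `^ sigma) <=
  C' * J * (T0 * r `^ sigma * a) + g `^ q0 * (T0 * r `^ sigma * a) `^ q0.
Proof.
move=> r0 T00 a0 g0 h.
have rN := powR_gt0 N%:R r0.
have E1 : (T0 * r `^ sigma * a ^+ 2) `^ P = r `^ N%:R * (T0 * a ^+ 2) `^ P.
  have T1 : 0 <= T0 * a ^+ 2 by rewrite mulr_ge0 ?exprn_ge0.
  rewrite (_ : T0 * _ * _ = r `^ sigma * (T0 * a ^+ 2)); last by ring.
  rewrite (powRM _ (powR_ge0 _ _) T1); congr (_ * _).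
  by rewrite -powRrM mulrC divfK// gt_eqF.
have E2 : r `^ sigma = r `^ N%:R * r `^ (- (2 * s)) by rewrite -powRD_gt0.
have E3 : g `^ q0 * (T0 * r `^ sigma * a) `^ q0 = r `^ N%:R * (g * (T0 * a / r)) `^ q0.
  rewrite [in RHS]powRM ?mulr_ge0 ?invr_ge0 ?(ltW r0)// mulrCA; congr (_ * _).
  have -> : r `^ N%:R = (r `^ (sigma + 1)) `^ q0.
    by rewrite -powRrM mulrC /q0 divfK// gt_eqF.
  rewrite -powRM ?mulr_ge0 ?invr_ge0 ?powR_ge0 ?(ltW r0)//; congr (_ `^ _).
  rewrite (powRD_gt0 sigma 1 r0) powRr1 ?(ltW r0)//; field; exact: lt0r_neq0.
have := ler_wpM2l (ltW rN) h.
rewrite E1 E3; have -> : T0 * r `^ sigma = T0 * (r `^ N%:R * r `^ (- (2 * s))) by rewrite -E2.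
lra.
Qed.

Lemma contact_bound M : 0 < M -> exists B r, 0 < r /\ forall x0, r <= enorm x0 -> u x0 <= M ->
  exists2 y, enorm x0 / 2 <= enorm y <= 3 * (enorm x0 / 2) & (enorm x0 / 2) `^ sigma * u y <= B.
Proof.
move=> M0; have [c' c'0 Hc'] := nonlinearity_lower M0.
have [J [v [J0 v0 HL]]] := @fracLaplacian_bump R n s hs.
have g0 : 0 <= 6 * N%:R :> R by rewrite mulr_ge0.
have [B HB] := scaled_contact_bound (mulr_gt0 l0 c'0) (mulr_gt0 C0 v0) (mulr_ge0 (ltW C0) J0)
  (powR_ge0 (6 * N%:R) q0) q01 q0P subcritical.
(* Half this radius exceeds [R0], which keeps the contact point in the exterior domain, and exceeds
   [6 N M], which makes the gradient bound at most 1. *)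
exists B, (2 * (R0 + 1 + 6 * N%:R * M)); split.
  by rewrite mulr_gt0// !addr_gt0// mulr_gt0.
move=> x0 hx0 ux0; set r := enorm x0 / 2.
have xE : enorm x0 = 2 * r by rewrite /r mulrCA divff ?mulr1.
have gM : 0 <= 6 * N%:R * M by rewrite mulr_ge0// ltW.
have rbig : R0 + 1 + 6 * N%:R * M <= r by rewrite /r ler_pdivlMr// mulrC.
clearbody r.
have [r0 rR0 rM] : [/\ 0 < r, R0 < r & 6 * N%:R * M <= r].
  by move: (R00) gM rbig; move: (6 * N%:R * M) => Z *; split; lra.
have ri0 : 0 <= r^-1 by rewrite invr_ge0 ltW.
pose W (x : 'rV[R]_N) := M * bumpf (r^-1 *: (x - x0)).
(* As [|x0| = 2r], this annulus about the origin contains the ball of radius [r] about [x0], off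
   which the bump vanishes. *)
have [] := @touch R N _ u W x0 (@annulus_compact R N r (3 * r)) u0.
- move=> x /andP[rx _]; split; first exact: (supersolution_continuous hu (lt_le_trans rR0 rx)).
  have cl : {for x, continuous (fun z : 'rV[R]_N => r^-1 *: (z - x0))}.
    exact: (cvgZl_tmp (cvgB cvg_id (cvg_cst x0))).
  exact: (cvgM (cvg_cst M) (continuous_comp cl (@bump_continuous R N _))).
- move=> x nK; rewrite /W bump_outside ?mulr0//.
  rewrite enormZ ger0_norm// mulrC ler_pdivlMr// mul1r leNgt; apply/negP => h; apply: nK.
  have h1 := enormD (x - x0) x0; have h2 := enormD (- (x - x0)) x; move: h1 h2.
  rewrite subrK opprB subrK -opprB enormN xE => h1 h2.
  by apply/andP; split; lra.
- by rewrite /W subrr scaler0 bump0 mulr1.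
move=> t [y [/andP[t0 t1] /andP[ry yr] Ey Hy]].
exists y; first by rewrite ry yr.
pose T0 := t * M; have T00 : 0 < T0 by exact: mulr_gt0.
have T0M : T0 <= M by rewrite ler_piMl// ltW.
have Ey' : u y = T0 * bumpf (r^-1 *: (y - x0)) by rewrite -Ey /W mulrA.
have Hy' x : T0 * bumpf (r^-1 *: (x - x0)) <= u x by rewrite -mulrA; exact: Hy.
set b := r^-1 *: (y - x0) in Ey'.
have a0 : 0 < 1 - sqnorm b.
  rewrite ltNge; apply/negP => h; have := u0 y.
  by rewrite Ey' /bumpf (max_idPl h) expr0n mulr0 ltxx.
have [C2 wL sup] := hu.
have ey : exterior R0 y := lt_le_trans rR0 ry.
have L := HL C R0 r T0 u x0 y (ltW C0) C2 wL ey r0 (ltW T00) (ltW a0) Ey' Hy'.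
rewrite -/b in L; set a := 1 - sqnorm b in a0 L.
have a1 : a <= 1 by rewrite gerBl sqnorm_ge0.
have uE : u y = T0 * a ^+ 2 by rewrite Ey' bumpE// ltW.
have uM : u y <= M.
  by rewrite uE; apply: le_trans T0M; rewrite ler_piMr ?(ltW T00)// expr_le1// ltW.
have G : enorm (grad u y) <= 6 * N%:R * (T0 * a / r).
  rewrite (_ : 6 * N%:R * (T0 * a / r) = N%:R * (6 * T0 * a / r)); last by ring.
  apply: (grad_le _ r0); first by move=> i; have [_ D1 _] := C2 y ey; have [] := D1 i.
  move=> h hr; apply: le_trans (Hy' (y + h)).
  rewrite Ey' (_ : r^-1 *: (y + h - x0) = b + r^-1 *: h); last by rewrite addrAC scalerDr.
  have eh : enorm (r^-1 *: h) = r^-1 * enorm h by rewrite enormZ ger0_norm.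
  have := @bump_lower R N b (r^-1 *: h) (ltW a0).
  rewrite eh => /(_ _)/(ler_wpM2l (ltW T00)).
  rewrite mulrC ler_pdivrMr ?mul1r// => /(_ (ltW hr)).
  by rewrite -/a; lra.
have gr0 : 0 <= 6 * N%:R * (T0 * a / r) := le_trans (enorm_ge0 _) G.
have gr1 : 6 * N%:R * (T0 * a / r) <= 1.
  rewrite mulrA ler_pdivrMr// mul1r; apply: le_trans rM; rewrite ler_wpM2l//.
  by apply: le_trans T0M; rewrite ler_piMr// ltW.
have gr00 : 0 < 6 * N%:R * (T0 * a / r).
  by apply: mulr_gt0; [exact: mulr_gt0|apply: divr_gt0 => //; exact: mulr_gt0].
(* The gradient bound is at most 1, so lowering the exponent from [q] to the scale-invariant [q0]
   only increases its power. *)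
have Gq : enorm (grad u y) `^ q <= (6 * N%:R * (T0 * a / r)) `^ q0.
  apply: (@le_trans _ _ ((6 * N%:R * (T0 * a / r)) `^ q)).
    by apply: ge0_ler_powR G; rewrite ?nnegrE ?enorm_ge0//; have := hq; have := q01; rewrite /q0; lra.
  by apply: ger_powR; [rewrite gr00|exact: ltW].
have uy : 0 < u y <= M by rewrite u0.
have main : lambda * (c' * (T0 * a ^+ 2) `^ P) <=
    C * (T0 * r `^ (- (2 * s)) * (J * a - v)) + (6 * N%:R * (T0 * a / r)) `^ q0.
  apply: (@le_trans _ _ (lambda * f (u y))).
    by rewrite ler_wpM2l ?(ltW l0)// -uE; exact: Hc'.
  by apply: (le_trans (sup y ey)); exact: lerD.
have TT0 : 0 < T0 * r `^ sigma by rewrite mulr_gt0// powR_gt0.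
have a01 : 0 < a <= 1 by rewrite a0.
apply: le_trans (HB _ _ TT0 a01 (scaled_inequality r0 (ltW T00) (ltW a0) g0 main)).
by rewrite mulrC uE mulrAC ler_piMr ?(ltW TT0)// expr_le1// ltW.
Qed.

Lemma far_lower_bound M : 0 < M -> exists r, forall x, r <= enorm x -> M < u x.
Proof.
move=> M0; have [B [r1 [r10 HB]]] := contact_bound M0.
(* [3^sigma] makes up for [|y| <= 3 |x|/2], so that [(|x|/2)^sigma u(y)] reaches at least [|B| + 1],
   above the bound [B]. *)
have M'0 : 0 < 3 `^ sigma * (`|B| + 1).
  by rewrite mulr_gt0 ?powR_gt0// ltr_wpDl.
have [r2 Hr2] := improved_lower_bound hs hN C0 l0 R00 f0 hu u0 hq c0 delta0 fc f_mono M'0.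
exists (Num.max r1 (2 * `|r2|)) => x; rewrite ge_max => /andP[h1 h2].
rewrite ltNge; apply/negP => uM; have [y /andP[y1 y2]] := HB x h1 uM.
have x0 : 0 < enorm x := lt_le_trans r10 h1.
have z0 : 0 < enorm x / 2 by exact: divr_gt0.
have y0 : 0 < enorm y := lt_le_trans z0 y1.
apply/negP; rewrite -ltNge.
have := Hr2 y _; have -> : r2 <= enorm y.
  by apply: le_trans y1; apply: (le_trans (ler_norm _)); rewrite ler_pdivlMr// mulrC.
move/(_ isT) => hy; apply: lt_le_trans (ler_wpM2l (powR_ge0 _ sigma) hy).
apply: (@lt_le_trans _ _ (`|B| + 1)); first by rewrite (le_lt_trans (ler_norm B))// ltrDl.
rewrite /pw powRN [leRHS](_ : _ = (3 * (enorm x / 2)) `^ sigma * (`|B| + 1) / enorm y `^ sigma); last first.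
  by rewrite (powRM _ (ler0n R 3) (ltW z0)); ring.
rewrite mulrAC ler_peMl ?addr_ge0// ler_pdivlMr ?powR_gt0// mul1r.
by rewrite ge0_ler_powR ?nnegrE ?(mulr_ge0 (ler0n R 3) (ltW z0)) ?(ltW y0) ?(ltW sigma0).
Qed.

End far_contact.

(** * From the lower limit of [f] to the theorem *)

Lemma limf_einf_at_right_gt0 {R : realType} (g : R -> R) :
  (0 < limf_einf (fun t => (g t)%:E) 0^'+)%E ->
  exists c delta, [/\ 0 < c, 0 < delta & forall t, 0 < t <= delta -> c <= g t].
Proof.
rewrite limf_einfE => /ereal_sup_gt[_ [V [e /= e0 HV] <-] hV].
have [c c0 hc] : exists2 c : R, 0 < c & (c%:E <= ereal_inf [set (g t)%:E | t in V])%E.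
  move: hV; case: (ereal_inf _) => [m| |] //; last by exists 1; rewrite ?ltr01 ?leey.
  by rewrite lte_fin => m0; exists m.
(* Half of [e], because the neighbourhood is an open ball while [t = delta] is allowed. *)
exists c, (e / 2); split=> //; first exact: divr_gt0.
move=> t /andP[t0 te]; rewrite -lee_fin; apply: (le_trans hc).
apply: ereal_inf_lbound; exists t => //; apply: HV => //=.
rewrite sub0r normrN gtr0_norm//; apply: (le_lt_trans te).
by rewrite ltr_pdivrMr// mulr_natr mulr2n ltrDl.
Qed.

Theorem theorem1p2 (R : realType) (N : nat) (C s lambda R0 p q : R) (f : R -> R)
  (hN : (1 <= N)%N) (hC : 0 < C)
  (hs : 1 / 2 < s < 1) (h2s : 1 < 2 * s < N%:R)
  (hlambda : 0 < lambda) (hR0 : 0 < R0)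
  (hp : p = N%:R / (N%:R - 2 * s))
  (hq : N%:R / (N%:R + 1 - 2 * s) < q)
  (f_gt0 : forall t, 0 < t -> 0 < f t)
  (f_cont : {within `]0, +oo[, continuous f})
  (f_ndecr : {in `]0, +oo[ &, {homo f : x y / x <= y}})
  (f_liminf : (0 < limf_einf (fun t : R => (f t / t `^ p)%:E) 0^'+)%E) :
  ~ exists u : 'rV[R]_N -> R,
      [/\ classical_supersolution C s q lambda R0 f u,
          forall x, 0 < u x &
          ~ blows_up_at_infinity u].
Proof.
case: N hN h2s hp hq => // n _ /andP[_ hN] hp hq [u [hu u0 nblow]]; apply: nblow.
have [c [delta [c0 delta0 hc]]] := limf_einf_at_right_gt0 f_liminf.
have fc t : 0 < t <= delta -> c * t `^ (n.+1%:R / (n.+1%:R - 2 * s)) <= f t.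
  move=> td; have /andP[t0 _] := td.
  by rewrite -hp -ler_pdivlMr ?powR_gt0//; exact: hc.
have f_mono t t' : 0 < t -> t <= t' -> f t <= f t'.
  by move=> t0 tt'; apply: f_ndecr; rewrite ?in_itv/= ?andbT// (lt_le_trans t0).
have hq' : n.+1%:R / (n.+1%:R - 2 * s + 1) < q by rewrite addrAC.
apply/cvgryPgt => A.
have [r Hr] := far_lower_bound hs hN hC hlambda hR0 f_gt0 hu u0 hq' c0 delta0 fc f_mono
  (ltr_wpDl (normr_ge0 A) ltr01).
exists r => x rx; apply: le_lt_trans (Hr x (ltW rx)).
by apply: (le_trans (ler_norm A)); rewrite lerDl.
Qed.
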